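(* Let $n\ge3$ and let $K$ be star-shaped in $\mathbb S^n_+$. Then $$\int_{S^{n-1}} \mathrm{vol}(K\cap\xi^\perp)^n\, d\xi\ge c_n\,\mathrm{vol}(K)^n,\qquad c_n=\frac{2\,\Gamma\left(\frac{n+1}2\right)^n}{\Gamma\left(\frac{n}2\right)^{n+1}}.$$ Moreover, the constant $c_n$ is optimal for any fixed volume: for every $v\in(0,\mathrm{vol}(\mathbb S^n_+))$, the infimum of $\mathrm{vol}(K)^{-n}\int_{S^{n-1}} \mathrm{vol}(K\cap\xi^\perp)^n\, d\xi$ over star-shaped sets $K\subset\mathbb S^n_+$ with $\mathrm{vol}(K)=v$ equals $c_n$.
   Context: $\mathbb S^n_+$ is the closed upper hemisphere of the unit sphere in $\mathbb R^{n+1}$, with its geodesic distance $\mathrm d$; the origin $o$ is the center (pole) of the hemisphere. $S^{n-1}$ is the unit sphere in $T_o\mathbb S^n_+$ with its unnormalized surface measure $d\xi$. For $\xi\in S^{n-1}$, $\xi^\perp$ is the totally geodesic hypersurface of $\mathbb S^n_+$ through $o$ with normal $\xi$ at $o$. A set $K$ is star-shaped if every geodesic through $o$ meets $K$ in a connected segment containing $o$; its radial function $\rho_K(\xi)\in[0,\pi/2]$ is the supremum of $\mathrm d(x,o)$ over $x\in K$ on the geodesic ray from $o$ in direction $\xi$ (assumed measurable, but not necessarily continuous or positive). $\mathrm{vol}$ is the spherical Riemannian volume in the appropriate dimension, so $$\mathrm{vol}(K)=\int_{S^{n-1}}\int_0^{\rho_K(\theta)}\sin^{n-1}t\,dt\,d\theta,\qquad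 \mathrm{vol}(K\cap\xi^\perp)=\int_{S^{n-1}\cap\xi^\perp}\int_0^{\rho_K(\theta)}\sin^{n-2}t\,dt\,d\theta.$$ *)

(* Defs.v *)
From HB Require Import structures.
From mathcomp Require Import all_boot all_order all_algebra.
From mathcomp Require Import all_classical all_reals all_analysis.
From mathcomp Require Import measurable_realfun.

Set Implicit Arguments.
Unset Strict Implicit.
Unset Printing Implicit Defensive.

Import Order.TTheory GRing.Theory Num.Theory.
Import numFieldNormedType.Exports.

Local Open Scope classical_set_scope.
Local Open Scope ring_scope.

(* R^n is [n.-tuple R], which carries the product Borel sigma-algebra. *)
Section euclidean.
Context {R : realType}.

Definition dot n (x y : n.-tuple R) : R := \sum_(i < n) tnth x i * tnth y i.

Definition enorm n (x : n.-tuple R) : R := Num.sqrt (dot x x).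

Definition tscale n (a : R) (x : n.-tuple R) : n.-tuple R :=
  [tuple a * tnth x i | i < n].

Definition tsub n (x y : n.-tuple R) : n.-tuple R :=
  [tuple tnth x i - tnth y i | i < n].

Definition normalize n (x : n.-tuple R) : n.-tuple R :=
  tscale (enorm x)^-1 x.

(* Orthogonal projection onto the hyperplane normal to the unit vector xi. *)
Definition hproj n (xi x : n.-tuple R) : n.-tuple R :=
  tsub x (tscale (dot x xi) xi).

(* [usphere n] is S^(n-1), the unit sphere of R^n. *)
Definition usphere n : set (n.-tuple R) := [set x | enorm x = 1].

Definition orth n (xi : n.-tuple R) : set (n.-tuple R) :=
  [set x | dot x xi = 0].

Lemma measurable_dot d (T : measurableType d) n (f g : T -> n.-tuple R) :
  measurable_fun setT f -> measurable_fun setT g ->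
  measurable_fun setT (fun x => dot (f x) (g x)).
Proof.
move=> /measurable_fun_tnthP mf /measurable_fun_tnthP mg.
by apply: measurable_sum => i; apply: measurable_funM; [exact: mf|exact: mg].
Qed.

Lemma measurable_enorm n : measurable_fun setT (@enorm n).
Proof.
have msqrt : measurable_fun setT (@Num.sqrt R).
  by apply: continuous_measurable_fun; exact: sqrt_continuous.
by apply: (measurableT_comp msqrt); apply: measurable_dot; exact: measurable_id.
Qed.

Lemma measurable_tscale d (T : measurableType d) n (a : T -> R)
    (f : T -> n.-tuple R) :
  measurable_fun setT a -> measurable_fun setT f ->
  measurable_fun setT (fun x => tscale (a x) (f x)).
Proof.
move=> ma /measurable_fun_tnthP mf; apply/measurable_fun_tnthP => i.
rewrite (_ : _ \o _ = fun x => a x * tnth (f x) i); last first.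
  by apply/funext => x /=; rewrite tnth_mktuple.
by apply: measurable_funM => //; exact: mf.
Qed.

Lemma measurable_normalize n : measurable_fun setT (@normalize n).
Proof.
apply: measurable_tscale; last exact: measurable_id.
rewrite (_ : (fun x => _) = (@powR R ^~ (-1)) \o @enorm n); last first.
  by apply/funext => x /=; rewrite powR_inv1// sqrtr_ge0.
by apply: measurableT_comp; [exact: measurable_powR|exact: measurable_enorm].
Qed.

Lemma measurable_hproj n (xi : n.-tuple R) : measurable_fun setT (hproj xi).
Proof.
apply/measurable_fun_tnthP => i.
rewrite (_ : _ \o _ = fun x => tnth x i - dot x xi * tnth xi i); last first.
  by apply/funext => x /=; rewrite !tnth_mktuple.
apply: measurable_funB; first exact: measurable_tnth.
apply: measurable_funM; last exact: measurable_cst.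
by apply: measurable_dot; [exact: measurable_id|exact: measurable_cst].
Qed.

End euclidean.
Arguments usphere {R} n.

Section lebesgue_tuple.
Context {R : realType}.

Definition tcons n (p : measurableTypeR R * n.-tuple R) : n.+1.-tuple R :=
  [tuple of p.1 :: p.2].

Definition tuncons n (x : n.+1.-tuple R) : measurableTypeR R * n.-tuple R :=
  (thead x, [tuple of behead x]).

Lemma measurable_tcons n : measurable_fun setT (@tcons n).
Proof.
apply: (@measurable_cons _ _ (measurableTypeR R * n.-tuple R)%type R fst n snd).
- exact: (@measurable_fst _ _ (measurableTypeR R) (n.-tuple R)).
- exact: measurable_snd.
Qed.

Lemma measurable_tuncons n : measurable_fun setT (@tuncons n).
Proof.
apply/measurable_fun_pairP; split; last exact: measurable_behead.
exact: (@measurable_tnth _ R n.+1 ord0).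
Qed.

Section step.
Variables (n : nat) (m : {sigma_finite_measure set (n.-tuple R) -> \bar R}).

Definition lebesgueS : set (n.+1.-tuple R) -> \bar R :=
  pushforward (lebesgue_measure \x m)%E (@tcons n).

Let P : {measure set (measurableTypeR R * n.-tuple R)%type -> \bar R} :=
  (lebesgue_measure \x m)%E.

Let M : {measure set (n.+1.-tuple R) -> \bar R} :=
  measure_function_pushforward__canonical__measure_function_Measure
    P (@measurable_tcons n).

HB.instance Definition _ := isMeasure.Build _ _ _ lebesgueS
  (measure0 M) (measure_ge0 M) (@measure_semi_sigma_additive _ _ _ M).

Let lebesgueS_sigma_finite : sigma_finite setT lebesgueS.
Proof.
have /sigma_finiteP[F [TF ndF Foo]] := sigma_finiteT (@lebesgue_measure R).
have /sigma_finiteP[G [TG ndG Goo]] := sigma_finiteT m.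
exists (fun k => @tuncons n @^-1` (F k `*` G k)) => [|k].
  rewrite predeqE => x; split => // _.
  have [i _ Fi] : (\bigcup_k F k) (thead x) by rewrite -TF.
  have [j _ Gj] : (\bigcup_k G k) [tuple of behead x] by rewrite -TG.
  exists (maxn i j) => //; split => /=.
  - by move: Fi; exact/subsetPset/ndF/leq_maxl.
  - by move: Gj; exact/subsetPset/ndG/leq_maxr.
have [mF Fkoo] := Foo k; have [mG Gkoo] := Goo k.
have mFG : measurable (F k `*` G k) by exact: measurableX.
split.
  by rewrite -[X in measurable X]setTI; exact: measurable_tuncons.
rewrite /lebesgueS /pushforward -comp_preimage.
have -> : @tuncons n \o @tcons n = id.
  by apply/funext => -[a y]; congr pair => //; exact/val_inj.
by rewrite preimage_id product_measure1E// lte_mul_pinfty// ge0_fin_numE.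
Qed.

HB.instance Definition _ :=
  Measure_isSigmaFinite.Build _ _ _ lebesgueS lebesgueS_sigma_finite.

End step.

(* Lebesgue measure on R^n, as an iterated product measure. *)
Fixpoint lebesgue_tuple n :
    {sigma_finite_measure set (n.-tuple R) -> \bar R} :=
  match n with
  | 0 => \d_([tuple] : 0.-tuple R)
  | k.+1 => lebesgueS (lebesgue_tuple k)
  end.

End lebesgue_tuple.

Section surface_measure.
Context {R : realType} (n : nat).
Local Open Scope ereal_scope.

Section cone.
Variables (c : {nonneg R}%R) (D : set (n.-tuple R)) (mD : measurable D).
Variables (f : n.-tuple R -> n.-tuple R) (mf : measurable_fun setT f).

Let M0 : {measure set (n.-tuple R) -> \bar R} :=
  mrestr (lebesgue_tuple n) mD.

Let M1 : {measure set (n.-tuple R) -> \bar R} :=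
  measure_function_pushforward__canonical__measure_function_Measure M0 mf.

Definition cone_measure : {measure set (n.-tuple R) -> \bar R} := mscale c M1.

End cone.

Definition punctured_ball : set (n.-tuple R) := [set x | 0 < enorm x <= 1]%R.

Lemma measurable_punctured_ball : measurable punctured_ball.
Proof.
rewrite (_ : punctured_ball = setT `&` @enorm R n @^-1` `]0%R, 1%R]).
  by apply: measurable_enorm.
by rewrite setTI; apply/seteqP; split => x /=; rewrite in_itv.
Qed.

(* Surface measure of S^(n-1), normalized through the cone over a subset A of
   the sphere: in polar coordinates the volume of {r a | 0 < r <= 1, a in A}
   is the area of A times the integral of r^(n-1) on [0, 1], i.e. 1/n. *)
Definition sphere_measure : set (n.-tuple R) -> \bar R := fun A =>
  n%:R%:E * lebesgue_tuple n (@normalize R n @^-1` A `&` punctured_ball).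

Let S : {measure set (n.-tuple R) -> \bar R} :=
  cone_measure (n%:R%:nng)%R measurable_punctured_ball (@measurable_normalize R n).

HB.instance Definition _ := isMeasure.Build _ _ _ sphere_measure
  (measure0 S) (measure_ge0 S) (@measure_semi_sigma_additive _ _ _ S).

Section subsphere.
Variable xi : n.-tuple R.

Definition punctured_cylinder : set (n.-tuple R) :=
  [set x | punctured_ball (hproj xi x) /\ (0 <= dot x xi <= 1)%R].

Lemma measurable_punctured_cylinder : measurable punctured_cylinder.
Proof.
rewrite (_ : punctured_cylinder =
    (setT `&` hproj xi @^-1` punctured_ball) `&`
    (setT `&` (fun x => dot x xi) @^-1` `[0%R, 1%R])).
  apply: measurableI.
    exact: measurable_hproj measurable_punctured_ball.
  have mdot : measurable_fun setT (fun x : n.-tuple R => dot x xi).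
    by apply: measurable_dot; [exact: measurable_id|exact: measurable_cst].
  exact: mdot.
by rewrite !setTI; apply/seteqP; split => x /=; rewrite in_itv.
Qed.

(* For a unit vector xi, surface measure of the (n-2)-dimensional sphere
   S^(n-1) `&` orth xi. The (n-1)-dimensional Lebesgue measure of a subset C of
   orth xi is the n-dimensional measure of the cylinder C + [0, 1] xi of height
   one; C is here the cone {r a | 0 < r <= 1, a in A}, which accounts for the
   factor n - 1 as in [sphere_measure]. *)
Definition subsphere_measure : set (n.-tuple R) -> \bar R := fun A =>
  n.-1%:R%:E * lebesgue_tuple n
    ((@normalize R n \o hproj xi) @^-1` A `&` punctured_cylinder).

Let S' : {measure set (n.-tuple R) -> \bar R} :=
  cone_measure (n.-1%:R%:nng)%R measurable_punctured_cylinder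
    (measurableT_comp (@measurable_normalize R n) (measurable_hproj xi)).

HB.instance Definition _ := isMeasure.Build _ _ _ subsphere_measure
  (measure0 S') (measure_ge0 S') (@measure_semi_sigma_additive _ _ _ S').

End subsphere.
End surface_measure.
Arguments sphere_measure {R} n.

(* The sphere S^n lies in R^(n+1) = R x R^n, the first coordinate being the
   height; T_o is identified with R^n. *)
Section hemisphere.
Context {R : realType} (n : nat).

Definition hemisphere : set (n.+1.-tuple R) :=
  [set x | usphere n.+1 x /\ 0 <= thead x].

Definition pole : n.+1.-tuple R := [tuple of 1 :: nseq n 0].

Definition sdist (x y : n.+1.-tuple R) : R := acos (dot x y).

(* The unit speed geodesic from the pole in direction theta (the exponential
   map at the pole, applied to t theta). *)
Definition geod (theta : n.-tuple R) (t : R) : n.+1.-tuple R :=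
  [tuple of cos t :: tscale (sin t) theta].

(* The totally geodesic hypersurface through the pole with normal xi. *)
Definition perp (xi : n.-tuple R) : set (n.+1.-tuple R) :=
  [set x | hemisphere x /\ dot [tuple of behead x] xi = 0].

(* The geodesic of the closed hemisphere through the pole with direction theta
   is parametrized by [-pi/2, pi/2]. *)
Definition star_shaped (K : set (n.+1.-tuple R)) : Prop :=
  K `<=` hemisphere /\
  forall theta, usphere n theta ->
    let I := [set t | t \in `[- (pi / 2), pi / 2] /\ K (geod theta t)] in
    is_interval I /\ I 0.

Definition ray (theta : n.-tuple R) : set (n.+1.-tuple R) :=
  geod theta @` `[0, pi / 2].

Definition radial (K : set (n.+1.-tuple R)) (theta : n.-tuple R) : R :=
  sup [set sdist x pole | x in K `&` ray theta].

Local Open Scope ereal_scope.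

(* Riemannian volume of a subset of the closed hemisphere, in geodesic polar
   coordinates (t, theta) at the pole, where the metric is
   dt^2 + sin^2 t dtheta^2. *)
Definition vol (E : set (n.+1.-tuple R)) : \bar R :=
  \int[sphere_measure n]_(theta in usphere n)
    \int[lebesgue_measure]_(t in `[0%R, (pi / 2)%R])
      (\1_E (geod theta t) * sin t ^+ n.-1)%:E.

(* Likewise, (n-1)-dimensional Riemannian volume of a subset of [perp xi]. *)
Definition hvol (xi : n.-tuple R) (E : set (n.+1.-tuple R)) : \bar R :=
  \int[subsphere_measure xi]_(theta in usphere n `&` orth xi)
    \int[lebesgue_measure]_(t in `[0%R, (pi / 2)%R])
      (\1_E (geod theta t) * sin t ^+ n.-2)%:E.

Definition section_integral (K : set (n.+1.-tuple R)) : \bar R :=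
  \int[sphere_measure n]_(xi in usphere n) (hvol xi (K `&` perp xi)) ^+ n.

End hemisphere.
Arguments hemisphere {R} n.

Section constant.
Context {R : realType}.

(* Euler's Gamma function, for s > 0. *)
Definition Gamma (s : R) : R :=
  \int[lebesgue_measure]_(x in `]0, +oo[) (x `^ (s - 1) * expR (- x)).

Definition c_ (n : nat) : R :=
  2 * Gamma (n.+1%:R / 2) ^+ n / Gamma (n%:R / 2) ^+ n.+1.

End constant.

(* Main.v *)
Require Import Defs.
From mathcomp Require Import all_boot all_order all_algebra.
From mathcomp Require Import all_classical all_reals all_analysis.
From mathcomp Require Import measurable_realfun zify ring lra.

Set Implicit Arguments.
Unset Strict Implicit.
Unset Printing Implicit Defensive.

Import Order.TTheory GRing.Theory Num.Theory.
Import numFieldNormedType.Exports.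
Local Open Scope classical_set_scope.
Local Open Scope ring_scope.

(** The theorem is an intersection inequality of Busemann type, for which the
    whole hemisphere is extremal.

    Let S be the unit sphere of R^n, rho the radial function of K, and let
    [seg j r] be the integral of sin^j over [[0, r]]. In geodesic polar
    coordinates at the pole the volume of K is the integral of
    [seg (n - 1) (rho theta)] over S ([vol_radial_seg]), and the volume of the
    section by the hypersurface normal to xi is the integral of
    [seg (n - 2) (rho theta)] over the great subsphere normal to xi
    ([hvol_radial_seg]).

    The inequality. When xi is averaged over S, the section volumes average to
    a fixed multiple of the integral of [seg (n - 2) (rho theta)] over S: this
    is the polar formula for the Funk transform ([funk]). As the sine is
    increasing on [[0, pi / 2]], the ratio of [seg (n - 1) r] to
    [seg (n - 2) r] is largest at [r = pi / 2] ([seg_ratio]), so the mean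
    section volume is at least a constant times vol(K); the power mean
    inequality ([power_mean]) then gives the bound on the mean of the n-th
    powers. Each step is an equality for the whole hemisphere, so the constant
    is the value of the quotient there, which [c_E] compares with the expression
    in terms of Gamma: the volume of the unit ball enters through the Gaussian
    integral ([ball_vol_gamma]) and through slicing ([ball_vol_rec]).

    The Funk formula is obtained without the rotation group. Writing the
    hyperplanes as graphs over a coordinate hyperplane, the integral
    of [P y * G z] over the pairs of orthogonal vectors [(y, z)] of R^n takes an
    explicit form, in which the exchange of [y] and [z] is the inversion of
    a single real parameter ([incidence_integral_sym]). For a radial [P] the
    inner integral over [y] is the same constant for every [z], so the average
    of hyperplane integrals of [G] is proportional to the integral of [G]
    ([funk_proportional]), and the factor is found with [G] constant on the
    unit ball.

    Optimality. Equality requires rho to take only the values 0 and [pi / 2],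
    and all the sections to have the same volume. Both hold asymptotically
    for the cone over the set of directions where the fractional part of
    [(m + 1) * x_1 / x_2] is less than [b]: as m grows it fills the proportion
    [b] of S and of almost every great subsphere ([perp_osc_cvg],
    [sphere_osc_cvg]), because along lines it is a periodic pattern of small
    period ([oscillation_upper], [oscillation_lower]). To reach a given volume
    v, take [b] slightly larger than the proportion of v in the volume of the
    hemisphere, take m large, and cut the cone at the distance from the pole
    for which the volume is v; cutting only decreases the sections, so the
    quotient stays close to the constant ([osc_cone_optimal]). *)

(** * Affine changes of variable on the line *)

Section affine.
Context {R : realType}.
Notation L := (@lebesgue_measure R).
Local Open Scope ereal_scope.

Lemma measurable_affine (c d : R) :
  measurable_fun setT ((fun t => c * t + d)%R : measurableTypeR R -> measurableTypeR R).
Proof.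
apply: measurable_funD; last exact: measurable_cst.
by apply: measurable_funM; [exact: measurable_cst|exact: measurable_id].
Qed.

(** Lebesgue measure is determined by the lengths of half-open intervals, so
    it is enough to compute the lengths of their preimages, according to the
    sign of [c]. *)
Lemma ge0_integral_affine (f : R -> \bar R) (c d : R) : c != 0%R ->
  measurable_fun setT f -> (forall x, 0 <= f x) ->
  \int[L]_t f (c * t + d)%R = (`|c|^-1)%:E * \int[L]_t f t.
Proof.
move=> c0 mf f0.
pose phi : measurableTypeR R -> measurableTypeR R := fun t => (c * t + d)%R.
have mphi : measurable_fun setT phi by exact: measurable_affine.
have cp : (0 < `|c|)%R by rewrite normr_gt0.
pose M : {measure set (measurableTypeR R) -> \bar R} :=
  measure_function_pushforward__canonical__measure_function_Measure L mphi.
pose M' : {measure set (measurableTypeR R) -> \bar R} :=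
  mscale (NngNum (normr_ge0 c)) M.
have LM A : measurable A -> L A = M' A.
  apply: lebesgue_measure_unique => _ [[a b]] _ <-.
  transitivity (`|c|%:E * L (phi @^-1` `]a, b])); last by [].
  have [c1|c1|] := ltgtP c 0%R; last by move/eqP: c0.
  - have -> : phi @^-1` `]a, b] = `[((b - d) / c)%R, ((a - d) / c)%R[%classic.
      apply/seteqP; split => t /=; rewrite !in_itv/= /phi => /andP[h1 h2];
        apply/andP; split.
      + by rewrite ler_ndivrMr//; lra.
      + by rewrite ltr_ndivlMr//; lra.
      + by move: h2; rewrite ltr_ndivlMr//; lra.
      + by move: h1; rewrite ler_ndivrMr//; lra.
    rewrite !lebesgue_measure_itv/= !lte_fin.
    rewrite ltr_nM2r ?invr_lt0// ltrD2r ltr0_norm//.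
    case: ifPn => // ab; rewrite ?mule0//.
    by rewrite -!EFinB -EFinM; congr EFin; field.
  - have -> : phi @^-1` `]a, b] = `]((a - d) / c)%R, ((b - d) / c)%R]%classic.
      apply/seteqP; split => t /=; rewrite !in_itv/= /phi => /andP[h1 h2];
        apply/andP; split.
      + by rewrite ltr_pdivrMr//; lra.
      + by rewrite ler_pdivlMr//; lra.
      + by move: h1; rewrite ltr_pdivrMr//; lra.
      + by move: h2; rewrite ler_pdivlMr//; lra.
    rewrite !lebesgue_measure_itv/= !lte_fin.
    rewrite ltr_pM2r ?invr_gt0// ltrD2r gtr0_norm//.
    case: ifPn => // ab; rewrite ?mule0//.
    by rewrite -!EFinB -EFinM; congr EFin; field.
rewrite (@eq_measure_integral _ _ _ setT M' L f); last by move=> A mA _; exact: LM.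
rewrite ge0_integral_mscale//= muleA -EFinM mulVf ?gt_eqF// mul1e.
by rewrite ge0_integral_pushforward.
Qed.

Lemma ge0_integral_translate (f : R -> \bar R) (d : R) :
  measurable_fun setT f -> (forall x, 0 <= f x) ->
  \int[L]_t f (t + d)%R = \int[L]_t f t.
Proof.
move=> mf f0; have := @ge0_integral_affine f 1%R d (oner_neq0 _) mf f0.
by under eq_integral do rewrite mul1r; rewrite normr1 invr1 mul1e.
Qed.

Lemma ge0_integral_dilate (f : R -> \bar R) (c : R) : c != 0%R ->
  measurable_fun setT f -> (forall x, 0 <= f x) ->
  \int[L]_t f (c * t)%R = (`|c|^-1)%:E * \int[L]_t f t.
Proof.
move=> c0 mf f0; rewrite -(@ge0_integral_affine f c 0%R c0 mf f0).
by apply: eq_integral => t _; rewrite addr0.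
Qed.

Lemma measurable_invr : measurable_fun setT (@GRing.inv R).
Proof.
(* [powR] is measurable on the whole line, and gives the inverse of the
   nonnegative [`|x|], including the convention that the inverse of 0 is 0. *)
rewrite (_ : @GRing.inv R = fun x => (x * (`|x| `^ (-1)) ^+ 2)%R); last first.
  apply/funext => x; rewrite powR_inv1// exprVn real_normK ?num_real//.
  have [->|x0] := eqVneq x 0%R; first by rewrite invr0 mul0r.
  by rewrite expr2; field.
apply: measurable_funM; first exact: measurable_id.
apply: measurable_funX.
exact: (measurableT_comp (measurable_powR (-1)) (@normr_measurable R setT)).
Qed.

End affine.

(** * Iterated integrals on R^n *)

Section tuple_integral.
Context {R : realType}.
Notation L := (@lebesgue_measure R).
Notation lam n := (@lebesgue_tuple R n).
Local Open Scope ereal_scope.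

Lemma integral_tupleS n (f : n.+1.-tuple R -> \bar R) :
  measurable_fun setT f -> (forall x, 0 <= f x) ->
  \int[lam n.+1]_x f x = \int[L]_a \int[lam n]_x f (tcons (a, x)).
Proof.
move=> mf f0.
have mt := @measurable_tcons R n.
rewrite /= (_ : \int[_]_x f x =
  \int[pushforward (L \x lam n) (@tcons R n)]_x f x)//.
rewrite ge0_integral_pushforward//= preimage_setT.
rewrite fubini_tonelli1//; exact: measurableT_comp mf mt.
Qed.

Lemma integral_tupleS_swap n (f : n.+1.-tuple R -> \bar R) :
  measurable_fun setT f -> (forall x, 0 <= f x) ->
  \int[lam n.+1]_x f x = \int[lam n]_x \int[L]_a f (tcons (a, x)).
Proof.
move=> mf f0; rewrite integral_tupleS//.
rewrite (@fubini_tonelli _ _ _ _ R L (lam n) (fun p => f (tcons p)))//.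
exact: measurableT_comp mf (@measurable_tcons R n).
Qed.

Lemma integral_tuple0 (f : 0.-tuple R -> \bar R) :
  measurable_fun setT f -> \int[lam 0]_x f x = f [tuple].
Proof. by move=> mf; rewrite integral_dirac// diracT mul1e. Qed.

End tuple_integral.

(** * Vector algebra on tuples *)

Section tuple_algebra.
Context {R : realType}.
Implicit Types (a b c : R).

Definition tbehead n (x : n.+1.-tuple R) : n.-tuple R := [tuple of behead x].

Lemma tcons_eta n (x : n.+1.-tuple R) :
  x = tcons (thead x, tbehead x).
Proof. by rewrite [LHS]tuple_eta; exact/val_inj. Qed.

Lemma thead_tcons n a (x : n.-tuple R) : thead (tcons (a, x)) = a.
Proof. by []. Qed.

Lemma behead_tcons n a (x : n.-tuple R) : tbehead (tcons (a, x)) = x.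
Proof. exact/val_inj. Qed.

Lemma tnth_tcons0 n a (x : n.-tuple R) : tnth (tcons (a, x)) ord0 = a.
Proof. by []. Qed.

Lemma tnth_tconsS n a (x : n.-tuple R) i :
  tnth (tcons (a, x)) (lift ord0 i) = tnth x i.
Proof. by rewrite /tcons /= tnthS. Qed.

Lemma dot_tcons n a b (x y : n.-tuple R) :
  dot (tcons (a, x)) (tcons (b, y)) = a * b + dot x y.
Proof.
rewrite /dot big_ord_recl !tnth_tcons0; congr (_ + _).
by apply: eq_bigr => i _; rewrite !tnth_tconsS.
Qed.

Lemma tsub_tcons n a b (x y : n.-tuple R) :
  tsub (tcons (a, x)) (tcons (b, y)) = tcons (a - b, tsub x y).
Proof.
apply: eq_from_tnth => i; rewrite tnth_mktuple.
by case: (unliftP ord0 i) => [j ->|->]; rewrite ?tnth_tcons0// !tnth_tconsS tnth_mktuple.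
Qed.

Lemma tscale_tcons n c a (x : n.-tuple R) :
  tscale c (tcons (a, x)) = tcons (c * a, tscale c x).
Proof.
apply: eq_from_tnth => i; rewrite tnth_mktuple.
by case: (unliftP ord0 i) => [j ->|->]; rewrite ?tnth_tcons0// !tnth_tconsS tnth_mktuple.
Qed.

Lemma dotC n (x y : n.-tuple R) : dot x y = dot y x.
Proof. by apply: eq_bigr => i _; rewrite mulrC. Qed.

Lemma dotZl n c (x y : n.-tuple R) : dot (tscale c x) y = c * dot x y.
Proof. by rewrite /dot mulr_sumr; apply: eq_bigr => i _; rewrite tnth_mktuple mulrA. Qed.

Lemma dotZr n c (x y : n.-tuple R) : dot x (tscale c y) = c * dot x y.
Proof. by rewrite dotC dotZl dotC. Qed.

Lemma dotBl n (x y z : n.-tuple R) : dot (tsub x y) z = dot x z - dot y z.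
Proof.
by rewrite /dot -sumrB; apply: eq_bigr => i _; rewrite tnth_mktuple mulrBl.
Qed.

Lemma dotBr n (x y z : n.-tuple R) : dot z (tsub x y) = dot z x - dot z y.
Proof. by rewrite dotC dotBl !(dotC z). Qed.

Definition dotE := (dot_tcons, dotBl, dotBr, dotZl, dotZr).

Lemma dot_ge0 n (x : n.-tuple R) : 0 <= dot x x.
Proof. by apply: sumr_ge0 => i _; rewrite -expr2 sqr_ge0. Qed.

Lemma enorm_sqr n (x : n.-tuple R) : enorm x ^+ 2 = dot x x.
Proof. by rewrite /enorm sqr_sqrtr// dot_ge0. Qed.

Lemma enorm_ge0 n (x : n.-tuple R) : 0 <= enorm x.
Proof. exact: sqrtr_ge0. Qed.

Lemma enormZ n c (x : n.-tuple R) : enorm (tscale c x) = `|c| * enorm x.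
Proof.
by rewrite /enorm dotZl dotZr mulrA -expr2 sqrtrM ?sqr_ge0// sqrtr_sqr.
Qed.

Lemma tscaleA n a b (x : n.-tuple R) : tscale a (tscale b x) = tscale (a * b) x.
Proof. by apply: eq_from_tnth => i; rewrite !tnth_mktuple mulrA. Qed.

Lemma uspherex n (x : n.-tuple R) : usphere n x -> dot x x = 1.
Proof. by rewrite /usphere /= -enorm_sqr => ->; rewrite expr1n. Qed.

Lemma enorm_normalize n (x : n.-tuple R) : enorm x != 0 -> enorm (normalize x) = 1.
Proof.
by move=> x0; rewrite /normalize enormZ ger0_norm ?invr_ge0 ?enorm_ge0// mulVf.
Qed.

Lemma normalizeZ n c (x : n.-tuple R) : 0 < c -> normalize (tscale c x) = normalize x.
Proof.
move=> c0; rewrite /normalize enormZ gtr0_norm// tscaleA invfM.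
by rewrite mulrAC mulVf ?gt_eqF// mul1r.
Qed.

End tuple_algebra.

(** * Measurability *)

Section measurability.
Context {R : realType} d (X : measurableType d).

Lemma meas_tsub n (f g : X -> n.-tuple R) :
  measurable_fun setT f -> measurable_fun setT g ->
  measurable_fun setT (fun x => tsub (f x) (g x)).
Proof.
move=> /measurable_fun_tnthP mf /measurable_fun_tnthP mg.
apply/measurable_fun_tnthP => i.
rewrite (_ : _ \o _ = fun x => tnth (f x) i - tnth (g x) i); last first.
  by apply/funext => x /=; rewrite tnth_mktuple.
by apply: measurable_funB; [exact: mf|exact: mg].
Qed.

Lemma meas_tcons n (f : X -> R) (g : X -> n.-tuple R) :
  measurable_fun setT f -> measurable_fun setT g ->
  measurable_fun setT (fun x => tcons (f x, g x)).
Proof.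
move=> mf mg; apply: (measurableT_comp (@measurable_tcons R n)).
exact: measurable_fun_pair.
Qed.

Lemma meas_enorm n (f : X -> n.-tuple R) :
  measurable_fun setT f -> measurable_fun setT (fun x => enorm (f x)).
Proof. by move=> mf; exact: measurableT_comp (@measurable_enorm R n) mf. Qed.

Lemma meas_normalize n (f : X -> n.-tuple R) :
  measurable_fun setT f -> measurable_fun setT (fun x => normalize (f x)).
Proof. by move=> mf; exact: measurableT_comp (@measurable_normalize R n) mf. Qed.

Lemma meas_hproj n (f g : X -> n.-tuple R) :
  measurable_fun setT f -> measurable_fun setT g ->
  measurable_fun setT (fun x => hproj (f x) (g x)).
Proof.
move=> mf mg; apply: meas_tsub => //.
by apply: measurable_tscale => //; exact: measurable_dot.
Qed.

Lemma meas_invr (f : X -> R) :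
  measurable_fun setT f -> measurable_fun setT (fun x => (f x)^-1).
Proof. by move=> mf; exact: measurableT_comp measurable_invr mf. Qed.

Lemma meas_normr (f : X -> R) :
  measurable_fun setT f -> measurable_fun setT (fun x => `|f x|).
Proof. by move=> mf; apply: measurableT_comp mf; exact: normr_measurable. Qed.

Lemma meas_thead n (f : X -> n.+1.-tuple R) :
  measurable_fun setT f -> measurable_fun setT (fun x => thead (f x)).
Proof. by move=> /measurable_fun_tnthP/(_ ord0). Qed.

Lemma meas_behead n (f : X -> n.+1.-tuple R) :
  measurable_fun setT f -> measurable_fun setT (fun x => tbehead (f x)).
Proof. by move=> mf; exact: measurableT_comp (@measurable_behead _ R n) mf. Qed.

Lemma meas_EFin (f : X -> R) :
  measurable_fun setT f -> measurable_fun setT (fun x => (f x)%:E).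
Proof. by move=> mf; exact/measurable_EFinP. Qed.

Lemma meas_indic (f : X -> bool) :
  measurable_fun setT f -> measurable_fun setT (fun x => (f x)%:R : R).
Proof.
move=> mf; have -> : (fun x => (f x)%:R : R) = fun x => if f x then 1 else 0.
  by apply/funext => x; case: (f x).
by apply: measurable_fun_ifT => //; exact: measurable_cst.
Qed.

Lemma meas_le (f g : X -> R) : measurable_fun setT f -> measurable_fun setT g ->
  measurable_fun setT (fun x => f x <= g x).
Proof. exact: measurable_fun_ler. Qed.

Lemma meas_lt (f g : X -> R) : measurable_fun setT f -> measurable_fun setT g ->
  measurable_fun setT (fun x => f x < g x).
Proof. exact: measurable_fun_ltr. Qed.

Lemma meas_fst d1 d2 (Y : measurableType d1) (Z : measurableType d2) (f : X -> Y * Z) :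
  measurable_fun setT f -> measurable_fun setT (fun x => (f x).1).
Proof. by move=> mf; exact: measurableT_comp measurable_fst mf. Qed.

Lemma meas_snd d1 d2 (Y : measurableType d1) (Z : measurableType d2) (f : X -> Y * Z) :
  measurable_fun setT f -> measurable_fun setT (fun x => (f x).2).
Proof. by move=> mf; exact: measurableT_comp measurable_snd mf. Qed.

Lemma meas_oppr (f : X -> R) :
  measurable_fun setT f -> measurable_fun setT (fun x => - f x).
Proof. by move=> mf; exact: measurable_funN. Qed.

End measurability.

(** Measurability by following the syntax of the function: each step peels off
    the head operation, whose arguments are captured as functions of the
    variable. *)
Ltac meas1 := cbv beta; lazymatch goal with
 | |- measurable_fun _ (fun x => x) => exact: measurable_id
 | |- measurable_fun _ (fun _ => ?c) => exact: (measurable_cst c)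
 | |- measurable_fun _ (fun x => (@?f x).1) => refine (meas_fst (f := f) _)
 | |- measurable_fun _ (fun x => (@?f x).2) => refine (meas_snd (f := f) _)
 | |- measurable_fun _ (fun x => (@?f x, @?g x)) =>
     refine (measurable_fun_pair (f := f) (g := g) _ _)
 | |- measurable_fun _ (fun x => (@?f x)%:E) => refine (meas_EFin (f := f) _)
 | |- measurable_fun _ (fun x => (@?f x * @?g x)%E) =>
     refine (emeasurable_funM (f := f) (g := g) _ _)
 | |- measurable_fun _ (fun x => (nat_of_bool (@?f x))%:R) =>
     refine (meas_indic (f := f) _)
 | |- measurable_fun _ (fun x => @?f x && @?g x) =>
     refine (measurable_and (f := f) (g := g) _ _)
 | |- measurable_fun _ (fun x => (@?f x <= @?g x)%R) =>
     refine (meas_le (f := f) (g := g) _ _)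
 | |- measurable_fun _ (fun x => (@?f x < @?g x)%R) =>
     refine (meas_lt (f := f) (g := g) _ _)
 | |- measurable_fun _ (fun x => @?f x + @?g x)%R =>
     refine (measurable_funD (f := f) (g := g) _ _)
 | |- measurable_fun _ (fun x => - @?f x)%R =>
     refine (meas_oppr (f := f) _)
 | |- measurable_fun _ (fun x => @?f x * @?g x)%R =>
     refine (measurable_funM (f := f) (g := g) _ _)
 | |- measurable_fun _ (fun x => @?f x ^+ ?n)%R =>
     refine (measurable_funX (f := f) n _)
 | |- measurable_fun _ (fun x => (@?f x)^-1)%R => refine (meas_invr (f := f) _)
 | |- measurable_fun _ (fun x => `|@?f x|)%R => refine (meas_normr (f := f) _)
 | |- measurable_fun _ (fun x => dot (@?f x) (@?g x)) =>
     refine (measurable_dot (f := f) (g := g) _ _)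
 | |- measurable_fun _ (fun x => enorm (@?f x)) => refine (meas_enorm (f := f) _)
 | |- measurable_fun _ (fun x => hproj (@?f x) (@?g x)) =>
     refine (meas_hproj (f := f) (g := g) _ _)
 | |- measurable_fun _ (fun x => normalize (@?f x)) =>
     refine (meas_normalize (f := f) _)
 | |- measurable_fun _ (fun x => tcons (@?f x, @?g x)) =>
     refine (meas_tcons (f := f) (g := g) _ _)
 | |- measurable_fun _ (fun x => tcons (@?f x)) =>
     refine (measurableT_comp (@measurable_tcons _ _) (g := f) _)
 | |- measurable_fun _ (fun x => tsub (@?f x) (@?g x)) =>
     refine (meas_tsub (f := f) (g := g) _ _)
 | |- measurable_fun _ (fun x => tscale (@?f x) (@?g x)) =>
     refine (measurable_tscale (a := f) (f := g) _ _)
 | |- measurable_fun _ (fun x => thead (@?f x)) => refine (meas_thead (f := f) _)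
 | |- measurable_fun _ (fun x => tbehead (@?f x)) => refine (meas_behead (f := f) _)
 | |- measurable_fun _ (@thead _ _) => exact: (meas_thead (f := id))
 | |- measurable_fun _ (@enorm _ _) => exact: measurable_enorm
 | |- measurable_fun _ (@normalize _ _) => exact: measurable_normalize
 | |- measurable_fun _ (@tcons _ _) => exact: measurable_tcons
 | H : measurable_fun setT ?h |- measurable_fun _ (fun x => ?h (@?g x)) =>
     refine (measurableT_comp H (g := g) _)
 | H : measurable_fun setT ?h |- measurable_fun _ ?h => exact: H
 end.
Ltac meas := repeat meas1.

Section iterated_integrals.
Context {R : realType} d1 d2 (X : measurableType d1) (Y : measurableType d2).
Variables (m1 : {sigma_finite_measure set X -> \bar R}).
Variables (m2 : {sigma_finite_measure set Y -> \bar R}).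
Local Open Scope ereal_scope.

Lemma meas_integral (f : X -> Y -> \bar R) :
  measurable_fun setT (fun p : X * Y => f p.1 p.2) -> (forall x y, 0 <= f x y) ->
  measurable_fun setT (fun x => \int[m2]_y f x y).
Proof.
move=> mf f0.
by apply: (@measurable_fun_fubini_tonelli_F _ _ _ _ R m2 (fun p : X * Y => f p.1 p.2)).
Qed.

Lemma tonelli_swap (f : X -> Y -> \bar R) :
  measurable_fun setT (fun p : X * Y => f p.1 p.2) -> (forall x y, 0 <= f x y) ->
  \int[m1]_x \int[m2]_y f x y = \int[m2]_y \int[m1]_x f x y.
Proof.
move=> mf f0.
by apply: (@fubini_tonelli _ _ _ _ R m1 m2 (fun p : X * Y => f p.1 p.2)).
Qed.

End iterated_integrals.

(** * Translations, dilations and rotations of R^n *)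

Section lebesgue_invariance.
Context {R : realType}.
Notation lam n := (@lebesgue_tuple R n).
Local Open Scope ereal_scope.

Lemma integral_tuple_translate n (v : n.-tuple R) (f : n.-tuple R -> \bar R) :
  measurable_fun setT f -> (forall x, 0 <= f x) ->
  \int[lam n]_x f (tsub x v) = \int[lam n]_x f x.
Proof.
elim: n v f => [|n IH] v f mf f0.
  rewrite !integral_tuple0//; last by meas.
  by congr f; apply: eq_from_tnth => -[].
rewrite [v]tcons_eta; move: (thead v) (tbehead v) => b {}v.
do 2 (rewrite integral_tupleS; [|by meas|by []]).
under eq_integral.
  move=> a _; under eq_integral do rewrite tsub_tcons.
  rewrite (IH v (fun x => f (tcons (a - b, x))%R))//; last by meas.
  over.
rewrite (@ge0_integral_translate R (fun a => \int[lam n]_x f (tcons (a, x))) (- b))//.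
- apply: (measurable_fun_fubini_tonelli_F (fun p => f (tcons p))) => //.
  exact: (measurableT_comp mf (@measurable_tcons R n)).
- by move=> x; exact: integral_ge0.
Qed.

Lemma integral_tuple_scale n (c : R) (f : n.-tuple R -> \bar R) : c != 0%R ->
  measurable_fun setT f -> (forall x, 0 <= f x) ->
  \int[lam n]_x f (tscale c x) = ((`|c| ^+ n)^-1)%:E * \int[lam n]_x f x.
Proof.
move=> c0; elim: n f => [|n IH] f mf f0.
  rewrite !integral_tuple0//; last by meas.
  by rewrite expr0 invr1 mul1e; congr f; apply: eq_from_tnth => -[].
have mF : measurable_fun setT (fun a : R => \int[lam n]_x f (tcons (a, x))).
  apply: (measurable_fun_fubini_tonelli_F (fun p => f (tcons p))) => //.
  exact: (measurableT_comp mf (@measurable_tcons R n)).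
have F0 a : 0 <= \int[lam n]_x f (tcons (a, x)) by exact: integral_ge0.
do 2 (rewrite integral_tupleS; [|by meas|by []]).
under eq_integral.
  move=> a _; under eq_integral do rewrite tscale_tcons.
  rewrite (IH (fun x => f (tcons (c * a, x))%R))//; last by meas.
  over.
rewrite ge0_integralZl; [|by []| |by []|by rewrite lee_fin invr_ge0 exprn_ge0];
  last first.
  by apply: (measurableT_comp mF); meas.
rewrite (ge0_integral_dilate c0 mF F0) muleA; congr (_ * _).
by rewrite -EFinM -invfM exprSr.
Qed.

(** A shear preserves Lebesgue measure: for fixed values of the coordinates
    that do not move, it is a translation of the others. *)
Lemma integral_shear0 n (k : R) (w : n.-tuple R) (f : n.+1.-tuple R -> \bar R) :
  measurable_fun setT f -> (forall x, 0 <= f x) ->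
  \int[lam n.+1]_y f (tcons (thead y - k * dot (tbehead y) w, (tbehead y)))%R
  = \int[lam n.+1]_y f y.
Proof.
move=> mf f0; do 2 (rewrite integral_tupleS_swap; [|by meas|by []]).
apply: eq_integral => x _.
under eq_integral do rewrite thead_tcons behead_tcons.
rewrite (@ge0_integral_translate R (fun a => f (tcons (a, x))) (- (k * dot x w))%R)//.
by meas.
Qed.

Lemma integral_shearS n (k : R) (w : n.-tuple R) (f : n.+1.-tuple R -> \bar R) :
  measurable_fun setT f -> (forall x, 0 <= f x) ->
  \int[lam n.+1]_y f (tcons (thead y, tsub (tbehead y) (tscale (k * thead y) w)))%R
  = \int[lam n.+1]_y f y.
Proof.
move=> mf f0; do 2 (rewrite integral_tupleS; [|by meas|by []]).
apply: eq_integral => a _.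
under eq_integral do rewrite thead_tcons behead_tcons.
rewrite (integral_tuple_translate _ (f := fun x => f (tcons (a, x))))//.
by meas.
Qed.

Lemma dot_self_eq0 n (x w : n.-tuple R) : dot w w = 0%R -> dot x w = 0%R.
Proof.
move=> /eqP; rewrite psumr_eq0; last by move=> i _; rewrite -expr2 sqr_ge0.
move=> /allP h; rewrite /dot big1// => i _.
have := h i; rewrite mem_index_enum => /(_ isT)/=.
by rewrite mulf_eq0 orbb => /eqP ->; rewrite mulr0.
Qed.

(** A rotation that takes the first axis to [xi = (c, w)] is the product of
    three shears, as in the plane: [(a, x) |-> (a - k <x, w>, x)] with
    [k = 1 / (1 + c)], then [(a, x) |-> (a, x + a w)], then the first one
    again. Composing [F] with them in turn and expanding the scalar products
    is all that has to be checked. *)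
Lemma integral_rotate n (xi : n.+1.-tuple R) (F : R * R -> \bar R) :
  usphere n.+1 xi -> measurable_fun setT F -> (forall x, 0 <= F x) ->
  \int[lam n.+1]_x F (dot x x, dot x xi) = \int[lam n.+1]_x F (dot x x, thead x).
Proof.
rewrite [xi]tcons_eta; move: (thead xi) (tbehead xi) => c w.
move=> /uspherex; rewrite dot_tcons => cw mF F0.
have mp (T : measurableType _) (f g : T -> R) : measurable_fun setT f ->
  measurable_fun setT g ->
    measurable_fun setT (fun x => F (f x, g x)).
  by move=> ? ?; apply: (measurableT_comp mF); exact: measurable_fun_pair.
have mdx (T : n.+1.-tuple R -> R) : measurable_fun setT T ->
    measurable_fun setT (fun x : n.+1.-tuple R => F (dot x x, T x)).
  by move=> mT; apply: mp => //; meas.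
(* [k] is undefined when [xi] is opposite to the first axis: the reflection
   of the first coordinate does it. *)
have [c1|c1] := eqVneq (1 + c)%R 0%R.
  have cE : c = (-1)%R by lra.
  have w0 : dot w w = 0%R by move: cw; rewrite cE; lra.
  do 2 (rewrite integral_tupleS_swap; [|by apply: mdx; meas|by []]). cbv beta.
  apply: eq_integral => x _.
  rewrite -[RHS]mul1e -[X in X%:E * _]invr1 -[X in (X^-1)%:E]normrN1.
  under [in RHS]eq_integral => a _ do rewrite dot_tcons thead_tcons.
  rewrite -(@ge0_integral_dilate R (fun a => F (a * a + dot x x, a)%R))//.
  - by apply: eq_integral => a _;
    rewrite !dot_tcons (dot_self_eq0 x w0) cE addr0 mulrN1 mulN1r mulrNN.
  - by apply: mp; meas.
set G := fun x : n.+1.-tuple R => F (dot x x, dot x (tcons (c, w))).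
have mG : measurable_fun setT G by apply: mdx; meas.
have G0 x : 0 <= G x by exact: F0.
pose k := ((1 + c)^-1)%R.
rewrite -[LHS](integral_shear0 k w mG G0).
set G1 := (fun y => G _).
have mG1 : measurable_fun setT G1.
  by apply: (measurableT_comp mG); meas.
have G10 x : 0 <= G1 x by exact: F0.
rewrite -(integral_shearS (-1) w mG1 G10).
set G2 := (fun y => G1 _).
have mG2 : measurable_fun setT G2.
  by apply: (measurableT_comp mG1); meas.
have G20 x : 0 <= G2 x by exact: F0.
rewrite -(integral_shear0 k w mG2 G20).
apply: eq_integral => y _; rewrite [y]tcons_eta.
move: (thead y) (tbehead y) => a x.
rewrite /G2 /G1 /G /= !thead_tcons !behead_tcons !dotE (dotC w x).
move: (dot x w) (dot x x) (dot w w) cw => p q s cw.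
have -> : s = (1 - c * c)%R by lra.
by congr (F (_, _)); rewrite /k; field.
Qed.

End lebesgue_invariance.

(** * The invariant measure of the multiplicative group *)

Section line_integrals.
Context {R : realType}.
Notation L := (@lebesgue_measure R).
Local Open Scope ereal_scope.

Lemma ge0_integral_eq_neq0 (f g : R -> \bar R) :
  measurable_fun setT f -> measurable_fun setT g ->
  (forall x, 0 <= f x) -> (forall x, 0 <= g x) ->
  (forall x, x != 0%R -> f x = g x) ->
  \int[L]_x f x = \int[L]_x g x.
Proof.
move=> mf mg f0 g0 fg; apply: ge0_ae_eq_integral => //.
exists [set 0%R]; split; first exact: measurable_set1.
  exact: lebesgue_measure_set1.
move=> x /= /not_implyP [_ h]; apply: contra_notP h => /eqP; exact: fg.
Qed.

Lemma integral_unit_itv :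
  \int[L]_t (((0 <= t) && (t <= 1))%:R : R)%:E = 1.
Proof.
have -> : (fun t : R => (((0 <= t) && (t <= 1))%:R : R)%:E) =
   fun t => (\1_`[0%R, 1%R] t)%:E.
  apply/funext => t; rewrite indicE; congr (_%:R%:E)%R.
  by rewrite mem_setE in_itv.
rewrite integral_indic//= setIT.
by rewrite lebesgue_measure_itv/= lte_fin ltr01 sube0.
Qed.

(** [dx / |x|] is a Haar measure of the multiplicative group of the reals. *)
Lemma integral_haar_scale (f : R -> \bar R) (s : R) : s != 0%R ->
  measurable_fun setT f -> (forall x, 0 <= f x) ->
  \int[L]_x ((`|x|^-1)%:E * f (s * x)%R) = \int[L]_x ((`|x|^-1)%:E * f x).
Proof.
move=> s0 mf f0.
have s1 : (0 < `|s|)%R by rewrite normr_gt0.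
have h := @ge0_integral_dilate R (fun x => (`|x|^-1)%:E * f x) s s0.
under eq_integral => x _.
  rewrite (_ : (`|x|^-1)%:E = `|s|%:E * (`|s * x|^-1)%:E); last first.
    by rewrite -EFinM normrM invfM mulrA mulfV ?gt_eqF// mul1r.
  rewrite -muleA.
  over.
rewrite ge0_integralZl//; last 2 first.
- by meas.
- by move=> x _; rewrite mule_ge0// lee_fin invr_ge0.
rewrite h; last 2 first.
- by meas.
- by move=> x; rewrite mule_ge0// lee_fin invr_ge0.
by rewrite muleA -EFinM mulfV ?gt_eqF// mul1e.
Qed.

(** Invariance under inversion follows from invariance under scaling alone.
    Let [w] have integral one for [dx / |x|]. Scaling [y] by [x], then [x]
    by [y], the integral of [f (1 / y) * w x] becomes that of
    [f (x / y) * w x], then that of [f x * w (x * y)], whose integral in [y]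
    is [f x]. *)
Lemma integral_haar_inv (f : R -> \bar R) :
  measurable_fun setT f -> (forall x, 0 <= f x) ->
  \int[L]_x ((`|x|^-1)%:E * f (x^-1)%R) = \int[L]_x ((`|x|^-1)%:E * f x).
Proof.
move=> mf f0.
(* [w] is [`|x|] on [[1, 2]] and 0 elsewhere, and [h] is the density of the
   Haar measure. *)
pose w (x : R) : \bar R := (`|x| * ((0 <= x - 1)%R && (x - 1 <= 1)%R)%:R)%:E.
have mw : measurable_fun setT w by rewrite /w; meas.
have w0 x : 0 <= w x by rewrite lee_fin mulr_ge0.
pose h (x : R) : \bar R := (`|x|^-1)%:E.
have mh : measurable_fun setT h by rewrite /h; meas.
have h0 x : 0 <= h x by rewrite lee_fin invr_ge0.
have h00 : h 0%R = 0 by rewrite /h normr0 invr0.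
have W1 : \int[L]_x (h x * w x) = 1.
  rewrite -integral_unit_itv -[RHS](@ge0_integral_translate _ _ (-1)%R).
  - apply: eq_integral => x _; rewrite /h /w -EFinM mulrA; congr (_%:E).
    have [->|x0] := eqVneq x 0%R.
      by rewrite normr0 mulr0 mul0r add0r lerNr oppr0 ler10.
    by rewrite mulVf ?normr_eq0// mul1r.
  - by meas.
  - by move=> x; rewrite lee_fin.
have Zl (c : \bar R) g : 0 <= c -> measurable_fun setT g -> (forall x : R, 0 <= g x) ->
    \int[L]_x (c * g x) = c * \int[L]_x g x.
  by move=> *; rewrite ge0_integralZl.
pose k x y := (h x * f x) * (h y * w (x * y)%R).
pose k' y x := (h y * (h x * (f (x * y^-1)%R * w x))).
have mk : measurable_fun setT (fun p : R * R => k p.1 p.2) by rewrite /k; meas.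
have mk' : measurable_fun setT (fun p : R * R => k' p.1 p.2) by rewrite /k'; meas.
have k0 x y : 0 <= k x y by rewrite /k !mule_ge0.
have k'0 x y : 0 <= k' x y by rewrite /k' !mule_ge0.
rewrite -/h.
transitivity (\int[L]_x \int[L]_y k' y x).
  rewrite -[LHS]mule1 -W1.
  rewrite -Zl//; [|by apply: integral_ge0 => x _; rewrite mule_ge0|by meas
    |by move=> x; rewrite mule_ge0].
  apply: eq_integral => x _.
  have [->|x0] := eqVneq x 0%R.
    rewrite h00 mul0e mule0; apply/esym; apply: integral0_eq => y _.
    by rewrite /k' h00 mul0e mule0.
  rewrite muleC -(integral_haar_scale (invr_neq0 x0) (f := fun y => f (y^-1)%R))//;
    last by meas.
  rewrite -Zl//; [|by rewrite mule_ge0|by meas|by move=> y; rewrite mule_ge0].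
  apply: eq_integral => y _; rewrite /k' invfM invrK -/(h y).
  by rewrite muleACA [RHS]muleA (muleC (h y)) (muleC (w x)).
transitivity (\int[L]_y \int[L]_x k' y x).
  by apply: (@fubini_tonelli _ _ _ _ R L L (fun p : R * R => k' p.2 p.1)) => //;
    rewrite /k'; meas.
transitivity (\int[L]_y \int[L]_x k x y).
  apply: eq_integral => y _.
  have [->|y0] := eqVneq y 0%R.
    by rewrite /k' /k; under eq_integral do rewrite h00 mul0e;
      under [RHS]eq_integral do rewrite h00 mul0e mule0.
  rewrite /k' Zl//; [|by meas|by move=> x; rewrite !mule_ge0].
  rewrite -(integral_haar_scale y0 (f := fun x => f (x * y^-1)%R * w x))//; [
    |by meas|by move=> x; rewrite mule_ge0].
  rewrite -Zl//; [|by meas|by move=> x; rewrite !mule_ge0// lee_fin invr_ge0].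
  apply: eq_integral => x _; rewrite mulrC mulKf// -/(h x) /k (mulrC x).
  by rewrite muleA [RHS]muleACA (muleC (h x)).
rewrite -(@fubini_tonelli _ _ _ _ R L L (fun p : R * R => k p.1 p.2))//=.
apply: eq_integral => x _; rewrite /k.
have [->|x0] := eqVneq x 0%R.
  by under eq_integral do rewrite h00 mul0e mul0e; rewrite integral0 -/(h 0%R) h00 mul0e.
rewrite Zl//; [|by rewrite mule_ge0|by meas|by move=> y; rewrite mule_ge0].
by rewrite (integral_haar_scale x0 (f := w))// W1 mule1.
Qed.

Lemma integral_haar_div (f : R -> \bar R) (p : R) : p != 0%R ->
  measurable_fun setT f -> (forall x, 0 <= f x) ->
  \int[L]_x ((`|x|^-1)%:E * f (p / x)%R) = \int[L]_x ((`|x|^-1)%:E * f x).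
Proof.
move=> p0 mf f0; rewrite -(integral_haar_scale p0 mf f0).
by rewrite -[RHS]integral_haar_inv//; meas.
Qed.

End line_integrals.

(** * Integrals over hyperplanes *)

Section hyperplane_integral.
Context {R : realType}.
Notation L := (@lebesgue_measure R).
Notation lam n := (@lebesgue_tuple R n).
Local Open Scope ereal_scope.

(** Hyperplanes are negligible: after a rotation, the hyperplane is normal
    to the first axis and meets each parallel to it in one point. *)
Lemma ae_dot_neq0 n (w : n.-tuple R) : dot w w != 0%R ->
  {ae lam n, forall x, dot x w != 0%R}.
Proof.
case: n w => [|n] w w0; first by move: w0; rewrite /dot big_ord0 eqxx.
have ew0 : enorm w != 0%R.
  by apply: contra w0 => /eqP h; rewrite -enorm_sqr h expr0n.
have /integral_rotate := enorm_normalize ew0.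
pose F (p : R * R) : \bar R := (((p.2 <= 0)%R && (0 <= p.2)%R)%:R)%:E.
have mF : measurable_fun setT F by rewrite /F; meas.
have F0 x : 0 <= F x by rewrite /F lee_fin.
move=> /(_ F mF F0).
rewrite [RHS]integral_tupleS_swap; [|by rewrite /F; meas|by []].
rewrite [RHS]integral0_eq; last first.
  move=> x _.
  rewrite (ge0_integral_eq_neq0 (g := cst 0)) ?integral0//.
  - by rewrite /F; meas.
  - by move=> a a0; rewrite /F /= thead_tcons -eq_le (negbTE a0).
move=> I0.
have mD : measurable [set x : n.+1.-tuple R | dot x w = 0%R].
  rewrite -[X in measurable X]setTI (_ : [set _ | _] =
    (fun x => dot x w) @^-1` [set 0%R])//.
  have : measurable_fun setT (fun x : n.+1.-tuple R => dot x w) by meas.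
  by apply => //; exact: measurable_set1.
exists [set x | dot x w = 0%R]; split => //; last first.
  by move=> x /= /negP; rewrite negbK => /eqP.
transitivity (\int[lam n.+1]_x (\1_[set x | dot x w = 0%R] x)%:E).
  by rewrite integral_indic// setIT.
rewrite -I0; apply: eq_integral => x _; rewrite /F /= -eq_le /normalize dotZr mulf_eq0.
rewrite invr_eq0 (negbTE ew0) /= indicE; congr ((nat_of_bool _)%:R%:E)%R.
by apply/idP/idP => [/[1!inE]/= ->|/eqP h] //; rewrite inE.
Qed.

Lemma ae_thead_neq0 n : {ae lam n.+1, forall x, thead x != 0%R}.
Proof.
pose e : n.+1.-tuple R := tcons (1%R, [tuple 0%R | i < n]).
have e0 : dot e e != 0%R by rewrite /e dot_tcons gt_eqF// mulr1 ltr_wpDr// dot_ge0.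
have := ae_dot_neq0 e0; apply: filterS => x.
rewrite [x]tcons_eta /e dot_tcons mulr1 (_ : dot _ _ = 0)%R ?addr0//.
by rewrite /dot big1// => i _; rewrite tnth_mktuple mulr0.
Qed.

Lemma ae_dot_self_neq0 n : {ae lam n.+1, forall x, dot x x != 0%R}.
Proof.
have := @ae_thead_neq0 n; apply: filterS => x; apply: contra.
rewrite [x]tcons_eta dot_tcons thead_tcons paddr_eq0 ?dot_ge0 -?expr2 ?sqr_ge0//.
by rewrite sqrf_eq0 => /andP[].
Qed.

(** For a unit vector [u], the integral of [G] over the hyperplane normal to
    [u], thickened to a slab of width one as in [subsphere_measure]. *)
Definition perp_integral n (u : n.-tuple R) (G : n.-tuple R -> \bar R) : \bar R :=
  \int[lam n]_x (G (hproj u x) * (((0 <= dot x u)%R && (dot x u <= 1)%R)%:R)%:E).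

(** When [b != 0] the hyperplane is the graph of [z |-> - <z, w> / b], with
    constant Jacobian [1 / |b|]. In the slab, the first coordinate is
    replaced by the signed distance [t] to the hyperplane; the projection of
    a point with remaining coordinates [x] then has remaining coordinates
    [x - t w], and the translation by [t w] does not change the integral
    over [x]. *)
Lemma perp_integral_graph n (b : R) (w : n.-tuple R) (G : n.+1.-tuple R -> \bar R) :
  usphere n.+1 (tcons (b, w)) -> b != 0%R ->
  measurable_fun setT G -> (forall x, 0 <= G x) ->
  perp_integral (tcons (b, w)) G =
  (`|b|^-1)%:E * \int[lam n]_z G (tcons (- (dot z w) / b, z))%R.
Proof.
move=> /uspherex; rewrite dot_tcons => bw b0 mG G0.
have b1 : (0 < `|b|)%R by rewrite normr_gt0.
(* [I] is the indicator of the slab as a function of the distance [t]. *)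
pose I (t : R) : \bar R := (((0 <= t)%R && (t <= 1)%R)%:R)%:E.
have mI : measurable_fun setT I by rewrite /I; meas.
have I0 t : 0 <= I t by rewrite lee_fin.
pose g z := G (tcons (- (dot z w) / b, z))%R.
have mg : measurable_fun setT g by rewrite /g; meas.
have g0 z : 0 <= g z by exact: G0.
rewrite /perp_integral integral_tupleS_swap; last 2 first.
- by meas.
- by move=> x; rewrite mule_ge0// lee_fin.
transitivity (\int[lam n]_x ((`|b|^-1)%:E * \int[L]_t (g (tsub x (tscale t w)) * I t))).
  apply: eq_integral => x _.
  rewrite -[LHS](mul1e) -[X in X%:E * _](mulVf (lt0r_neq0 b1)) EFinM -muleA;
    congr (_ * _).
  rewrite -[X in X%:E * _]invrK -normfV.
  rewrite -(ge0_integral_affine (- dot x w / b)%R (invr_neq0 b0)); last 2 first.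
  - by meas.
  - by move=> a; rewrite mule_ge0// lee_fin.
  apply: eq_integral => t _.
  rewrite /hproj !dot_tcons tscale_tcons tsub_tcons.
  have -> : ((b^-1 * t + - dot x w / b) * b + dot x w = t)%R by field.
  congr (_ * _); rewrite /g dotBl dotZl; congr (G (tcons (_, _))).
  have -> : (dot w w = 1 - b * b)%R by lra.
  by field.
rewrite ge0_integralZl//; last 2 first.
- apply: (meas_integral L (f := fun x t => g (tsub x (tscale t w)) * I t)).
  + by meas.
  + by move=> x t; rewrite mule_ge0.
- by move=> x _; apply: integral_ge0 => t _; rewrite mule_ge0.
congr (_ * _).
rewrite (tonelli_swap (lam n) L (f := fun x t => g (tsub x (tscale t w)) * I t));
  last 2 first.
- by meas.
- by move=> x t; rewrite mule_ge0.
transitivity (\int[L]_t ((\int[lam n]_z g z) * I t)).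
  apply: eq_integral => t _ /=.
  rewrite ge0_integralZr//; last by meas.
  by rewrite integral_tuple_translate.
rewrite ge0_integralZl//; last exact: integral_ge0.
by rewrite integral_unit_itv mule1.
Qed.

(** With the weight [1 / |y|] on the left, the norm of [y = (b, w)] cancels
    from the formula. *)
Lemma perp_integral_normalize n (b : R) (w : n.-tuple R) (G : n.+1.-tuple R -> \bar R) :
  b != 0%R -> measurable_fun setT G -> (forall x, 0 <= G x) ->
  ((enorm (tcons (b, w)))^-1)%:E * perp_integral (normalize (tcons (b, w))) G =
  (`|b|^-1)%:E * \int[lam n]_z G (tcons (- (dot z w) / b, z))%R.
Proof.
move=> b0 mG G0.
have e0 : enorm (tcons (b, w)) != 0%R.
  apply/negP => /eqP e0; have := enorm_sqr (tcons (b, w)).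
  rewrite e0 expr0n/= dot_tcons => /esym/eqP.
  by rewrite paddr_eq0 ?dot_ge0 -?expr2 ?sqr_ge0// sqrf_eq0 (negbTE b0).
have e1 : (0 < enorm (tcons (b, w)))%R by rewrite lt_def e0 enorm_ge0.
have := enorm_normalize e0; rewrite /normalize tscale_tcons => eu.
rewrite perp_integral_graph ?mulf_neq0 ?invr_neq0//.
rewrite muleA; congr (_ * _).
  by rewrite -EFinM normrM invfM normfV invrK mulrA (gtr0_norm e1) mulVf// mul1r.
apply: eq_integral => z _; congr (G (tcons (_, _))).
rewrite dotZr; field.
by rewrite b0 e0.
Qed.

(** The integral of [P y * G z'] over the pairs of orthogonal vectors
    [y = (b, w)] and [z' = (a, z)]. Given [w] and [z], orthogonality means
    that [(a, b)] lies on the hyperbola [a * b = - <z, w>], and [db / |b|]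
    is the measure on the hyperbola that does not distinguish between [a]
    and [b]. *)
Definition incidence_integral n (P G : n.+1.-tuple R -> \bar R) : \bar R :=
  \int[lam n]_w \int[lam n]_z \int[L]_b
    ((`|b|^-1)%:E * (P (tcons (b, w)) * G (tcons (- (dot z w) / b, z))%R)).

(** The exchange of the two vectors is the inversion [b |-> - <z, w> / b] of
    the parameter of the hyperbola, which preserves [db / |b|]. It
    degenerates for [<z, w> = 0], that is, on a negligible set. *)
Lemma incidence_integral_sym n (P G : n.+2.-tuple R -> \bar R) :
  measurable_fun setT P -> (forall x, 0 <= P x) ->
  measurable_fun setT G -> (forall x, 0 <= G x) ->
  incidence_integral P G = incidence_integral G P.
Proof.
move=> mP P0 mG G0; rewrite /incidence_integral.
pose k (P G : n.+2.-tuple R -> \bar R) (w z : n.+1.-tuple R) (b : R) :=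
  (`|b|^-1)%:E * (P (tcons (b, w)) * G (tcons (- (dot z w) / b, z))%R).
have k0 (P' G' : n.+2.-tuple R -> \bar R) w z b : (forall x, 0 <= P' x) ->
  (forall x, 0 <= G' x) -> 0 <= k P' G' w z b.
  by move=> P'0 G'0; rewrite /k !mule_ge0// lee_fin invr_ge0.
have mk (P' G' : n.+2.-tuple R -> \bar R) : measurable_fun setT P' ->
  measurable_fun setT G' ->
   measurable_fun setT (fun p : (n.+1.-tuple R * n.+1.-tuple R) * R => k P' G' p.1.1
     p.1.2 p.2).
  by move=> mP' mG'; rewrite /k; meas.
have mk2 (P' G' : n.+2.-tuple R -> \bar R) : measurable_fun setT P' ->
  measurable_fun setT G' ->
   (forall x, 0 <= P' x) -> (forall x, 0 <= G' x) ->
   measurable_fun setT (fun p : (n.+1.-tuple R * n.+1.-tuple R)  => \int[L]_b k P' G'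
     p.1 p.2 b).
  move=> mP' mG' P'0 G'0.
  apply: (meas_integral L (f := fun p b => k P' G' p.1 p.2 b)).
    exact: mk.
  by move=> x b; exact: k0.
rewrite -[LHS]/(\int[lam n.+1]_w \int[lam n.+1]_z \int[L]_b k P G w z b).
rewrite -[RHS]/(\int[lam n.+1]_z \int[lam n.+1]_w \int[L]_b k G P z w b).
rewrite (tonelli_swap (lam n.+1) (lam n.+1) (f := fun w z => \int[L]_b k P G w z b));
  last 2 first.
- exact: mk2.
- by move=> w z; apply: integral_ge0 => b _; exact: k0.
have sw : measurable_fun setT (fun p : n.+1.-tuple R * n.+1.-tuple R => (p.2, p.1)).
  by meas.
apply: ge0_ae_eq_integral => //.
- apply: (meas_integral (lam n.+1) (f := fun z w => \int[L]_b k P G w z b)).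
  + exact: (measurableT_comp (mk2 _ _ mP mG P0 G0) sw).
  + by move=> z w; apply: integral_ge0 => b _; exact: k0.
- apply: (meas_integral (lam n.+1) (f := fun z w => \int[L]_b k G P z w b)).
  + exact: mk2.
  + by move=> z w; apply: integral_ge0 => b _; exact: k0.
- by move=> x _; apply: integral_ge0 => y _; apply: integral_ge0 => b _; exact: k0.
- by move=> x _; apply: integral_ge0 => y _; apply: integral_ge0 => b _; exact: k0.
have := @ae_dot_self_neq0 n; apply: filterS => z z0 _.
apply: ge0_ae_eq_integral => //.
- by apply: (measurableT_comp (mk2 _ _ mP mG P0 G0) (g := fun w => (w, z))); meas.
- by apply: (measurableT_comp (mk2 _ _ mG mP G0 P0) (g := fun w => (z, w))); meas.
- by move=> y _; apply: integral_ge0 => b _; exact: k0.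
- by move=> y _; apply: integral_ge0 => b _; exact: k0.
have := ae_dot_neq0 z0; apply: filterS => w wz _.
have p0 : (- dot w z)%R != 0%R by rewrite oppr_eq0.
rewrite -[RHS](integral_haar_div p0); last 2 first.
- by meas.
- by move=> b; rewrite mule_ge0.
apply: eq_integral => b _; have [->|b0] := eqVneq b 0%R.
  by rewrite /k normr0 invr0 !mul0e.
rewrite /k (dotC z w) (muleC (G _)); congr (_ * (P (tcons (_, _)) * _)).
by rewrite -oppr_eq0 in p0 *; field; rewrite b0.
Qed.

(** Both sides are the same integral over the pairs of orthogonal vectors
    [y] and [z]: the transform that integrates over hyperplanes is
    self-adjoint, for the weight [1 / |y|]. *)
Lemma perp_integral_sym n (P G : n.+2.-tuple R -> \bar R) :
  measurable_fun setT P -> (forall x, 0 <= P x) ->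
  measurable_fun setT G -> (forall x, 0 <= G x) ->
  \int[lam n.+2]_y (P y * (((enorm y)^-1)%:E * perp_integral (normalize y) G)) =
  \int[lam n.+2]_z (G z * (((enorm z)^-1)%:E * perp_integral (normalize z) P)).
Proof.
suff H (P' G' : n.+2.-tuple R -> \bar R) :
    measurable_fun setT P' -> (forall x, 0 <= P' x) ->
    measurable_fun setT G' -> (forall x, 0 <= G' x) ->
    \int[lam n.+2]_y (P' y * (((enorm y)^-1)%:E * perp_integral (normalize y) G')) =
    incidence_integral P' G'.
  move=> mP P0 mG G0; rewrite (H P G mP P0 mG G0) (H G P mG G0 mP P0).
  exact: incidence_integral_sym.
move=> mP P0 mG G0.
pose T u := perp_integral u G'.
have T0 u : 0 <= T u.
  by apply: integral_ge0 => x _; rewrite mule_ge0// lee_fin.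
have mT : measurable_fun setT T.
  apply: (meas_integral (lam n.+2)); first by meas.
  by move=> u x; rewrite mule_ge0// lee_fin.
rewrite -[LHS]/(\int[lam n.+2]_y (P' y * (((enorm y)^-1)%:E * T (normalize y)))).
rewrite integral_tupleS_swap; last 2 first.
- by meas.
- by move=> x; rewrite !mule_ge0// lee_fin invr_ge0 enorm_ge0.
apply: eq_integral => w _.
pose k z b := (`|b|^-1)%:E * (P' (tcons (b, w)) * G' (tcons (- (dot z w) / b, z))%R).
have mk : measurable_fun setT (fun p : n.+1.-tuple R * R => k p.1 p.2).
  by rewrite /k; meas.
have k0 z b : 0 <= k z b by rewrite /k !mule_ge0// lee_fin invr_ge0.
rewrite (tonelli_swap (lam n.+1) L (f := k))//.
apply: ge0_integral_eq_neq0.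
- by meas.
- by apply: (meas_integral (lam n.+1) (f := fun b z => k z b)); rewrite // /k; meas.
- by move=> x; rewrite !mule_ge0// lee_fin invr_ge0 enorm_ge0.
- by move=> x; apply: integral_ge0.
- move=> b b0; rewrite /T perp_integral_normalize// muleCA /k /=.
  rewrite ge0_integralZl; [|by []|by meas| |].
  - by rewrite ge0_integralZl//; meas.
  - by move=> x _; rewrite mule_ge0.
  - by rewrite lee_fin invr_ge0.
Qed.

End hyperplane_integral.

(** * Integrals over spheres as integrals over cones *)

Section sphere_integrals.
Context {R : realType}.
Notation L := (@lebesgue_measure R).
Notation lam n := (@lebesgue_tuple R n).
Local Open Scope ereal_scope.

Lemma ge0_integral_mrestr d (T : measurableType d) (mu : {measure set T -> \bar R})
    (D : set T) (mD : measurable D) (f : T -> \bar R) :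
  measurable_fun setT f -> (forall x, 0 <= f x) ->
  \int[mrestr mu mD]_x f x = \int[mu]_(x in D) f x.
Proof.
move=> mf f0; rewrite -(setUv D) ge0_integral_setU; [|by []|exact: measurableC
  |by rewrite setUv|by []|exact/disj_setPCl].
rewrite (eq_measure_integral mu); last first.
  by move=> A mA AD; transitivity (mu (A `&` D)) => //; rewrite setIidl.
rewrite [X in _ + X](_ : _ = 0) ?adde0//.
rewrite (eq_measure_integral mzero) ?integral_measure_zero//.
move=> A mA AD; transitivity (mu (A `&` D)) => //.
rewrite (_ : A `&` D = set0) ?measure0//.
by apply/seteqP; split => // x [/AD].
Qed.

Lemma ge0_integral_cone n (c : {nonneg R}) (D : set (n.-tuple R))
    (mD : measurable D) (phi : n.-tuple R -> n.-tuple R)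
    (mphi : measurable_fun setT phi) (f : n.-tuple R -> \bar R) :
  measurable_fun setT f -> (forall x, 0 <= f x) ->
  \int[cone_measure c mD mphi]_x f x =
  c%:num%:E * \int[lam n]_(x in D) f (phi x).
Proof.
move=> mf f0; rewrite ge0_integral_mscale//=; congr (_ * _).
by rewrite ge0_integral_pushforward//= preimage_setT ge0_integral_mrestr//; meas.
Qed.

(** [punctured_ball] as a boolean, for use as a factor of an integrand. *)
Definition in_pball n (x : n.-tuple R) : bool := (0 < enorm x)%R && (enorm x <= 1)%R.

Lemma meas_in_pball d (X : measurableType d) n (f : X -> n.-tuple R) :
  measurable_fun setT f -> measurable_fun setT (fun x => in_pball (f x)).
Proof. by move=> mf; rewrite /in_pball; meas. Qed.

Lemma integral_restrict_bool d (T : measurableType d) (mu : {measure set T -> \bar R})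
    (D : set T) (b : T -> bool) (f : T -> \bar R) :
  D = [set x | b x] ->
  \int[mu]_(x in D) f x = \int[mu]_x (f x * ((b x)%:R)%:E).
Proof.
move=> ->; rewrite integral_mkcond; apply: eq_integral => x _.
rewrite patchE; have [bx|/negbTE bx] := boolP (b x).
  by rewrite mem_set// mule1.
by rewrite memNset ?mule0//= bx.
Qed.

Lemma measurable_usphere n : measurable (usphere n : set (n.-tuple R)).
Proof.
rewrite -[X in measurable X]setTI (_ : usphere n = @enorm R n @^-1` [set 1%R])//.
by apply: measurable_enorm => //; exact: measurable_set1.
Qed.

Lemma measurable_orth n (xi : n.-tuple R) : measurable (orth xi).
Proof.
rewrite -[X in measurable X]setTI (_ : orth xi = (fun x => dot x xi) @^-1` [set 0%R])//.
have : measurable_fun setT (fun x : n.-tuple R => dot x xi) by meas.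
by apply => //; exact: measurable_set1.
Qed.

Lemma ge0_integral_carried d (T : measurableType d) (mu : {measure set T -> \bar R})
    (D : set T) (f : T -> \bar R) :
  measurable D -> mu (~` D) = 0 -> measurable_fun setT f -> (forall x, 0 <= f x) ->
  \int[mu]_(x in D) f x = \int[mu]_x f x.
Proof.
move=> mD D0 mf f0; rewrite [RHS](ge0_negligible_integral (measurableC mD))//.
by rewrite setTD setCK.
Qed.

Lemma sphere_measure_carried n : sphere_measure n (~` (usphere n : set (n.-tuple R))) = 0.
Proof.
rewrite /sphere_measure (_ : _ `&` _ = set0) ?measure0 ?mule0//.
apply/seteqP; split => // x /= [h /andP[x0 _]]; apply: h.
by apply: enorm_normalize; rewrite gt_eqF.
Qed.

Lemma sphere_integralE n (f : n.-tuple R -> \bar R) :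
  measurable_fun setT f -> (forall x, 0 <= f x) ->
  \int[sphere_measure n]_(x in usphere n) f x =
  n%:R%:E * \int[lam n]_x (f (normalize x) * (in_pball x)%:R%:E).
Proof.
move=> mf f0; rewrite ge0_integral_carried//; last 2 first.
- exact: measurable_usphere.
- exact: sphere_measure_carried.
rewrite (eq_measure_integral (cone_measure (n%:R%:nng)%R (@measurable_punctured_ball R
  n) (@measurable_normalize R n)))//.
rewrite ge0_integral_cone//; congr (_ * _).
by apply: (@integral_restrict_bool _ _ _ _ (@in_pball n)).
Qed.

Lemma dot_hproj n (xi x : n.-tuple R) : dot xi xi = 1%R -> dot (hproj xi x) xi = 0%R.
Proof. by move=> x1; rewrite /hproj !dotE x1 mulr1 subrr. Qed.

Lemma dot_hproj_self n (xi x : n.-tuple R) : dot xi xi = 1%R ->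
  dot (hproj xi x) (hproj xi x) = (dot x x - dot x xi ^+ 2)%R.
Proof. by move=> x1; rewrite /hproj !dotE x1 (dotC xi x); ring. Qed.

Lemma subsphere_measure_carried n (xi : n.-tuple R) : usphere n xi ->
  subsphere_measure xi (~` (usphere n `&` orth xi)) = 0.
Proof.
move=> /uspherex x1.
rewrite /subsphere_measure (_ : _ `&` _ = set0) ?measure0 ?mule0//.
apply/seteqP; split => // x /= [h [/andP[x0 _] _]]; apply: h; split.
  by apply: enorm_normalize; rewrite gt_eqF.
by rewrite /orth /= /normalize dotZl dot_hproj// mulr0.
Qed.

Lemma subsphere_integralE n (xi : n.-tuple R) (f : n.-tuple R -> \bar R) :
  usphere n xi -> measurable_fun setT f -> (forall x, 0 <= f x) ->
  \int[subsphere_measure xi]_(x in usphere n `&` orth xi) f x =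
  n.-1%:R%:E * perp_integral xi (fun z => f (normalize z) * (in_pball z)%:R%:E).
Proof.
move=> xi1 mf f0; rewrite ge0_integral_carried//; last 2 first.
- by apply: measurableI; [exact: measurable_usphere|exact: measurable_orth].
- exact: subsphere_measure_carried.
rewrite (eq_measure_integral (cone_measure (n.-1%:R%:nng)%R
  (@measurable_punctured_cylinder R n xi)
    (measurableT_comp (@measurable_normalize R n) (measurable_hproj xi))))//.
rewrite ge0_integral_cone//; congr (_ * _).
rewrite (@integral_restrict_bool _ _ _ _ (fun x => in_pball (hproj xi x) && ((0 <=
  dot x xi)%R && (dot x xi <= 1)%R))).
  by apply: eq_integral => x _ /=; rewrite -muleA -EFinM -natrM mulnb.
by apply/seteqP; split => x /=; [move=> [h1 h2]; apply/andP|move=> /andP[]].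
Qed.

(** All hyperplanes are alike for a radial function: [integral_rotate] takes
    [u] to the first axis. *)
Lemma perp_integral_radial n (u : n.+1.-tuple R) (p : R -> \bar R) :
  usphere n.+1 u -> measurable_fun setT p -> (forall x, 0 <= p x) ->
  perp_integral u (fun z => p (dot z z)) = \int[lam n]_z p (dot z z).
Proof.
move=> u1 mp p0; rewrite /perp_integral.
pose F (q : R * R) := p (q.1 - q.2 ^+ 2)%R * (((0 <= q.2)%R && (q.2 <= 1)%R)%:R)%:E.
have mF : measurable_fun setT F by rewrite /F; meas.
have F0 q : 0 <= F q by rewrite /F mule_ge0// lee_fin.
transitivity (\int[lam n.+1]_x F (dot x x, dot x u)).
  by apply: eq_integral => x _; rewrite dot_hproj_self//; exact: uspherex.
rewrite integral_rotate// integral_tupleS_swap; last 2 first.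
- by meas.
- by [].
apply: eq_integral => z _.
transitivity (\int[L]_a (p (dot z z) * (((0 <= a)%R && (a <= 1)%R)%:R)%:E)).
  apply: eq_integral => a _; rewrite /F /= thead_tcons dot_tcons.
  by congr (p _ * _); ring.
by rewrite ge0_integralZl//; [rewrite integral_unit_itv mule1|meas].
Qed.

Lemma in_pballE n (z : n.-tuple R) : in_pball z = (0 < dot z z)%R && (dot z z <= 1)%R.
Proof.
by rewrite /in_pball -enorm_sqr !lt_def sqrf_eq0 sqr_ge0 enorm_ge0 expr_le1 ?enorm_ge0.
Qed.

Lemma in_pballZ n (c : R) (x : n.-tuple R) : (0 < c)%R ->
  in_pball (tscale c x) = (0 < enorm x)%R && (enorm x <= c^-1)%R.
Proof.
move=> c0; rewrite /in_pball enormZ gtr0_norm// pmulr_rgt0//.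
by rewrite -ler_pdivlMl// mulr1.
Qed.

(** The integral of [min 1 (s ^- n)] over the half line. *)
Definition inv_weight n : \bar R :=
  \int[L]_s ((0 <= s)%R%:R * (if (s <= 1)%R then 1%R else (s ^+ n)^-1%R))%:E.

(** [1 / |z|] is the length of the set of [s >= 0] such that [s * |z| <= 1].
    For fixed [s] this constraint cuts the unit ball down to the ball of
    radius [min 1 (1 / s)], on which the integral of a function of
    [normalize z] is found by scaling. *)
Lemma integral_inv_enorm n (h : n.-tuple R -> \bar R) :
  measurable_fun setT h -> (forall x, 0 <= h x) ->
  \int[lam n]_z (h (normalize z) * (in_pball z)%:R%:E * ((enorm z)^-1)%:E) =
  inv_weight n * \int[lam n]_z (h (normalize z) * (in_pball z)%:R%:E).
Proof.
move=> mh h0.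
have mb : measurable_fun setT (@in_pball n) by exact: (meas_in_pball (f := id)).
pose k z s : \bar R := h (normalize z) * (in_pball z)%:R%:E *
  (((0 <= s)%R && (s * enorm z <= 1)%R)%:R)%:E.
have mk : measurable_fun setT (fun p : n.-tuple R * R => k p.1 p.2).
  by rewrite /k; meas.
have k0 z s : 0 <= k z s by rewrite /k !mule_ge0// lee_fin.
transitivity (\int[lam n]_z \int[L]_s k z s).
  apply: eq_integral => z _; rewrite /k.
  rewrite ge0_integralZl//; last 2 first.
  - by meas.
  - by rewrite mule_ge0// lee_fin.
  have [|] := boolP (in_pball z); last by rewrite mule0 !mul0e.
  rewrite /in_pball => /andP[z0 z1]; congr (_ * _).
  rewrite (_ : (fun s => _) = fun s => (\1_`[0%R, (enorm z)^-1%R] s)%:E); last first.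
    apply/funext => s; rewrite indicE mem_setE in_itv/=;
      congr ((nat_of_bool (_ && _))%:R%:E).
    by rewrite -ler_pdivlMr// mul1r.
  rewrite integral_indic//= setIT lebesgue_measure_itv/= lte_fin invr_gt0 z0.
  by rewrite sube0.
rewrite (tonelli_swap (lam n) L)//.
set J := \int[lam n]_z (h (normalize z) * _).
have J0 : 0 <= J by apply: integral_ge0 => z _; rewrite mule_ge0// lee_fin.
rewrite muleC /inv_weight -ge0_integralZl//; last 2 first.
- apply: meas_EFin; apply: measurable_funM; first by meas.
  by apply: measurable_fun_ifT; meas.
- move=> s _; rewrite lee_fin; have [s0|] := boolP (0 <= s)%R; last by rewrite mul0r.
  by rewrite mul1r; case: ifP => // _; rewrite invr_ge0 exprn_ge0.
apply: eq_integral => s _; rewrite /k.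
have [s0|_] := boolP (0 <= s)%R; last first.
  by rewrite mul0r mule0; under eq_integral do rewrite mule0; rewrite integral0.
rewrite mul1r /=; case: ifPn => s1.
  rewrite mule1; apply: eq_integral => z _.
  have [|] := boolP (in_pball z); last by rewrite mule0 !mul0e.
  rewrite /in_pball => /andP[z0 z1]; rewrite (_ : (s * enorm z <= 1)%R) ?mule1//.
  by rewrite mulr_ile1// ltW.
rewrite -ltNge in s1; have {}s0 : (0 < s)%R by rewrite (lt_trans _ s1).
transitivity (\int[lam n]_z (h (normalize (tscale s z)) * (in_pball (tscale s z))%:R%:E)).
  apply: eq_integral => z _; rewrite normalizeZ// in_pballZ// -muleA -EFinM -natrM mulnb.
  congr (_ * (nat_of_bool _)%:R%:E); rewrite /in_pball -ler_pdivlMl// mulr1 -andbA.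
  congr (_ && _); apply/andP/idP => [[]//|zs]; split=> //.
  by rewrite (le_trans zs)// invf_le1// ltW.
rewrite (integral_tuple_scale (f := fun z => h (normalize z) * (in_pball z)%:R%:E))
  ?gt_eqF//; last 2 first.
- by meas.
- by move=> z; rewrite mule_ge0// lee_fin.
by rewrite gtr0_norm// muleC.
Qed.

End sphere_integrals.

(** * The volume of the unit ball and the Gamma function *)

Section one_dim_calculus.
Context {R : realType}.

Lemma meas_expR d (X : measurableType d) (f : X -> R) :
  measurable_fun setT f -> measurable_fun setT (fun x => expR (f x)).
Proof. by move=> mf; apply: measurableT_comp mf. Qed.

Notation L := (@lebesgue_measure R).
Local Open Scope ereal_scope.

Lemma integral_is_derive (f F : R -> R) (a b : R) : (a < b)%R ->
  continuous f -> (forall x, is_derive x (1%R : R) F (f x)) ->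
  \int[L]_(x in `[a, b]) (f x)%:E = (F b - F a)%:E.
Proof.
move=> ab cf dF.
have cF : continuous F.
  by move=> x; apply: differentiable_continuous; apply/derivable1_diffP; exact: ex_derive.
apply: continuous_FTC2 => //.
- exact: continuous_subspaceT.
- split; [by move=> x _; exact: ex_derive| |].
  + exact/cvg_at_right_filter/cF.
  + exact/cvg_at_left_filter/cF.
- by move=> x _; rewrite derive1E derive_val.
Qed.

Lemma continuous_expRN : continuous (fun s : R => expR (- s)).
Proof.
by move=> x; apply: continuous_comp; [exact: opp_continuous|exact: continuous_expR].
Qed.

Lemma integral_exp_tail (d : R) :
  \int[L]_(s in `[d, +oo[) (expR (- s))%:E = (expR (- d))%:E.
Proof.
rewrite (@ge0_continuous_FTC2y _ _ (fun x => - (expR (- x)))%R _ 0%R)//.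
- by rewrite EFinN oppeK add0e.
- exact/continuous_subspaceT/continuous_expRN.
- rewrite -oppr0; apply: cvgN; exact: cvgr_expR.
- by apply: cvgN; apply/cvg_at_right_filter; exact: continuous_expRN.
- by move=> x _; rewrite derive1E derive_val mulrN1 opprK.
Qed.

End one_dim_calculus.

Section ball_volume.
Context {R : realType}.
Notation L := (@lebesgue_measure R).
Notation lam n := (@lebesgue_tuple R n).
Local Open Scope ereal_scope.

Definition ball_vol n : \bar R := \int[lam n]_x (in_pball x)%:R%:E.

Lemma ball_vol_ge0 n : 0 <= ball_vol n.
Proof. by apply: integral_ge0 => x _; rewrite lee_fin. Qed.

(** By scaling; the origin, which is removed from the unit ball, is
    negligible. *)
Lemma integral_dot_le n (s : R) :
  \int[lam n.+1]_x ((dot x x <= s)%R%:R)%:E = ball_vol n.+1 * (Num.sqrt s ^+ n.+1)%:E.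
Proof.
have mdot (t : R) : measurable_fun setT (fun x : n.+1.-tuple R => ((dot x x <=
  t)%R%:R)%:E : \bar R).
  by meas.
have [s0|s0] := leP s 0%R.
  rewrite ler0_sqrtr// expr0n/= mule0 (ge0_ae_eq_integral (g := cst 0)) ?integral0//.
  have := @ae_dot_self_neq0 R n; apply: filterS => x x0 _.
    rewrite leNgt (le_lt_trans s0)// lt_def x0; exact: dot_ge0.
transitivity (\int[lam n.+1]_x ((dot x x <= 1)%R%:R)%:E * (Num.sqrt s ^+ n.+1)%:E).
  have r0 : (0 < Num.sqrt s)%R by rewrite sqrtr_gt0.
  have ri : ((Num.sqrt s)^-1 != 0)%R by rewrite invr_eq0 gt_eqF.
  have := integral_tuple_scale ri (mdot 1%R);
    rewrite normfV gtr0_norm// exprVn invrK muleC => <-.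
    apply: eq_integral => x _; congr ((nat_of_bool _)%:R%:E).
    rewrite dotZl dotZr mulrA -expr2 exprVn sqr_sqrtr; last exact: ltW.
  by rewrite mulrC ler_pdivrMr// mul1r.
  by move=> x; rewrite lee_fin.
congr (_ * _); apply: ge0_ae_eq_integral => //.
  by apply: meas_EFin; apply: meas_indic; apply: (meas_in_pball (f := id)).
have := @ae_dot_self_neq0 R n; apply: filterS => x x0 _; rewrite in_pballE.
by rewrite lt_def x0 dot_ge0.
Qed.

Lemma integral_tuple_gauss n :
  \int[lam n]_x (expR (- dot x x))%:E = (Num.sqrt pi ^+ n)%:E.
Proof.
have me m : measurable_fun setT (fun x : m.-tuple R => (expR (- dot x x))%:E : \bar R).
  by apply: meas_EFin; apply: meas_expR; meas.
elim: n => [|n IH]; first by rewrite integral_tuple0// /dot big_ord0 oppr0 expR0.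
rewrite integral_tupleS; [|exact: me|by move=> x; rewrite lee_fin expR_ge0].
transitivity (\int[L]_a ((expR (- a ^+ 2))%:E * (Num.sqrt pi ^+ n)%:E)).
  apply: eq_integral => a _; rewrite -IH -ge0_integralZl; [|by []|exact: me
    |by move=> x _; rewrite lee_fin expR_ge0|by rewrite lee_fin expR_ge0].
  by apply: eq_integral => x _; rewrite dot_tcons -EFinM -expRD opprD.
rewrite ge0_integralZr; [|by []| | |]; last 3 first.
- by apply: meas_EFin; apply: meas_expR; meas.
- by move=> a _; rewrite lee_fin expR_ge0.
- by rewrite lee_fin exprn_ge0// sqrtr_ge0.
by rewrite integralT_gauss -EFinM -exprS.
Qed.

(** [Gamma (n / 2 + 1)] as an extended real, before it is known to be
    finite. *)
Definition gamma_half n : \bar R :=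
  \int[L]_(s in `]0%R, +oo[) (s `^ (n.+2%:R / 2 - 1) * expR (- s))%:E.

(** The Gaussian integral by layers: [expR (- |x|^2)] is the integral of
    [expR (- s)] over [s >= |x|^2], and for fixed [s] the admissible [x]
    form a ball of radius [sqrt s]. *)
Lemma ball_vol_gamma n : ball_vol n.+1 * gamma_half n.+1 = (Num.sqrt pi ^+ n.+1)%:E.
Proof.
rewrite -integral_tuple_gauss.
pose k (x : n.+1.-tuple R) s : \bar R := ((dot x x <= s)%R%:R * expR (- s))%:E.
have mN : measurable_fun setT (fun s : R => expR (- s)).
  by apply: meas_expR; meas.
have mk : measurable_fun setT (fun p : n.+1.-tuple R * R => k p.1 p.2).
  apply: meas_EFin; apply: measurable_funM; first by meas.
  exact: (measurableT_comp mN).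
have k0 x s : 0 <= k x s by rewrite lee_fin mulr_ge0// expR_ge0.
transitivity (\int[lam n.+1]_x \int[L]_s k x s); last first.
  apply: eq_integral => x _; rewrite -integral_exp_tail.
  rewrite [RHS](@integral_restrict_bool _ _ _ _ _ (fun s : measurableTypeR R => dot x x
    <= s)%R).
    by apply: eq_integral => s _; rewrite muleC -EFinM.
  by apply/seteqP; split => s /=; rewrite in_itv/= andbT.
rewrite (tonelli_swap (lam n.+1) L)// /gamma_half.
rewrite (@integral_restrict_bool _ _ _ _ _ (fun s : measurableTypeR R => 0 < s)%R);
  last first.
  by apply/seteqP; split => s /=; rewrite in_itv/= andbT.
rewrite -ge0_integralZl; [|by []| | |]; last 3 first.
- apply: emeasurable_funM; last by meas.
  apply: meas_EFin; apply: measurable_funM => //; exact: measurable_powR.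
- by move=> s _; rewrite mule_ge0// lee_fin// mulr_ge0 ?powR_ge0 ?expR_ge0.
- exact: ball_vol_ge0.
apply: eq_integral => s _; rewrite /k.
transitivity (\int[lam n.+1]_x (((dot x x <=
  s)%R%:R)%:E * (expR (- s))%:E : \bar R)) => //.
rewrite ge0_integralZr; [|by []| | |]; last 3 first.
- by meas.
- by move=> x _; rewrite lee_fin.
- by rewrite lee_fin expR_ge0.
rewrite integral_dot_le -muleA; congr (_ * _); rewrite -!EFinM; congr (_%:E).
have [s0|s0] := ltP 0%R s; last by rewrite mulr0 ler0_sqrtr// expr0n mul0r.
rewrite mulr1; congr (_ * _)%R; rewrite -powR_mulrn ?sqrtr_ge0// -powR12_sqrt ?ltW//.
by rewrite -powRrM; congr (_ `^ _)%R; rewrite -[in LHS]natr1 -[in RHS]natr1; field.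
Qed.

(** Two nonnegative factors of a positive real number are both positive and
    finite. *)
Lemma ball_vol_gt0_fin n : 0 < ball_vol n.+1 < +oo.
Proof.
have h := ball_vol_gamma n.
have p0 : 0 < (Num.sqrt (pi : R) ^+ n.+1)%:E by rewrite lte_fin exprn_gt0// sqrtr_gt0
  pi_gt0.
have g0 : 0 <= gamma_half n.+1.
  by apply: integral_ge0 => s _; rewrite lee_fin// mulr_ge0 ?powR_ge0 ?expR_ge0.
have b0 := ball_vol_ge0 n.+1.
have b1 : 0 < ball_vol n.+1.
  rewrite lt_def b0 andbT; apply/negP => /eqP b00.
  by move: p0; rewrite -h b00 mul0e ltxx.
have g1 : 0 < gamma_half n.+1.
  rewrite lt_def g0 andbT; apply/negP => /eqP b00.
  by move: p0; rewrite -h b00 mule0 ltxx.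
rewrite b1 ltNge leye_eq; apply/negP => /eqP boo.
by move: h; rewrite boo gt0_mulye.
Qed.

Definition bvol n : R := fine (ball_vol n).

Lemma bvolE n : ball_vol n.+1 = (bvol n.+1)%:E.
Proof.
by have /andP[b0 b1] := ball_vol_gt0_fin n; rewrite /bvol fineK// ge0_fin_numE// ltW.
Qed.

Lemma bvol_gt0 n : (0 < bvol n.+1)%R.
Proof. by have /andP[+ _] := ball_vol_gt0_fin n; rewrite bvolE. Qed.

Lemma Gamma_half n : Gamma (n.+3%:R / 2 : R) = (Num.sqrt pi ^+ n.+1 / bvol n.+1)%R.
Proof.
have h := ball_vol_gamma n; rewrite bvolE in h.
have b0 := bvol_gt0 n.
have gE : gamma_half n.+1 = (Num.sqrt pi ^+ n.+1 / bvol n.+1)%:E.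
  rewrite mulrC EFinM -h muleA -EFinM mulVf ?gt_eqF// mul1e//.
by rewrite /Gamma /Rintegral -[X in fine X]/(gamma_half n.+1) gE.
Qed.

End ball_volume.

(** * The Funk transform *)

Section funk.
Context {R : realType}.
Notation lam n := (@lebesgue_tuple R n).
Local Open Scope ereal_scope.

Lemma meas_perp_integral n (G : n.-tuple R -> \bar R) :
  measurable_fun setT G -> (forall x, 0 <= G x) ->
  measurable_fun setT (fun u => perp_integral u G).
Proof.
move=> mG G0; apply: (meas_integral (lam n)); first by meas.
by move=> u x; rewrite mule_ge0// lee_fin.
Qed.

Lemma perp_integral_ge0 n (u : n.-tuple R) (G : n.-tuple R -> \bar R) :
  (forall x, 0 <= G x) -> 0 <= perp_integral u G.
Proof. by move=> G0; apply: integral_ge0 => x _; rewrite mule_ge0// lee_fin. Qed.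

(** The extension of a function on the sphere that is constant along rays,
    cut off at the unit ball. *)
Definition cone_ext n (h : n.-tuple R -> \bar R) (z : n.-tuple R) : \bar R :=
  h (normalize z) * (in_pball z)%:R%:E.

Lemma meas_cone_ext n (h : n.-tuple R -> \bar R) :
  measurable_fun setT h -> measurable_fun setT (cone_ext h).
Proof.
move=> mh; have mb : measurable_fun setT (@in_pball R n) by exact: (meas_in_pball (f :=
  id)).
by rewrite /cone_ext; meas.
Qed.

Lemma cone_ext_ge0 n (h : n.-tuple R -> \bar R) z :
  (forall x, 0 <= h x) -> 0 <= cone_ext h z.
Proof. by move=> h0; rewrite mule_ge0// lee_fin. Qed.

Lemma perp_integral_cone_ext1 n (u : n.+1.-tuple R) : usphere n.+1 u ->
  perp_integral u (cone_ext (cst 1)) = ball_vol n.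
Proof.
move=> u1; pose p (s : R) : \bar R := ((0 < s)%R && (s <= 1)%R)%:R%:E.
transitivity (perp_integral u (fun z => p (dot z z))).
  by congr perp_integral; apply/funext => z; rewrite /cone_ext mul1e in_pballE.
rewrite perp_integral_radial//; last 2 first.
- by rewrite /p; meas.
- by move=> x; rewrite lee_fin.
by apply: eq_integral => z _; rewrite in_pballE.
Qed.

Lemma sphere_area n : sphere_measure n (usphere n : set (n.-tuple R)) =
  n%:R%:E * ball_vol n.
Proof.
transitivity (\int[sphere_measure n]_(x in (usphere n : set (n.-tuple R))) (cst 1 x)).
  by rewrite integral_cst ?mul1e//; exact: measurable_usphere.
rewrite sphere_integralE//; congr (_ * _).
by apply: eq_integral => z _; rewrite mul1e.
Qed.

Lemma sphere_area_gt0_fin n :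
  0 < sphere_measure n.+1 (usphere n.+1 : set (n.+1.-tuple R)) < +oo.
Proof.
by rewrite sphere_area bvolE -EFinM ltry lte_fin mulr_gt0// bvol_gt0.
Qed.

(** This is [perp_integral_sym] for [G = cone_ext h] and for [P y = |y|] on
    the unit ball. On one side [|y|] cancels the weight. On the other side
    the integral of [P] over a hyperplane is a constant [t], and the weight
    [1 / |z|] amounts to the factor [inv_weight]. *)
Lemma funk_proportional n : exists C : \bar R, forall h : n.+2.-tuple R -> \bar R,
  measurable_fun setT h -> (forall x, 0 <= h x) ->
  \int[sphere_measure n.+2]_(xi in usphere n.+2) perp_integral xi (cone_ext h) =
  C * \int[sphere_measure n.+2]_(x in usphere n.+2) h x.
Proof.
(* [P y] is [|y|] on the unit ball, as a function [p] of the square of the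
   norm. *)
pose p (s : R) : \bar R := (Num.sqrt s * ((0 < s)%R && (s <= 1)%R)%:R)%:E.
have mp : measurable_fun setT p.
  rewrite /p; apply: meas_EFin; apply: measurable_funM; last by meas.
  by apply: continuous_measurable_fun; exact: sqrt_continuous.
have p0 s : 0 <= p s by rewrite lee_fin mulr_ge0// sqrtr_ge0.
pose P (y : n.+2.-tuple R) := p (dot y y).
have mP : measurable_fun setT P by rewrite /P; meas.
have P0 y : 0 <= P y by exact: p0.
pose t := \int[lam n.+1]_z p (dot z z).
have t0 : 0 <= t by exact: integral_ge0.
have mnb : measurable_fun setT (@in_pball R n.+2) by exact: (meas_in_pball (f := id)).
exists (t * inv_weight n.+2) => h mh h0.
have mG := meas_cone_ext mh; have G0 z := cone_ext_ge0 z h0.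
set G := cone_ext h in mG G0 *.
have mT := meas_perp_integral mG G0; have T0 u := perp_integral_ge0 u G0.
rewrite !sphere_integralE//.
transitivity ((n.+2)%:R%:E * \int[lam n.+2]_y (P y * (((enorm y)^-1)%:E * perp_integral
  (normalize y) G))).
  congr (_ * _); apply: eq_integral => y _; rewrite /P /p -in_pballE muleC.
  have [yb|_] := boolP (in_pball y); last by rewrite mulr0 !mul0e.
  rewrite mulr1 mul1e muleA -EFinM divff ?mul1e//.
  by move: yb => /andP[y0 _]; rewrite gt_eqF.
rewrite perp_integral_sym// muleCA; congr (_ * _).
transitivity (\int[lam n.+2]_z (t * (h (normalize z) * (in_pball z)%:R%:E * ((enorm
  z)^-1)%:E))).
  apply: eq_integral => z _; rewrite /G /cone_ext.
  have [zb|_] := boolP (in_pball z); last by rewrite mule0 !mul0e mule0.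
  rewrite !mule1 muleA [RHS]muleC; congr (_ * _).
  rewrite (_ : perp_integral _ _ = t)//.
  by apply: perp_integral_radial => //; apply: enorm_normalize;
    move: zb => /andP[z0 _]; rewrite gt_eqF.
rewrite ge0_integralZl; [|by []| | |by []]; last 2 first.
- by meas.
- by move=> z _; rewrite !mule_ge0// lee_fin// invr_ge0 enorm_ge0.
by rewrite integral_inv_enorm// muleA.
Qed.

(** The factor of proportionality is obtained from [h = 1]. *)
Lemma funk n (h : n.+2.-tuple R -> \bar R) :
  measurable_fun setT h -> (forall x, 0 <= h x) ->
  \int[sphere_measure n.+2]_(xi in usphere n.+2) perp_integral xi (cone_ext h) =
  ball_vol n.+1 * \int[sphere_measure n.+2]_(x in usphere n.+2) h x.
Proof.
move=> mh h0; have [C HC] := funk_proportional n.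
rewrite HC//; congr (_ * _).
have /andP[A0 A1] := sphere_area_gt0_fin n.+1.
have := HC (cst 1) (measurable_cst _) (fun=> lee01).
rewrite (eq_integral (cst (ball_vol n.+1))); last first.
  by move=> xi /set_mem xi1; exact: perp_integral_cone_ext1.
rewrite !integral_cst ?mul1e; [|exact: measurable_usphere|exact: measurable_usphere].
set A := sphere_measure n.+2 _ in A0 A1 * => CA.
have Af : A \is a fin_num by rewrite ge0_fin_numE// ltW.
have Ai : A * ((fine A)^-1)%:E = 1.
  by rewrite -[X in X * _]fineK// -EFinM mulfV// gt_eqF// fine_gt0// A0.
have {}CA : ball_vol n.+1 * A = C * A by exact: CA.
rewrite -[LHS]mule1 -[RHS]mule1 -Ai [LHS]muleA [RHS]muleA; congr (_ * _).
exact: (esym CA).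
Qed.

End funk.

(** * Wallis integrals and the value of the constant *)

Section wallis.
Context {R : realType}.
Notation L := (@lebesgue_measure R).

Lemma pihalf_gt0 : 0 < pi / 2 :> R.
Proof. by rewrite divr_gt0// pi_gt0. Qed.

Lemma pihalf_le_pi : pi / 2 <= pi :> R.
Proof. by rewrite ler_pdivrMr// ler_peMr// ?pi_ge0// ler1n. Qed.

Lemma sin_pihalf_ge0 (t : R) : t \in `[0, pi / 2] -> 0 <= sin t.
Proof.
rewrite in_itv/= => /andP[t0 t1].
by rewrite sin_ge0_pi// t0 (le_trans t1)// pihalf_le_pi.
Qed.

Definition wallis j : R := \int[L]_(t in `[0, pi / 2]) (sin t ^+ j).

Lemma continuousXn (f : R -> R) j : continuous f -> continuous (fun t => f t ^+ j).
Proof.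
move=> cf t; apply: (@continuous_comp _ _ _ f (fun x : R => x ^+ j)); first exact: cf.
exact: exprn_continuous.
Qed.

Lemma continuous_sinX j : continuous (fun t : R => sin t ^+ j).
Proof. exact/continuousXn/continuous_sin. Qed.

Lemma integrable_sinX j (a b : R) : L.-integrable `[a, b] (EFin \o fun t => sin t ^+ j).
Proof.
apply: continuous_compact_integrable; first exact: segment_compact.
exact/continuous_subspaceT/continuous_sinX.
Qed.

Lemma integral_wallis j :
  (\int[L]_(t in `[0%R, (pi / 2)%R]) (sin t ^+ j)%:E = (wallis j)%:E)%E.
Proof.
rewrite /wallis /Rintegral fineK//.
by apply: (integrable_fin_num _ (integrable_sinX j 0 (pi / 2))).
Qed.

Lemma wallis0 : wallis 0 = pi / 2.
Proof.
apply: EFin_inj; rewrite -integral_wallis.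
under eq_integral do rewrite expr0.
rewrite integral_cst//= mul1e lebesgue_measure_itv/= lte_fin pihalf_gt0.
by rewrite sube0.
Qed.

Lemma wallis1 : wallis 1 = 1.
Proof.
apply: EFin_inj; rewrite -integral_wallis.
under eq_integral do rewrite expr1.
have dF (x : R) : is_derive x (1 : R) (fun x => - cos x) (sin x).
  by apply: is_derive_eq; rewrite opprK.
rewrite (integral_is_derive pihalf_gt0 (@continuous_sin R) dF).
by rewrite cos_pihalf cos0 oppr0 sub0r opprK.
Qed.

(** The difference of the integrands is the derivative of
    [- cos * sin ^+ j.+1], which vanishes at both ends. *)
Lemma wallis_rec j : j.+2%:R * wallis j.+2 = j.+1%:R * wallis j.
Proof.
pose f (x : R) : R := j.+2%:R * sin x ^+ j.+2 - j.+1%:R * sin x ^+ j.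
have cf : continuous f.
  by move=> x; apply: cvgB; apply: cvgM; try exact: cvg_cst; exact: continuous_sinX.
have dF (x : R) : is_derive x (1 : R) (fun x => - cos x * sin x ^+ j.+1) (f x).
  have d1 : is_derive x (1 : R) (- (@cos R)) (- - sin x) by exact: is_deriveN.
  have d2 := @is_deriveX _ _ (@sin R) j.+1 x 1 _ (is_derive_sin x).
  rewrite (_ : (fun x => _) = (- (@cos R)) * (@sin R) ^+ j.+1); last first.
    by apply/funext => y; rewrite fctE/= exprfctE.
  have d3 := is_deriveM d1 d2.
  apply: (is_derive_eq d3).
  rewrite /f /GRing.scale/= exprfctE opprK.
  rewrite -[(- cos) x]/(- cos x).
  have := cos2Dsin2 x; move: (sin x) (cos x) => s c cs.
  have e : c * c = 1 - s * s by rewrite -!expr2; lra.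
  rewrite -[j.+2%:R]natr1 !exprS; move: (s ^+ j) (j.+1%:R) => sj k.
  by transitivity (- (k * sj * (c * c)) + s * sj * s); [ring|rewrite e; ring].
have I0 : \int[L]_(t in `[0, pi / 2]) f t = 0.
  rewrite /Rintegral (integral_is_derive pihalf_gt0 cf dF)/=.
  by rewrite cos_pihalf sin0 expr0n/= mulr0 oppr0 mul0r addr0.
have : \int[L]_(t in `[0, pi / 2]) (f t + j.+1%:R * sin t ^+ j) = j.+1%:R * wallis j.
  rewrite RintegralD//; last 2 first.
  - by apply: continuous_compact_integrable; [exact: segment_compact
    |exact/continuous_subspaceT/cf].
  - apply: continuous_compact_integrable; [exact: segment_compact
    |apply/continuous_subspaceT].
    by move=> x; apply: cvgM; [exact: cvg_cst|exact: continuous_sinX].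
  by rewrite I0 add0r RintegralZl//; exact: integrable_sinX.
move=> <-; rewrite -RintegralZl//; last exact: integrable_sinX.
by apply: eq_Rintegral => x _; rewrite /f subrK.
Qed.

Lemma wallis_mul j : j.+1%:R * (wallis j.+1 * wallis j) = pi / 2.
Proof.
elim: j => [|j IH]; first by rewrite wallis1 wallis0 mul1r mul1r.
by rewrite mulrA wallis_rec -mulrA (mulrC (wallis j)).
Qed.

Lemma wallis_gt0 j : 0 < wallis j.
Proof.
have w0 i : 0 <= wallis i.
  by apply: Rintegral_ge0 => t /= /sin_pihalf_ge0 s0; rewrite exprn_ge0.
rewrite lt_def w0 andbT; apply/negP => /eqP w00.
by have := wallis_mul j; rewrite w00 !mulr0 => /esym/eqP; rewrite gt_eqF// pihalf_gt0.
Qed.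

(** The slice of the unit ball at the first coordinate [a] is a ball of
    radius [sqrt (1 - a^2)]; substitute [a = cos t]. *)
Lemma ball_vol_rec n : (ball_vol n.+2 : \bar R) =
  (ball_vol n.+1 * (2 * wallis n.+2)%:E)%E.
Proof.
have := @integral_dot_le R n.+1 1.
rewrite sqrtr1 expr1n mule1 => <-.
rewrite integral_tupleS; [|by meas|by move=> x; rewrite lee_fin].
pose q (a : R) : R := Num.sqrt (1 - a ^+ 2) ^+ n.+1.
have cq : continuous q.
  apply: continuousXn => a.
  apply: (@continuous_comp _ _ _ (fun a : R => 1 - a ^+ 2) Num.sqrt);
    last exact: sqrt_continuous.
  by apply: cvgB; [exact: cvg_cst|exact: exprn_continuous].
have q0 a : 0 <= q a by rewrite exprn_ge0// sqrtr_ge0.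
transitivity (\int[L]_a (ball_vol n.+1 * (q a)%:E))%E.
  apply: eq_integral => a _; rewrite -integral_dot_le.
  apply: eq_integral => x _; rewrite dot_tcons; congr ((nat_of_bool _)%:R%:E).
  by rewrite lerBrDl expr2.
rewrite ge0_integralZl; [|by []| | |exact: ball_vol_ge0]; last 2 first.
- by apply/measurable_EFinP; exact: continuous_measurable_fun.
- by move=> a _; rewrite lee_fin.
congr (_ * _)%E.
rewrite ge0_symfun_integralT//; last by move=> a /=; rewrite /q sqrrN.
rewrite EFinM -integral_wallis; congr (_ * _)%E.
transitivity (\int[L]_(a in `[0%R, 1%R]) (q a)%:E)%E.
  rewrite integral_mkcond [RHS]integral_mkcond; apply: eq_integral => a _.
  rewrite !patchE; case: ifPn => [/set_mem /= a0|].
    case: ifPn => //; rewrite notin_setE /= in_itv/= a0/= => /negP; rewrite -ltNge => a1.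
    rewrite /q ler0_sqrtr ?expr0n//= subr_le0.
    by rewrite exprn_ege1 ?ltW.
  rewrite notin_setE /= => a0; rewrite memNset//= in_itv/=.
  by have /negP/negbTE -> := a0.
have p0 : (0 <= pi / 2 :> R) by rewrite ltW// pihalf_gt0.
have dcos : (@cos R)^`()%classic = (fun x => - sin x).
  by apply/funext => y; rewrite derive1E derive_val.
rewrite -[X in `[X, _]]cos_pihalf -[X in `[_, X]]cos0.
rewrite (@integration_by_substitution_decreasing _ cos q 0 (pi / 2))//.
- apply: eq_integral => t /set_mem /= /sin_pihalf_ge0 s0; rewrite dcos.
  rewrite -[LHS]/((q (cos t) * - - sin t)%:E) opprK /q -sin2cos2 sqrtr_sqr.
  by rewrite ger0_norm -?exprSr.
- move=> x y; rewrite !in_itv/= => /andP[x0 x1] /andP[y0 y1] xy.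
  by rewrite ltr_cos// in_itv/= ?x0 ?y0/= (le_trans _ pihalf_le_pi).
- move=> x _.
  by rewrite dcos; apply: cvgN; exact: continuous_sin.
- apply/cvg_ex; exists (- sin 0).
  by rewrite dcos; apply/cvg_at_right_filter; apply: cvgN; exact: continuous_sin.
- apply/cvg_ex; exists (- sin (pi / 2)).
  by rewrite dcos; apply/cvg_at_left_filter; apply: cvgN; exact: continuous_sin.
- split; first by move=> x _; exact: ex_derive.
  + by apply/cvg_at_right_filter; exact: continuous_cos.
  + by apply/cvg_at_left_filter; exact: continuous_cos.
- exact: continuous_subspaceT.
Qed.

Lemma bvol_rec n : bvol n.+2 = bvol n.+1 * (2 * wallis n.+2) :> R.
Proof.
by apply: EFin_inj; rewrite -bvolE ball_vol_rec bvolE.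
Qed.

(** The right-hand side is the value of the quotient for the hemisphere,
    whose volume is the area of the unit sphere times [wallis m.+2], and
    whose sections all have the volume of a hemisphere of one dimension
    less. Expressed by the two ball volumes that occur in the Gamma factors,
    both sides are [2 * pi * bvol m.+1 ^+ m.+4 / bvol m.+2 ^+ m.+3]. *)
Lemma c_E m : c_ m.+3 = m.+3%:R * bvol m.+3 *
  (m.+2%:R * bvol m.+2 * wallis m.+1 / (m.+3%:R * bvol m.+3 * wallis m.+2)) ^+ m.+3 :> R.
Proof.
have b1 : bvol m.+1 != 0 :> R by rewrite gt_eqF// bvol_gt0.
have b2 : bvol m.+2 != 0 :> R by rewrite gt_eqF// bvol_gt0.
have w1 : wallis m.+1 != 0 by rewrite gt_eqF// wallis_gt0.
have w2 : wallis m.+2 != 0 by rewrite gt_eqF// wallis_gt0.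
have s0 : Num.sqrt pi != 0 :> R by rewrite gt_eqF// sqrtr_gt0 pi_gt0.
have p0 : pi != 0 :> R by rewrite gt_eqF// pi_gt0.
have S : m.+3%:R * bvol m.+3 = 2 * pi * bvol m.+1 :> R.
  have h := wallis_mul m.+2.
  rewrite (_ : pi = m.+3%:R * (wallis m.+3 * wallis m.+2) * 2); last by rewrite h; field.
  by rewrite bvol_rec (bvol_rec m); ring.
have Q : m.+2%:R * bvol m.+2 * wallis m.+1 / (m.+3%:R * bvol m.+3 * wallis m.+2) =
  bvol m.+1 / bvol m.+2 :> R.
  apply/eqP; rewrite S eqr_div//; last by rewrite !mulf_neq0.
  have h := wallis_mul m.+1.
  rewrite (_ : pi = m.+2%:R * (wallis m.+2 * wallis m.+1) * 2); last by rewrite h; field.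
  by apply/eqP; rewrite (bvol_rec m); ring.
rewrite Q S /c_ !Gamma_half.
have sq : pi = Num.sqrt pi ^+ 2 :> R by rewrite sqr_sqrtr// pi_ge0.
rewrite [in RHS]sq.
rewrite !expr_div_n -!exprM.
have -> : (m.+2 * m.+3 = m.+1 * m.+4 + 2)%N by lia.
rewrite exprD (exprS (bvol m.+1) m.+3).
have z1 : Num.sqrt pi ^+ (m.+1 * m.+4) != 0 :> R by rewrite expf_neq0.
have z2 : bvol m.+2 ^+ m.+3 != 0 :> R by rewrite expf_neq0.
have z3 : bvol m.+1 ^+ m.+3 != 0 :> R by rewrite expf_neq0.
move: (_ ^+ (m.+1 * m.+4)) (bvol m.+2 ^+ m.+3) (bvol m.+1 ^+ m.+3) z1 z2 z3 => x y z z1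
  z2 z3.
by field; rewrite z1 z2 z3 b1.
Qed.

End wallis.

(** * Radial integrals *)

Section segment_integral.
Context {R : realType}.
Notation L := (@lebesgue_measure R).

(** As the domain of integration does not depend on [r], values of [seg] are
    compared through their integrands. *)
Definition seg j r : R := \int[L]_(t in `[0, pi / 2]) ((t < r)%R%:R * sin t ^+ j).

Lemma sin_pihalf_le (s t : R) : s \in `[0, pi / 2] -> t \in `[0, pi / 2] -> s <= t ->
  sin s <= sin t.
Proof.
move=> s0 t0 st; rewrite -ler_sqr ?nnegrE ?sin_pihalf_ge0// !sin2cos2.
rewrite lerD2l lerN2 ler_sqr ?nnegrE.
- rewrite le_eqVlt; move: st; rewrite le_eqVlt => /predU1P[->|st]; first by rewrite eqxx.
  move: s0 t0; rewrite !in_itv/= => /andP[s0 s1] /andP[t0 t1].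
  by rewrite ltr_cos ?st ?orbT// in_itv/= ?s0 ?t0/= (le_trans _ pihalf_le_pi).
- move: t0; rewrite in_itv/= => /andP[h ?]; apply: cos_ge0_pihalf.
  by rewrite (le_trans _ h)//= lerNl oppr0 ltW// pihalf_gt0.
- move: s0; rewrite in_itv/= => /andP[h ?]; apply: cos_ge0_pihalf.
  by rewrite (le_trans _ h)//= lerNl oppr0 ltW// pihalf_gt0.
Qed.

Lemma sinX_le1 j (t : R) : t \in `[0, pi / 2] -> sin t ^+ j <= 1.
Proof. by move=> /sin_pihalf_ge0 s0; rewrite exprn_ile1// sin_le1. Qed.

Lemma integrable_indic_sinX j (b : R -> bool) : measurable_fun setT b ->
  L.-integrable `[0, pi / 2] (EFin \o fun t => (b t)%:R * sin t ^+ j).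
Proof.
move=> mb.
have ms : measurable_fun setT (fun t : R => sin t ^+ j).
  by apply: continuous_measurable_fun; exact: continuous_sinX.
apply: (le_integrable _ _ _ (integrable_sinX j 0 (pi / 2))) => //.
- apply: measurable_funTS; apply/measurable_EFinP.
  by apply: measurable_funM => //; exact: meas_indic.
- move=> t _ /=; rewrite lee_fin normrM ler_piMl//.
  by case: (b t); rewrite ?normr1 ?normr0.
Qed.

Lemma meas_ltc (r : R) : measurable_fun setT (fun t : R => t < r).
Proof. by meas. Qed.

Lemma meas_gec (r : R) : measurable_fun setT (fun t : R => r <= t).
Proof. by meas. Qed.

Lemma seg_split j r :
  wallis j = seg j r + \int[L]_(t in `[0, pi / 2]) ((r <= t)%R%:R * sin t ^+ j) :> R.
Proof.
rewrite /seg -RintegralD//; last 2 first.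
- exact: (integrable_indic_sinX j (meas_ltc r)).
- exact: (integrable_indic_sinX j (meas_gec r)).
apply: eq_Rintegral => t _; rewrite -mulrDl leNgt.
by case: (t < r); rewrite /= ?addr0 ?add0r mul1r.
Qed.

Lemma seg_ge0 j r : 0 <= seg j r.
Proof.
by apply: Rintegral_ge0 => t /= /sin_pihalf_ge0 s0; rewrite mulr_ge0// exprn_ge0.
Qed.

Lemma seg_le j r : seg j r <= wallis j.
Proof.
rewrite (seg_split j r) lerDl.
by apply: Rintegral_ge0 => t /= /sin_pihalf_ge0 s0; rewrite mulr_ge0// exprn_ge0.
Qed.

Lemma seg_pihalf j r : pi / 2 <= r -> seg j r = wallis j.
Proof.
rewrite le_eqVlt => /predU1P[<-|rp]; last first.
  apply: eq_Rintegral => t /set_mem /=; rewrite in_itv/= => /andP[_ tp].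
  by rewrite (le_lt_trans tp)// mul1r.
rewrite /seg /wallis /Rintegral; congr fine.
rewrite -[LHS](@integral_setD1 _ _ (pi / 2)); last 2 first.
- exact: measurableD.
- apply/measurable_EFinP; apply: measurable_funTS; apply: measurable_funM.
    by apply: meas_indic; exact: meas_ltc.
  by apply: continuous_measurable_fun; exact: continuous_sinX.
rewrite -[RHS](@integral_setD1 _ _ (pi / 2)); last 2 first.
- exact: measurableD.
- apply/measurable_EFinP; apply: measurable_funTS.
  by apply: continuous_measurable_fun; exact: continuous_sinX.
apply: eq_integral => t /set_mem /= [] /=; rewrite in_itv/= => /andP[_ tp] /eqP tn.
by rewrite lt_neqAle tn tp mul1r.
Qed.

Lemma seg0 j r : r <= 0 -> seg j r = 0.
Proof.
move=> r0; rewrite /seg /Rintegral (eq_integral (cst 0%E)) ?integral0//.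
move=> t /set_mem /=; rewrite in_itv/= => /andP[t0 _].
by rewrite ltNge (le_trans r0 t0) mul0r.
Qed.

Lemma seg_lip j (r s : R) : r <= s -> seg j r <= seg j s <= seg j r + (s - r).
Proof.
move=> rs; apply/andP; split.
  apply: le_Rintegral => //.
  - exact: (integrable_indic_sinX j (meas_ltc r)).
  - exact: (integrable_indic_sinX j (meas_ltc s)).
  - move=> t /sin_pihalf_ge0 t0; rewrite ler_wpM2r ?exprn_ge0// ler_nat.
    by have [tr|//] := ltP t r; rewrite (lt_le_trans tr rs).
have mb : measurable_fun setT (fun t : R => (r <= t) && (t < s)) by meas.
have i0 := integrable_indic_sinX 0 mb.
have e0 : (\int[L]_(t in `[0, pi / 2]) (((r <= t) && (t < s))%:R * sin t ^+ 0) <=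
  s - r)%R.
  rewrite -lee_fin /Rintegral fineK; last exact: (integrable_fin_num _ i0).
  have -> : (\int[L]_(t in `[0%R, (pi / 2)%R]) (((r <=
    t) && (t < s))%:R * sin t ^+ 0)%:E =
     \int[L]_(t in `[0%R, (pi / 2)%R]) (\1_`[r, s[ t)%:E)%E.
    apply: eq_integral => t _; rewrite expr0 mulr1 indicE; congr ((nat_of_bool _)%:R%:E).
    by rewrite mem_setE in_itv.
  rewrite integral_indic//= (le_trans (le_measure _ _ _ (@subIsetl _ _ _)))//= ?inE//.
    exact: measurableI.
  by rewrite lebesgue_measure_itv/= lte_fin; case: ifP => // _; rewrite lee_fin subr_ge0.
apply: (le_trans _ (lerD (lexx _) e0)).
rewrite /seg -RintegralD//; last exact: (integrable_indic_sinX j (meas_ltc r)).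
apply: le_Rintegral => //.
- exact: (integrable_indic_sinX j (meas_ltc s)).
- exact: (integrableD _ (integrable_indic_sinX j (meas_ltc r)) i0).
move=> t tI; have s0 := sin_pihalf_ge0 tI; have s1 := sinX_le1 j tI.
rewrite expr0 mulr1; have [tr|tr] := ltP t r.
  by rewrite (lt_le_trans tr rs) /= addr0.
by rewrite mul0r add0r; case: (t < s) => /=; rewrite ?mul1r ?mul0r.
Qed.

Lemma continuous_seg j : continuous (seg j).
Proof.
have H (x y : R) : `|seg j x - seg j y| <= `|x - y|.
  wlog xy : x y / x <= y.
    move=> hw; case: (leP x y) => [|/ltW] xy; first exact: hw.
    by rewrite distrC (distrC x); exact: hw.
  have /andP[h1 h2] := seg_lip j xy.
  by rewrite distrC (distrC x) !ger0_norm ?subr_ge0// lerBlDl.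
move=> x; apply/cvgrPdist_lt => e e0; near=> y.
rewrite (le_lt_trans (H _ _))//; near: y.
Unshelve. all: by end_near. Qed.

(** The sine is at most [sin r] before [r] and at least [sin r] after it, so
    a larger exponent favours the part after [r]. *)
Lemma seg_ratio j r : r \in `[0, pi / 2] ->
  seg j.+1 r * wallis j <= seg j r * wallis j.+1.
Proof.
move=> rI; have sr := sin_pihalf_ge0 rI.
pose B i : R := \int[L]_(t in `[0, pi / 2]) ((r <= t)%R%:R * sin t ^+ i).
have B0 i : 0 <= B i.
  by apply: Rintegral_ge0 => t /= /sin_pihalf_ge0 s0; rewrite mulr_ge0// exprn_ge0.
have h1 : seg j.+1 r <= sin r * seg j r.
  have iL := integrable_indic_sinX j (meas_ltc r).
  rewrite /seg -RintegralZl//; apply: le_Rintegral => //.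
  - exact: (integrable_indic_sinX _ (meas_ltc r)).
  - exact: (integrableZl _ _ iL).
  move=> t tI; have t0 := sin_pihalf_ge0 tI.
  rewrite exprS mulrCA; have [tr|_] := ltP t r; last by rewrite !mul0r !mulr0.
  by rewrite ler_wpM2r ?mul1r ?exprn_ge0// sin_pihalf_le// ltW.
have h2 : sin r * B j <= B j.+1.
  have iL := integrable_indic_sinX j (meas_gec r).
  rewrite /B -RintegralZl//; apply: le_Rintegral => //.
  - exact: (integrableZl _ _ iL).
  - exact: (integrable_indic_sinX _ (meas_gec r)).
  move=> t tI; have t0 := sin_pihalf_ge0 tI.
  rewrite [X in _ <= _ * X]exprS [X in _ <= X]mulrCA; have [tr|_] := leP r t;
    last by rewrite !mul0r !mulr0.
  by rewrite ler_wpM2r ?mul1r ?exprn_ge0// sin_pihalf_le.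
rewrite (seg_split j r) (seg_split j.+1 r) -!/(B _).
have q1 := ler_wpM2r (B0 j) h1; have q2 := ler_wpM2l (seg_ge0 j r) h2.
by rewrite !mulrDr; move: q1 q2; lra.
Qed.

End segment_integral.

(** * The power mean inequality *)

Section power_mean.
Context {R : realType}.

(** The graph of a convex function lies above its tangent at [c]. In the
    induction, the defect for the next exponent is [x] times the previous
    one plus a multiple of [(x - c) ^+ 2]. *)
Lemma exprn_tangent (x c : R) n : 0 <= x -> 0 <= c ->
  n.+1%:R * c ^+ n * x <= x ^+ n.+1 + n%:R * c ^+ n.+1.
Proof.
move=> x0 c0; elim: n => [|n IH]; first by rewrite expr0 mulr1 mul1r mul0r addr0 expr1.
have h : 0 <= n.+1%:R * c ^+ n * (x - c) ^+ 2.
  by rewrite mulr_ge0 ?sqr_ge0// mulr_ge0// exprn_ge0.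
have := ler_wpM2l x0 IH; rewrite -subr_ge0 => IH'.
rewrite -subr_ge0; apply: le_trans (addr_ge0 h IH') _.
rewrite le_eqVlt; apply/orP; left; apply/eqP.
rewrite -[n.+2%:R]natr1 -[n.+1%:R]natr1 !exprS; ring.
Qed.

Local Open Scope ereal_scope.

Lemma measurable_fun_expe d (T : measurableType d) (D : set T) (h : T -> \bar R) n :
  measurable_fun D h -> measurable_fun D (fun x => (h x) ^+ n).
Proof.
move=> mh; elim: n => [|n IH]; first exact: measurable_cst.
by under eq_fun do rewrite expeS; exact: emeasurable_funM.
Qed.

(** Integrate [exprn_tangent] at the mean value [c = m / A] of [h]. *)
Lemma power_mean d (T : measurableType d) (mu : {measure set T -> \bar R})
    (D : set T) (h : T -> \bar R) n (A m : R) :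
  measurable D -> measurable_fun D h -> (forall x, D x -> 0 <= h x) ->
  mu D = A%:E -> (0 < A)%R -> \int[mu]_(x in D) h x = m%:E ->
  (A * (m / A) ^+ n.+1)%:E <= \int[mu]_(x in D) (h x) ^+ n.+1.
Proof.
move=> mD mh h0 muD A0 hm.
have m0 : (0 <= m)%R by rewrite -lee_fin -hm; exact: integral_ge0.
pose c := (m / A)%R; have c0 : (0 <= c)%R by rewrite divr_ge0// ltW.
have mhn : measurable_fun D (fun x => (h x) ^+ n.+1).
  exact: measurable_fun_expe.
have hn0 x : D x -> 0 <= (h x) ^+ n.+1 by move=> Dx; rewrite expe_ge0// h0.
have c1 : 0 <= (n%:R * c ^+ n.+1)%:E by rewrite lee_fin mulr_ge0// exprn_ge0.
have c2 : 0 <= (n.+1%:R * c ^+ n)%:E by rewrite lee_fin mulr_ge0// exprn_ge0.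
have : \int[mu]_(x in D) ((n.+1%:R * c ^+ n)%:E * h x) <=
       \int[mu]_(x in D) ((h x) ^+ n.+1 + (n%:R * c ^+ n.+1)%:E).
  apply: ge0_le_integral => //.
  - by move=> x Dx; rewrite mule_ge0// h0.
  - exact: emeasurable_funM.
  - exact: emeasurable_funD.
  move=> x Dx; have := h0 _ Dx; case: (h x) => [r|_|//].
    by rewrite lee_fin => r0; rewrite -EFin_expe -EFinM -EFinD lee_fin exprn_tangent.
  by rewrite expeS/= gt0_mulye ?addye ?leey// expe_gt0.
rewrite ge0_integralZl// hm ge0_integralD//.
rewrite integral_cst// muD -!EFinM -leeBlDr// -EFinB; apply: le_trans.
rewrite lee_fin le_eqVlt; apply/orP; left; apply/eqP.
rewrite -/c (_ : m = c * A)%R; last by rewrite /c divfK ?gt_eqF.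
by rewrite -natr1 exprS; ring.
Qed.

End power_mean.

(** * Star-shaped sets and the inequality *)

Section star_shaped.
Context {R : realType}.
Notation L := (@lebesgue_measure R).

Lemma geodE n (theta : n.-tuple R) t : geod theta t = tcons (cos t, tscale (sin t) theta).
Proof. exact/val_inj. Qed.

Lemma sdist_geod_pole n (theta : n.-tuple R) t : t \in `[0, pi / 2] ->
  sdist (geod theta t) (pole n) = t.
Proof.
move=> tI; rewrite /sdist.
have -> : dot (geod theta t) (pole n) = cos t.
  rewrite geodE (_ : pole n = tcons (1, [tuple of nseq n 0])); last exact/val_inj.
  rewrite dot_tcons mulr1 /dot big1 ?addr0// => i _.
  by rewrite [tnth [tuple of nseq n 0] i](_ : _ =
    0) ?mulr0// (tnth_nth 0)/= nth_nseq ltn_ord.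
rewrite cosK//; move: tI; rewrite !in_itv/= => /andP[-> t1].
by rewrite (le_trans t1)// pihalf_le_pi.
Qed.

Section slices.
Variables (n : nat) (K : set (n.+1.-tuple R)) (sK : star_shaped K).

Let J theta := [set t | t \in `[0, pi / 2] /\ K (geod theta t)].

Lemma radialE theta : radial K theta = sup (J theta).
Proof.
rewrite /radial; congr sup; apply/seteqP; split => [d [x [Kx [t tI tx]] <-]|t [tI Kt]].
- rewrite -tx in Kx *.
  have {}tI : t \in `[0, pi / 2] by exact: tI.
  by rewrite (sdist_geod_pole _ tI); exact: (conj tI Kx).
- by exists (geod theta t); [split => //; exists t|rewrite sdist_geod_pole].
Qed.

Let J0 theta : usphere n theta -> J theta 0.
Proof.
move=> /(sK.2 _)/= [_ [_ K0]]; split => //.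
by rewrite in_itv/= lexx; exact: (ltW pihalf_gt0).
Qed.

Let Jub theta : has_ubound (J theta).
Proof. by exists (pi / 2) => t [+ _]; rewrite in_itv/= => /andP[]. Qed.

Lemma radial_itv theta : usphere n theta -> radial K theta \in `[0, pi / 2].
Proof.
move=> th; rewrite radialE in_itv/=; apply/andP; split.
  by apply: ub_le_sup; [exact: Jub|exact: J0].
apply: ge_sup; first by exists 0; exact: J0.
by move=> t [+ _]; rewrite in_itv/= => /andP[].
Qed.

Lemma star_shaped_lt_radial theta t : usphere n theta -> t \in `[0, pi / 2] ->
  t < radial K theta -> K (geod theta t).
Proof.
move=> th tI; rewrite radialE => /sup_gt[]; first by exists 0; exact: J0.
move=> s [sI Ks] ts; have [iv [I0 K0]] := sK.2 _ th.
move: tI sI; rewrite !in_itv/= => /andP[t0 t1] /andP[s0 s1].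
have ph : - (pi / 2) <= 0 :> R by rewrite lerNl oppr0 ltW// pihalf_gt0.
have Is : [set t | t \in `[- (pi / 2), pi / 2] /\ K (geod theta t)] s.
  by split => //; rewrite in_itv/= s1 (le_trans ph).
have [] := iv 0 s (conj I0 K0) Is t; last by [].
by rewrite t0 ltW.
Qed.

Lemma star_shaped_gt_radial theta t : t \in `[0, pi / 2] ->
  radial K theta < t -> ~ K (geod theta t).
Proof.
move=> tI; rewrite radialE ltNge => /negP h Kt; apply: h.
by apply: ub_le_sup; [exact: Jub|split].
Qed.

Local Open Scope ereal_scope.

(** Along a ray, [K] is the interval from the pole to the distance
    [radial K theta], up to the end point. *)
Lemma slice_integral theta j : usphere n theta ->
  \int[L]_(t in `[0%R, (pi / 2)%R]) (\1_K (geod theta t) * sin t ^+ j)%:E =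
  (seg j (radial K theta))%:E.
Proof.
move=> th; set r := radial K theta.
have mseg : measurable_fun setT (fun t : R => (((t < r)%R : bool)%:R * sin t ^+ j)%:E).
  apply/measurable_EFinP; apply: measurable_funM; first exact: meas_indic (meas_ltc r).
  by apply: continuous_measurable_fun; exact: continuous_sinX.
have E : {in `[0%R, (pi / 2)%R]%classic `\ r,
    (fun t : R => (((t < r)%R : bool)%:R * sin t ^+ j)%:E) =1
    (fun t : R => (\1_K (geod theta t) * sin t ^+ j)%:E)}.
  move=> t /set_mem [/= tI /eqP tr]; congr (_ * _)%:E; rewrite indicE.
  have [lt|gt|e] := ltgtP t r; last by rewrite e eqxx in tr.
  - by rewrite mem_set//; exact: star_shaped_lt_radial.
  - by rewrite memNset//; exact: star_shaped_gt_radial.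
rewrite -(@integral_setD1 _ _ r); last 2 first.
- exact: measurableD.
- by apply: (eq_measurable_fun _ E); exact: measurable_funTS.
transitivity (\int[L]_(t in `[0%R, (pi / 2)%R]%classic `\ r) (((t < r)%R : bool)%:R *
  sin t ^+ j)%:E).
  by apply: eq_integral => t tD; rewrite -(E t tD).
rewrite integral_setD1; last 2 first.
- exact: measurableD.
- exact: measurable_funTS.
rewrite /seg /Rintegral fineK//.
exact: (integrable_fin_num _ (integrable_indic_sinX j (meas_ltc r))).
Qed.

Lemma perp_slice xi theta t : (usphere n `&` orth xi) theta ->
  \1_(K `&` perp xi) (geod theta t) = \1_K (geod theta t) :> R.
Proof.
move=> [th ox]; rewrite !indicE; congr ((nat_of_bool _)%:R); apply/idP/idP.
  by rewrite !inE => -[].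
rewrite !inE => Kt; split => //; split; first exact: sK.1.
rewrite -[[tuple of behead _]]/(tbehead (geod theta t)) geodE behead_tcons dotZl.
by rewrite (_ : dot theta xi = 0%R)// mulr0.
Qed.

Hypothesis mK : measurable_fun (usphere n) (radial K).

(** Zero outside the sphere, so as to be measurable on the whole space
    although [radial K] is only assumed to be so on the sphere. *)
Definition radial_seg j : n.-tuple R -> \bar R :=
  (fun theta => (seg j (radial K theta))%:E) \_ (usphere n).

Lemma radial_segE j theta : usphere n theta -> radial_seg j theta =
  (seg j (radial K theta))%:E.
Proof. by move=> th; rewrite /radial_seg patchE mem_set. Qed.

Lemma radial_seg_ge0 j theta : 0 <= radial_seg j theta.
Proof. by rewrite /radial_seg patchE; case: ifP => // _; rewrite lee_fin seg_ge0. Qed.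

Lemma measurable_radial_seg j : measurable_fun setT (radial_seg j).
Proof.
apply: (measurable_restrictT _ (@measurable_usphere R n)).1.
apply/measurable_EFinP.
apply: (@measurable_comp _ _ _ _ _ _ setT) => //.
by apply: continuous_measurable_fun; exact: continuous_seg.
Qed.

Lemma vol_radial_seg : vol K =
  \int[sphere_measure n]_(theta in usphere n) radial_seg n.-1 theta.
Proof.
by apply: eq_integral => theta /set_mem th; rewrite slice_integral// radial_segE.
Qed.

Lemma hvol_radial_seg xi : usphere n xi ->
  hvol xi (K `&` perp xi) = n.-1%:R%:E * perp_integral xi (cone_ext (radial_seg n.-2)).
Proof.
move=> x1; rewrite -subsphere_integralE//; last 2 first.
- exact: measurable_radial_seg.
- exact: radial_seg_ge0.
apply: eq_integral => theta /set_mem oth.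
rewrite radial_segE; last by case: oth.
rewrite -slice_integral; last by case: oth.
by apply: eq_integral => t _; rewrite perp_slice.
Qed.

End slices.

Local Open Scope ereal_scope.

Lemma meas_hvol n (h : n.-tuple R -> \bar R) (D : set (n.-tuple R)) :
  measurable_fun setT h -> (forall x, 0 <= h x) ->
  measurable_fun D (fun xi => n.-1%:R%:E * perp_integral xi (cone_ext h)).
Proof.
move=> mh h0; apply: measurable_funTS; apply: emeasurable_funM => //.
apply: meas_perp_integral; first exact: meas_cone_ext.
by move=> x; exact: cone_ext_ge0.
Qed.

(** The mean over [xi] of the section volumes [g xi] is a multiple of [U],
    the integral of [radial_seg] with the smaller exponent; [seg_ratio]
    bounds [U] below by the volume [V], and [power_mean] passes to the power
    [m.+3]. *)
Lemma section_inequality m (K : set (m.+4.-tuple R)) : star_shaped K ->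
  measurable_fun (usphere m.+3) (radial K) ->
  (c_ m.+3)%:E * vol K ^+ m.+3 <= section_integral K.
Proof.
move=> sK mK.
pose S : set (m.+3.-tuple R) := usphere m.+3.
pose s := @sphere_measure R m.+3.
have mS : measurable S := @measurable_usphere R m.+3.
have mh j := measurable_radial_seg mK j.
pose A : R := (m.+3%:R * bvol m.+3)%R.
have A0 : (0 < A)%R by rewrite mulr_gt0// bvol_gt0.
have sA : s S = A%:E by rewrite /s /S sphere_area bvolE -EFinM.
have b2 : (0 < bvol m.+2 :> R)%R := bvol_gt0 m.+1.
have w1 := wallis_gt0 (R := R) m.+1; have w2 := wallis_gt0 (R := R) m.+2.
pose H j := \int[s]_(theta in S) radial_seg K j theta.
have Hfin j : exists2 r : R, H j = r%:E & (0 <= r)%R.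
  have H0 : 0 <= H j by apply: integral_ge0 => x _; exact: radial_seg_ge0.
  have Hoo : H j <= (wallis j * A)%:E.
    rewrite EFinM -sA -integral_cst//; apply: ge0_le_integral => //.
    - by move=> x _; exact: radial_seg_ge0.
    - exact: measurable_funTS.
    - by move=> x Sx; rewrite radial_segE// lee_fin seg_le.
  have Hf : H j \is a fin_num.
    by rewrite ge0_fin_numE// (le_lt_trans Hoo)// ltry.
  by exists (fine (H j)); rewrite ?fineK// fine_ge0.
have [V HV V0] := Hfin m.+2; have [U HU U0] := Hfin m.+1.
have VU : (V * wallis m.+1 <= U * wallis m.+2)%R.
  rewrite -lee_fin !EFinM -HV -HU /H -!ge0_integralZr; [|by []
    |exact: measurable_funTS|by move=> x _; exact: radial_seg_ge0
    |by rewrite lee_fin ltW|by []|exact: measurable_funTS|by move=> x _;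
    exact: radial_seg_ge0|by rewrite lee_fin ltW].
  apply: ge0_le_integral => //.
  - by move=> x _; rewrite mule_ge0 ?radial_seg_ge0// lee_fin ltW.
  - by apply: emeasurable_funM => //; exact: measurable_funTS.
  - by apply: emeasurable_funM => //; exact: measurable_funTS.
  move=> x Sx; rewrite !radial_segE// -!EFinM lee_fin; apply: seg_ratio.
  exact: radial_itv.
have -> : vol K = V%:E by rewrite vol_radial_seg.
pose g xi := m.+2%:R%:E * perp_integral xi (cone_ext (radial_seg K m.+1)).
have g0 xi : 0 <= g xi.
  by rewrite mule_ge0// perp_integral_ge0// => z; apply: cone_ext_ge0 => x;
    exact: radial_seg_ge0.
have -> : section_integral K = \int[s]_(xi in S) g xi ^+ m.+3.
  by apply: eq_integral => xi /set_mem xS; rewrite hvol_radial_seg.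
have mg : measurable_fun S g by apply: (meas_hvol (n := m.+3)) => // x;
  exact: radial_seg_ge0.
have gI : \int[s]_(xi in S) g xi = (m.+2%:R * bvol m.+2 * U)%:E.
  rewrite /g ge0_integralZl//; last 2 first.
  - apply: measurable_funTS; apply: meas_perp_integral; first exact: meas_cone_ext.
    by move=> x; apply: cone_ext_ge0 => y; exact: radial_seg_ge0.
  - by move=> xi _; apply: perp_integral_ge0 => x; apply: cone_ext_ge0 => y;
    exact: radial_seg_ge0.
  rewrite funk//; last by move=> y; exact: radial_seg_ge0.
  by rewrite -/s -/S -/(H m.+1) HU bvolE -!EFinM mulrA.
have pm := power_mean m.+2 mS mg (fun x _ => g0 x) sA A0 gI.
apply: (le_trans _ pm).
rewrite -EFin_expe -EFinM lee_fin c_E -/A -[X in (X <= _)%R]mulrA ler_pM2l// -exprMn.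
have Aw : (0 < A * wallis m.+2)%R by rewrite mulr_gt0.
have Kb : (0 <= m.+2%:R * bvol m.+2 :> R)%R by rewrite mulr_ge0// ltW.
apply: lerXn2r; rewrite ?nnegrE.
- apply: mulr_ge0 => //; apply: divr_ge0; last exact: ltW.
  by apply: mulr_ge0 => //; exact: ltW.
- by apply: divr_ge0; [exact: mulr_ge0|exact: ltW].
rewrite -subr_ge0.
have -> : (m.+2%:R * bvol m.+2 * U / A - m.+2%:R * bvol m.+2 * wallis m.+1 / (A *
  wallis m.+2) * V =
   m.+2%:R * bvol m.+2 / (A * wallis m.+2) * (U * wallis m.+2 - V * wallis m.+1))%R.
  by field; rewrite !gt_eqF.
by rewrite mulr_ge0 ?subr_ge0// divr_ge0// ltW.
Qed.

End star_shaped.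

(** * Oscillation on an interval *)

Section oscillation.
Context {R : realType}.
Notation L := (@lebesgue_measure R).
Local Open Scope ereal_scope.

Definition frac_lt (b x : R) : bool := (x - (Num.floor x)%:~R < b)%R.

Lemma measurable_frac_lt b : measurable_fun setT (frac_lt b).
Proof.
rewrite /frac_lt; apply: meas_lt; last by meas.
apply: measurable_funB; first by meas.
apply: nondecreasing_measurable => // x y xy.
by rewrite ler_int; exact: le_floor.
Qed.

Lemma meas_frac_lt d (X : measurableType d) (f : X -> R) b :
  measurable_fun setT f -> measurable_fun setT (fun x => frac_lt b (f x)).
Proof. by move=> mf; exact: (measurableT_comp (measurable_frac_lt b)). Qed.

Lemma integral_frac_lt_period (b y : R) : (0 <= b <= 1)%R ->
  \int[L]_u ((((0 <= u)%R && (u < 1)%R)%:R * (frac_lt b (y + u))%:R)%:E) = b%:E.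
Proof.
move=> /andP[b0 b1].
(* With [f] the fractional part of [y], that of [y + u] is [f + u] or
   [f + u - 1], so the good [u] form two intervals of total length [b]. *)
pose f := (y - (Num.floor y)%:~R)%R.
have f0 : (0 <= f)%R by rewrite subr_ge0 floor_le.
have f1 : (f < 1)%R by have := floorD1_gt y; rewrite /f intrD; lra.
have [k kE] : exists k : R, k = (Num.floor y)%:~R by eexists.
have fE : (f = y - k)%R by rewrite kE.
clearbody f.
pose m := Num.min 1%R (1 + b - f)%R.
transitivity (\int[L]_u ((\1_`[0%R, (b - f)%R[ u)%:E + (\1_`[(1 - f)%R, m[ u)%:E)).
  apply: eq_integral => u _; rewrite -EFinD; congr (_%:E).
  rewrite !indicE !mem_setE !in_itv/= /m lt_min.
  have [/andP[u0 u1]|hu] := boolP ((0 <= u)%R && (u < 1)%R); last first.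
    rewrite mul0r.
    have -> : (0 <= u < b - f)%R = false.
      apply: contraNF hu => /andP[h1 h2]; rewrite h1/=.
      by apply: (lt_le_trans h2); lra.
    have -> : [&& (1 - f <= u)%R, (u < 1)%R & (u < 1 + b - f)%R] = false.
      apply: contraNF hu => /andP[h1 /andP[-> _]]; rewrite andbT.
      by apply: (le_trans _ h1); lra.
    by rewrite addr0.
  rewrite mul1r u0 u1 /=.
  have [h|h] := leP (1 - f)%R u.
    rewrite /frac_lt (_ : Num.floor (y + u) = Num.floor y + 1)%R; last first.
      by apply: floor_def; rewrite !intrD -kE; apply/andP; split; lra.
    rewrite (_ : (u < b - f)%R = false); last by apply/negbTE; rewrite -leNgt; lra.
    by rewrite add0r/= intrD -kE; congr ((nat_of_bool _)%:R)%R; apply/idP/idP => ?; lra.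
  rewrite /frac_lt (_ : Num.floor (y + u) = Num.floor y)%R; last first.
    by apply: floor_def; rewrite !intrD -kE; apply/andP; split; lra.
  by rewrite /= addr0 -kE; congr ((nat_of_bool _)%:R)%R; apply/idP/idP => ?; lra.
rewrite ge0_integralD//; last 2 first.
- by apply/measurable_EFinP; exact: measurable_indic.
- by apply/measurable_EFinP; exact: measurable_indic.
rewrite !integral_indic//= !setIT !lebesgue_measure_itv/= !lte_fin /m.
have [h|h] := leP 1%R (1 + b - f)%R.
- case: ifPn => [h1|]; case: ifPn => [h2|]; rewrite -?leNgt -?EFinD => *;
  congr (_%:E); lra.
- case: ifPn => [h1|]; case: ifPn => [h2|]; rewrite -?leNgt -?EFinD => *;
  congr (_%:E); lra.
Qed.

Section interval.
Variables (I : R -> bool) (mI : measurable_fun setT I).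
Hypothesis iI : forall x y z, I x -> I z -> (x <= y <= z)%R -> I y.
Hypothesis bI : forall t, I t -> (`|t| <= 1)%R.

(** A shift by [s] uncovers a part of the interval that lies within [|s|] of
    one of its ends. *)
Lemma interval_shift_diff (s : R) :
  \int[L]_t (((I t && ~~ I (t - s)%R)%:R)%:E) <= `|s|%:E.
Proof.
have [[x0 Ix0]|nI] := pselect (exists x, I x); last first.
  rewrite (eq_integral (cst 0)) ?integral0 ?lee_fin// => t _.
  by case: (boolP (I t)) => // It; case: nI; exists t.
have ub : has_ubound [set t | I t] by exists 1%R => t /bI; rewrite ler_norml => /andP[].
have lb : has_lbound [set t | I t] by exists (-1)%R => t /bI;
  rewrite ler_norml => /andP[].
have ne : [set t | I t] !=set0 by exists x0.
have mD : measurable_fun setT (fun t => ((I t && ~~ I (t - s)%R)%:R : R)%:E).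
  apply: meas_EFin; apply: meas_indic; apply: measurable_and => //.
  by apply: measurable_neg; apply: (measurableT_comp mI); meas.
have key (a : R) : (forall t, I t -> ~~ I (t - s)%R -> (a <= t <= a + `|s|)%R) ->
    \int[L]_t (((I t && ~~ I (t - s)%R)%:R)%:E) <= `|s|%:E.
  move=> ha; apply: (@le_trans _ _ (\int[L]_t (\1_`[a, (a + `|s|)%R] t)%:E)).
    apply: ge0_le_integral => //.
    - by apply/measurable_EFinP; exact: measurable_indic.
    move=> t _; rewrite lee_fin indicE mem_setE in_itv/= ler_nat.
    by case: (boolP (I t)) => //= It; case: (boolP (I (t - s)%R)) => //= Is; rewrite ha.
  rewrite integral_indic//= setIT lebesgue_measure_itv/= lte_fin.
  by case: ifP => _; rewrite -?EFinB lee_fin//; lra.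
have [s0|s0] := leP 0%R s.
  apply: (key (inf [set t | I t])) => t It Is; rewrite ge_inf//=.
  rewrite leNgt; apply/negP; rewrite ger0_norm// => ts.
  have /(inf_lt ne)[y Iy yt] : (inf [set t | I t] < t - s)%R by lra.
  by move/negP: Is; apply; apply: (iI Iy It); apply/andP; split; lra.
apply: (key (sup [set t | I t] - `|s|)%R) => t It Is;
  rewrite subrK (ub_le_sup ub)// andbT.
rewrite leNgt; apply/negP; rewrite ltr0_norm// => ts.
have /(sup_gt ne)[y Iy yt] : (t - s < sup [set t | I t])%R by lra.
by move/negP: Is; apply; apply: (iI It Iy); apply/andP; split; lra.
Qed.

Variables (P b : R) (P0 : P != 0%R) (b01 : (0 <= b <= 1)%R).

Let X := \int[L]_t (((I t)%:R * (frac_lt b (P * t)%R)%:R)%:E).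
Let Y := \int[L]_t (((I t)%:R)%:E).
(* [J u] is the integral for the translated pattern, and [w] the uniform
   density on the period [[0, 1]]. *)
Let J u := \int[L]_t (((I t)%:R * (frac_lt b (P * t + u)%R)%:R)%:E).
Let w (u : R) : \bar R := (((0 <= u)%R && (u < 1)%R)%:R)%:E.

Let JE u : J u = \int[L]_t (((I (t - u / P)%R)%:R * (frac_lt b (P * t)%R)%:R)%:E).
Proof.
rewrite -(@ge0_integral_translate _ (fun t => ((I (t - u / P)%R)%:R * (frac_lt b (P *
  t)%R)%:R)%:E) (u / P)%R).
- apply: eq_integral => t _; rewrite addrK; congr (_ * (nat_of_bool (frac_lt _ _))%:R)%:E.
  by field.
- apply: meas_EFin; apply: measurable_funM; apply: meas_indic.
    by apply: (measurableT_comp mI); meas.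
  by apply: meas_frac_lt; meas.
- by move=> t; rewrite lee_fin mulr_ge0.
Qed.

Let mXt s : measurable_fun setT (fun t : R => ((I (t - s)%R)%:R * (frac_lt b (P *
  t)%R)%:R)%:E : \bar R).
Proof.
apply: meas_EFin; apply: measurable_funM; apply: meas_indic.
  by apply: (measurableT_comp mI); meas.
by apply: meas_frac_lt; meas.
Qed.

Let XE : X = \int[L]_t (((I (t - 0)%R)%:R * (frac_lt b (P * t)%R)%:R)%:E).
Proof. by apply: eq_integral => t _; rewrite subr0. Qed.

Let shift_le (s s' : R) :
  \int[L]_t (((I (t - s)%R)%:R * (frac_lt b (P * t)%R)%:R)%:E) <=
  \int[L]_t (((I (t - s')%R)%:R * (frac_lt b (P * t)%R)%:R)%:E) + `|s' - s|%:E.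
Proof.
have mI' r : measurable_fun setT (fun t : R => I (t - r)%R) by apply: (measurableT_comp
  mI); meas.
have mD : measurable_fun setT (fun t : R => ((I (t - s)%R && ~~ I (t - s')%R)%:R : R)%:E).
  apply: meas_EFin; apply: meas_indic; apply: measurable_and => //.
  exact: measurable_neg.
have D : \int[L]_t ((I (t - s)%R && ~~ I (t - s')%R)%:R)%:E <= `|s' - s|%:E.
  have := interval_shift_diff (s' - s).
  rewrite -(@ge0_integral_translate _ (fun t => ((I t && ~~ I (t - (s' - s))%R)%:R :
    R)%:E) (- s)%R).
  - apply: le_trans; rewrite le_eqVlt; apply/orP; left; apply/eqP.
    by apply: eq_integral => t _; rewrite (_ : t - s - (s' - s) = t - s')%R; [|ring].
  - apply: meas_EFin; apply: meas_indic; apply: measurable_and => //.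
    exact: measurable_neg.
  - by move=> t; rewrite lee_fin.
apply: le_trans (leeD2l _ D).
rewrite -ge0_integralD; [|by []|by move=> t _; rewrite lee_fin mulr_ge0|exact: mXt
  |by move=> t _; rewrite lee_fin|exact: mD].
apply: ge0_le_integral; [by []|by move=> t _; rewrite lee_fin mulr_ge0
  |exact: mXt|apply: emeasurable_funD; [exact: mXt|exact: mD]|].
move=> t _; rewrite -EFinD lee_fin.
by case: (I (t - s)%R); case: (I (t - s')%R); case: (frac_lt _ _);
  rewrite /= ?mulr0 ?mul0r ?mulr1 ?addr0 ?add0r.
Qed.

Let w1 : \int[L]_u w u = 1.
Proof.
transitivity (\int[L]_u (\1_`[0%R, 1%R[ u)%:E).
  by apply: eq_integral => u _; rewrite indicE mem_setE in_itv.
by rewrite integral_indic//= setIT lebesgue_measure_itv/= lte_fin ltr01 sube0.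
Qed.

Let mw : measurable_fun setT w. Proof. by rewrite /w; meas. Qed.

Let mJ2 : measurable_fun setT (fun p : R * R => ((I p.2)%:R * (frac_lt b (P * p.2 +
  p.1)%R)%:R)%:E : \bar R).
Proof.
apply: meas_EFin; apply: measurable_funM; apply: meas_indic.
  by apply: (measurableT_comp mI); meas.
by apply: meas_frac_lt; meas.
Qed.

Let mJ : measurable_fun setT J.
Proof.
by apply: (meas_integral L) => // u t; rewrite lee_fin mulr_ge0.
Qed.

Let J0 u : 0 <= J u.
Proof. by apply: integral_ge0 => t _; rewrite lee_fin mulr_ge0. Qed.

Let X0 : 0 <= X.
Proof. by apply: integral_ge0 => t _; rewrite lee_fin mulr_ge0. Qed.

Let wJ : \int[L]_u (w u * J u) = b%:E * Y.
Proof.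
transitivity (\int[L]_u \int[L]_t (w u * ((I t)%:R * (frac_lt b (P * t + u)%R)%:R)%:E)).
  apply: eq_integral => u _; rewrite ge0_integralZl; [by []|by []| |by move=> t _;
    rewrite lee_fin mulr_ge0|by rewrite lee_fin].
  by apply: (measurableT_comp mJ2 (g := fun t => (u, t))); meas.
rewrite (tonelli_swap L L); last 2 first.
- apply: emeasurable_funM; first by apply: (measurableT_comp mw); meas.
  exact: mJ2.
- by move=> u t; apply: mule_ge0; rewrite lee_fin ?mulr_ge0.
rewrite /Y -ge0_integralZl; [|by []|by apply: meas_EFin; exact: meas_indic
  |by move=> t _; rewrite lee_fin|by rewrite lee_fin; case/andP: b01].
apply: eq_integral => t _; rewrite -(integral_frac_lt_period (P * t)%R b01).
rewrite muleC -ge0_integralZl; [|by []| |by move=> u _; rewrite lee_fin mulr_ge0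
  |by rewrite lee_fin]; last first.
  apply: meas_EFin; apply: measurable_funM; apply: meas_indic; first by meas.
  by apply: (meas_frac_lt (f := fun x : R => P * t + x)%R); meas.
apply: eq_integral => u _; rewrite /w -!EFinM; congr (_%:E).
by rewrite mulrCA.
Qed.

(** Translating the pattern by [u / P], with [u] between 0 and 1, changes
    the integral over the interval by at most [1 / |P|], and the average
    over [u] is exactly [b] times the length of the interval because the
    pattern has mean [b] over a period. *)
Lemma oscillation_upper : X <= b%:E * Y + `|P|^-1%:E.
Proof.
have c0 : 0 <= `|P|^-1%:E by rewrite lee_fin invr_ge0.
have w0 u : 0 <= w u by rewrite lee_fin.
rewrite -wJ -[X in X <= _]mule1 -[X in _ + X]mule1 -w1 -!ge0_integralZl//.
rewrite -ge0_integralD; [|by []|by move=> u _; rewrite mule_ge0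
  |exact: emeasurable_funM|by move=> u _; rewrite mule_ge0|exact: emeasurable_funM].
apply: ge0_le_integral; [by []|by move=> u _; rewrite mule_ge0
  |exact: emeasurable_funM|by apply: emeasurable_funD; exact: emeasurable_funM|].
move=> u _; rewrite /w; have [/andP[u0 u1]|_] := boolP ((0 <= u)%R && (u < 1)%R);
  last by rewrite !mul0e !mule0 ?mul0e adde0.
rewrite mul1e !mule1 JE XE; apply: (le_trans (shift_le 0 (u / P))).
rewrite leeD2l// lee_fin subr0 normrM normfV ger0_norm//.
by rewrite ler_piMl ?invr_ge0// ltW.
Qed.

Lemma oscillation_lower : b%:E * Y <= X + `|P|^-1%:E.
Proof.
have c0 : 0 <= `|P|^-1%:E by rewrite lee_fin invr_ge0.
have w0 u : 0 <= w u by rewrite lee_fin.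
rewrite -wJ -[X in X + _]mule1 -[X in _ + X]mule1 -w1 -!ge0_integralZl//.
rewrite -ge0_integralD; [|by []|by move=> u _; rewrite mule_ge0
  |exact: emeasurable_funM|by move=> u _; rewrite mule_ge0|exact: emeasurable_funM].
apply: ge0_le_integral; [by []|by move=> u _; rewrite mule_ge0
  |exact: emeasurable_funM|by apply: emeasurable_funD; exact: emeasurable_funM|].
move=> u _; rewrite /w; have [/andP[u0 u1]|_] := boolP ((0 <= u)%R && (u < 1)%R);
  last by rewrite !mul0e !mule0 ?mul0e adde0.
rewrite mul1e !mule1 JE XE; apply: (le_trans (shift_le (u / P) 0)).
rewrite leeD2l// lee_fin sub0r normrN normrM normfV ger0_norm//.
by rewrite ler_piMl ?invr_ge0// ltW.
Qed.

End interval.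

End oscillation.

(** * Oscillating sets of directions *)

Section oscillating_sets.
Context {R : realType}.
Notation L := (@lebesgue_measure R).
Notation lam n := (@lebesgue_tuple R n).
Local Open Scope ereal_scope.

Section region.
Variables (j : nat) (D : j.+2.-tuple R -> bool) (mD : measurable_fun setT D).
Hypothesis iD : forall y : j.+1.-tuple R, thead y != 0%R -> forall s t u,
  D (tcons (s, y)) -> D (tcons (u, y)) -> (s <= t <= u)%R -> D (tcons (t, y)).
Hypothesis bD : forall z, D z -> (dot z z <= 1)%R.
Variables (P b : R) (P0 : (0 < P)%R) (b01 : (0 <= b <= 1)%R).

Let X := \int[lam j.+2]_z (((D z)%:R * (frac_lt b (P * (thead z / thead (tbehead
  z))))%:R)%:E).
Let Y := \int[lam j.+2]_z (((D z)%:R)%:E).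

Let mX : measurable_fun setT (fun z : j.+2.-tuple R =>
  ((D z)%:R * (frac_lt b (P * (thead z / thead (tbehead z))))%:R)%:E : \bar R).
Proof.
apply: meas_EFin; apply: measurable_funM; apply: meas_indic => //.
by apply: meas_frac_lt; meas.
Qed.

(* The error of [oscillation_upper] on the line through [y], which misses [D]
   when [y] is outside the unit ball. *)
Let err (y : j.+1.-tuple R) : \bar R := P^-1%:E * ((dot y y <= 1)%R%:R)%:E.

Let int_err : \int[lam j.+1]_y err y = P^-1%:E * ball_vol j.+1.
Proof.
rewrite /err ge0_integralZl; [|by []|by meas|by move=> y _; rewrite lee_fin
  |by rewrite lee_fin invr_ge0 ltW].
by rewrite integral_dot_le sqrtr1 expr1n mule1.
Qed.

Let err0 y : 0 <= err y. Proof. by rewrite mule_ge0// lee_fin// invr_ge0 ltW. Qed.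

Let merr : measurable_fun setT err. Proof. by rewrite /err; meas. Qed.

Let x1 y := \int[L]_a (((D (tcons (a, y)))%:R * (frac_lt b (P * (thead (tcons (a, y)) /
  thead (tbehead (tcons (a, y))))))%:R)%:E).
Let y1 y := \int[L]_a (((D (tcons (a, y)))%:R)%:E).

Let mx1 : measurable_fun setT x1.
Proof.
apply: (meas_integral L) => [|y a]; last by rewrite lee_fin mulr_ge0.
by apply: (measurableT_comp mX (g := fun p : j.+1.-tuple R * R => tcons (p.2, p.1)));
  meas.
Qed.

Let my1 : measurable_fun setT y1.
Proof.
apply: (meas_integral L) => [|y a]; last by rewrite lee_fin.
apply: meas_EFin; apply: meas_indic.
by apply: (measurableT_comp mD (g := fun p : j.+1.-tuple R * R => tcons (p.2, p.1)));
  meas.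
Qed.

Let x10 y : 0 <= x1 y. Proof. by apply: integral_ge0 => a _;
  rewrite lee_fin mulr_ge0. Qed.
Let y10 y : 0 <= y1 y. Proof. by apply: integral_ge0 => a _; rewrite lee_fin. Qed.

Let XE : X = \int[lam j.+1]_y x1 y.
Proof.
rewrite /X integral_tupleS_swap; [by []|exact: mX|].
by move=> z; rewrite lee_fin mulr_ge0.
Qed.

Let YE : Y = \int[lam j.+1]_y y1 y.
Proof.
rewrite /Y integral_tupleS_swap; [by []| |by move=> z; rewrite lee_fin].
by apply: meas_EFin; exact: meas_indic.
Qed.

Let section_bounds (y : j.+1.-tuple R) : thead y != 0%R ->
  x1 y <= b%:E * y1 y + err y /\ b%:E * y1 y <= x1 y + err y.
Proof.
move=> c0; have [y1le|y1gt] := leP (dot y y) 1%R; last first.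
  have Df a : D (tcons (a, y)) = false.
    apply/negbTE/negP => /bD; rewrite dot_tcons => h.
    by have := sqr_ge0 a; rewrite expr2 => h2; lra.
  have -> : x1 y = 0 by apply: integral0_eq => a _; rewrite Df mul0r.
  have -> : y1 y = 0 by apply: integral0_eq => a _; rewrite Df.
  by rewrite mule0 !add0e.
have mI : measurable_fun setT (fun a : R => D (tcons (a, y))).
  by apply: (measurableT_comp mD (g := fun a : R => tcons (a, y))); meas.
have bI t : D (tcons (t, y)) -> (`|t| <= 1)%R.
  move=> /bD; rewrite dot_tcons => h.
  have h2 := dot_ge0 y; rewrite -[X in (_ <= X)%R]sqrtr1 -sqrtr_sqr ler_sqrt// expr2; lra.
have P1 : (P / thead y != 0)%R by rewrite mulf_neq0 ?invr_eq0// gt_eqF.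
have th1 : (`|thead y| <= 1)%R.
  move: y1le; rewrite [y]tcons_eta dot_tcons thead_tcons => h.
  have h2 := dot_ge0 (tbehead y).
  rewrite -[X in (_ <= X)%R]sqrtr1 -sqrtr_sqr ler_sqrt// expr2; lra.
have errle : `|P / thead y|^-1%:E <= err y.
  rewrite /err y1le mule1 lee_fin normrM normfV invfM invrK gtr0_norm//.
  by rewrite ler_piMr// invr_ge0 ltW.
have x1E : x1 y = \int[L]_t (((D (tcons (t, y)))%:R * (frac_lt b (P / thead y *
  t)%R)%:R)%:E).
  apply: eq_integral => a _; rewrite thead_tcons behead_tcons.
  by congr ((_ * (nat_of_bool (frac_lt _ _))%:R)%:E); rewrite mulrCA mulrC.
rewrite x1E; split.
- apply: (le_trans (oscillation_upper mI (iD c0) bI P1 b01)); exact: leeD2l.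
- apply: (le_trans (oscillation_lower mI (iD c0) bI P1 b01)); exact: leeD2l.
Qed.

(** On the line through [y] parallel to the first axis, the ratio
    [thead z / thead (tbehead z)] runs at the constant speed [1 / thead y],
    and [oscillation_upper] has an error [|thead y| / P], at most [1 / P]
    for [y] in the unit ball. *)
Lemma region_upper : X <= b%:E * Y + P^-1%:E * ball_vol j.+1.
Proof.
have b0 : 0 <= b%:E by rewrite lee_fin; case/andP: b01.
rewrite XE YE -int_err -ge0_integralZl//.
rewrite -ge0_integralD; [|by []|by move=> y _; rewrite mule_ge0
  |exact: emeasurable_funM|by []|by []].
apply: ae_ge0_le_integral; [by []|by []|by []|by move=> y _; apply: adde_ge0 => //;
  exact: mule_ge0| |].
  by apply: emeasurable_funD => //; exact: emeasurable_funM.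
by have := @ae_thead_neq0 R j; apply: filterS => y c0 _; case: (section_bounds c0).
Qed.

Lemma region_lower : b%:E * Y <= X + P^-1%:E * ball_vol j.+1.
Proof.
have b0 : 0 <= b%:E by rewrite lee_fin; case/andP: b01.
rewrite XE YE -int_err -ge0_integralZl//.
rewrite -ge0_integralD; [|by []|by []|by []|by []|by []].
apply: ae_ge0_le_integral; [by []|by move=> y _; rewrite mule_ge0
  |exact: emeasurable_funM|by move=> y _; rewrite adde_ge0| |].
  exact: emeasurable_funD.
by have := @ae_thead_neq0 R j; apply: filterS => y c0 _; case: (section_bounds c0).
Qed.

End region.

(** The condition is on the ratio of two coordinates, so it is the same for
    all the nonzero multiples of [x]; and the first coordinate is left free,
    so that it can be eliminated on almost every hyperplane. *)
Definition osc (b : R) j (m : nat) (x : j.+3.-tuple R) : bool :=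
  frac_lt b (m.+1%:R * (thead (tbehead x) / thead (tbehead (tbehead x)))).

Lemma measurable_osc b j m : measurable_fun setT (@osc b j m).
Proof. by apply: meas_frac_lt; meas. Qed.

Lemma oscZ b j m c (x : j.+3.-tuple R) : c != 0%R -> osc b m (tscale c x) = osc b m x.
Proof.
move=> c0; rewrite [x]tcons_eta; move: (thead x) (tbehead x) => x0 {}x.
rewrite [x]tcons_eta; move: (thead x) (tbehead x) => x1 {}x.
rewrite [x]tcons_eta; move: (thead x) (tbehead x) => x2 {}x.
rewrite /osc !tscale_tcons !behead_tcons !thead_tcons.
congr (frac_lt _ (_ * _)); rewrite invfM mulrACA divff// mul1r//.
Qed.

Definition oscE (b : R) j m : j.+3.-tuple R -> \bar R := fun x => ((osc b m x)%:R)%:E.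

Lemma measurable_oscE b j m : measurable_fun setT (@oscE b j m).
Proof. by apply: meas_EFin; apply: meas_indic; exact: measurable_osc. Qed.

Lemma oscE_ge0 b j m x : 0 <= @oscE b j m x.
Proof. by rewrite lee_fin. Qed.

(** The hyperplane is a graph over the last coordinates, which are those of
    the condition [osc]. The unit ball of the hyperplane projects to an
    ellipsoid [D], to which [region_upper] and [region_lower] apply because
    it is convex. *)
Lemma perp_osc_bounds b j m (u : j.+3.-tuple R) : (0 <= b <= 1)%R ->
  usphere j.+3 u -> thead u != 0%R ->
  let e := (`|thead u|^-1 * bvol j.+1)%:E * (m.+1%:R^-1)%:E in
  perp_integral u (cone_ext (oscE b m)) <= (b * bvol j.+2)%:E + e /\
  (b * bvol j.+2)%:E <= perp_integral u (cone_ext (oscE b m)) + e.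
Proof.
rewrite [u]tcons_eta; move: (thead u) (tbehead u) => c w {u} b01 u1 c0 /=.
rewrite thead_tcons in c0 *.
have m0 : (0 < m.+1%:R :> R)%R by [].
pose g (z : j.+2.-tuple R) := tcons (- dot z w / c, z)%R.
pose D z := in_pball (g z).
have mD : measurable_fun setT D.
  by apply: (meas_in_pball (f := g)); rewrite /g; meas.
have bD z : D z -> (dot z z <= 1)%R.
  rewrite /D in_pballE /g dot_tcons => /andP[_ h].
  by have := sqr_ge0 (- dot z w / c)%R; rewrite expr2 => h2; lra.
have iD (y : j.+1.-tuple R) : thead y != 0%R -> forall s t r,
    D (tcons (s, y)) -> D (tcons (r, y)) -> (s <= t <= r)%R -> D (tcons (t, y)).
  move=> y0 s t r.
  have dw a : dot (tcons (a, y)) w = (a * thead w + dot y (tbehead w))%R.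
    by rewrite {1}[w]tcons_eta dot_tcons.
  rewrite /D !in_pballE /g !dot_tcons !dw.
  move: (thead w) (dot y (tbehead w)) => w0 p.
  have yy : (0 < dot y y)%R.
    rewrite [y]tcons_eta dot_tcons ltr_pwDl ?dot_ge0// -expr2 lt_def sqr_ge0 andbT.
    by rewrite sqrf_eq0.
  move: (dot y y) yy => d d0 /andP[_ hs] /andP[_ hr] /andP[st tr].
  (* [f t] is the square of the norm of the point of the graph above
     [(t, y)]; it is a convex quadratic function of [t]. *)
  pose f a := ((- (a * w0 + p) / c) * (- (a * w0 + p) / c) + (a * a + d))%R.
  have ft : (f t <= 1)%R.
    have [sr|sr] := ltP s r; last by have -> : t = s by lra.
    have : ((r - s) * (1 - f t) = (r - t) * (1 - f s) + (t - s) * (1 - f r) +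
       (r - t) * (t - s) * (r - s) * ((w0 / c) ^+ 2 + 1))%R.
      by rewrite /f; field.
    have q1 : (0 <= (r - t) * (1 - f s))%R by rewrite mulr_ge0 ?subr_ge0.
    have q2 : (0 <= (t - s) * (1 - f r))%R by rewrite mulr_ge0 ?subr_ge0.
    have q3 : (0 <= (r - t) * (t - s) * (r - s) * ((w0 / c) ^+ 2 + 1))%R.
      by rewrite !mulr_ge0 ?subr_ge0 ?addr_ge0 ?sqr_ge0// ltW.
    have rs0 : (0 < r - s)%R by rewrite subr_gt0.
    move=> h; rewrite -subr_ge0 -(pmulr_rge0 (1 - f t)%R rs0) h.
    by rewrite !addr_ge0.
  rewrite -/(f t) ft andbT /f.
  have := sqr_ge0 (- (t * w0 + p) / c)%R; have := sqr_ge0 t.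
  by rewrite !expr2 => *; lra.
have ci : 0 <= (`|c|^-1)%:E by rewrite lee_fin invr_ge0.
have b0 : 0 <= b%:E by rewrite lee_fin; case/andP: b01.
have GE : perp_integral (tcons (c, w)) (cone_ext (oscE b m)) =
    (`|c|^-1)%:E * \int[lam j.+2]_z (((D z)%:R * (frac_lt b (m.+1%:R * (thead z / thead
      (tbehead z))))%:R)%:E).
  rewrite perp_integral_graph; [|exact: u1|exact: c0|by apply: meas_cone_ext;
    exact: measurable_oscE|by move=> x; apply: cone_ext_ge0; exact: oscE_ge0].
  congr (_ * _); apply: eq_integral => z _;
    rewrite /cone_ext -/(g z) -/(D z) -EFinM mulrC.
  case: (boolP (D z)) => [Dz|_]; last by rewrite !mul0r.
  congr (_ * (nat_of_bool _)%:R)%:E; rewrite /normalize oscZ; last first.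
    by rewrite invr_eq0; case/andP: Dz => z0 _; rewrite gt_eqF.
  by rewrite /osc /g behead_tcons.
have YE : (`|c|^-1)%:E * \int[lam j.+2]_z (((D z)%:R)%:E) = (bvol j.+2)%:E.
  rewrite -bvolE -(perp_integral_cone_ext1 u1) perp_integral_graph; [|exact: u1
    |exact: c0|by apply: meas_cone_ext; exact: measurable_cst|by move=> x;
    apply: cone_ext_ge0 => ?; exact: lee01].
  by congr (_ * _); apply: eq_integral => z _; rewrite /cone_ext mul1e.
have eE : (`|c|^-1 * bvol j.+1)%:E * (m.+1%:R^-1)%:E =
  (`|c|^-1)%:E * (m.+1%:R^-1%:E * ball_vol j.+1).
  by rewrite bvolE -!EFinM; congr (_%:E); rewrite -mulrA (mulrC (bvol _)).
rewrite eE EFinM -YE muleCA GE.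
have i0 : 0 <= m.+1%:R^-1%:E * ball_vol j.+1 :> \bar R.
  by rewrite mule_ge0 ?ball_vol_ge0// lee_fin.
have X0 : 0 <= \int[lam j.+2]_z (((D z)%:R * (frac_lt b (m.+1%:R * (thead z / thead
  (tbehead z))))%:R)%:E).
  by apply: integral_ge0 => z _; rewrite lee_fin mulr_ge0.
have Y0 : 0 <= \int[lam j.+2]_z (((D z)%:R)%:E : \bar R).
  by apply: integral_ge0 => z _; rewrite lee_fin.
rewrite -(ge0_muleDr _ (mule_ge0 b0 Y0) i0) -(ge0_muleDr _ X0 i0).
split; apply: lee_wpmul2l => //.
- exact: (region_upper mD iD bD m0 b01).
- exact: (region_lower mD iD bD m0 b01).
Qed.

Lemma perp_osc_le b j m (u : j.+3.-tuple R) : usphere j.+3 u ->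
  perp_integral u (cone_ext (oscE b m)) <= (bvol j.+2)%:E.
Proof.
move=> u1; rewrite -bvolE -(perp_integral_cone_ext1 u1); apply: ge0_le_integral => //.
- by move=> x _; rewrite mule_ge0// ?cone_ext_ge0// ?lee_fin// => y; exact: oscE_ge0.
- have := meas_cone_ext (measurable_oscE b (j := j) m) => mc; by meas.
- have := meas_cone_ext (measurable_cst (1 : \bar R)) (n := j.+3) => mc; by meas.
move=> x _; apply: lee_wpmul2r; first by rewrite lee_fin.
rewrite /cone_ext /oscE -!EFinM lee_fin.
by case: (osc b m _); case: (in_pball _); rewrite ?mul0r ?mul1r.
Qed.

Lemma perp_osc_cvg b j (u : j.+3.-tuple R) : (0 <= b <= 1)%R ->
  usphere j.+3 u -> thead u != 0%R ->
  perp_integral u (cone_ext (oscE b m)) @[m --> \oo] --> (b * bvol j.+2)%:E.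
Proof.
move=> b01 u1 u0.
pose C := (`|thead u|^-1 * bvol j.+1)%R.
have h0 : (C * m.+1%:R^-1)%R @[m --> \oo] --> (0 : R)%R.
  rewrite -[X in _ --> X](mulr0 C); apply: cvgMr; exact: cvg_harmonic.
apply: (@squeeze_cvge _ _ _ _ (fun m => (b * bvol j.+2 - C * m.+1%:R^-1)%:E) _
  (fun m => (b * bvol j.+2 + C * m.+1%:R^-1)%:E)).
- apply: nearW => m; have [h1 h2] := perp_osc_bounds m b01 u1 u0.
  rewrite EFinB EFinD EFinM h1 andbT leeBlDr// -EFinM//.
- apply: cvg_EFin; first by apply: nearW.
  rewrite -[X in _ --> X](subr0 (b * bvol j.+2)%R); apply: cvgB => //; exact: cvg_cst.
- apply: cvg_EFin; first by apply: nearW.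
  rewrite -[X in _ --> X](addr0 (b * bvol j.+2)%R); apply: cvgD => //; exact: cvg_cst.
Qed.

Lemma sphere_ae_thead n : {ae sphere_measure n.+1, forall x : n.+1.-tuple R, thead x !=
  0%R}.
Proof.
have mN : measurable [set x : n.+1.-tuple R | thead x = 0%R].
  rewrite -[X in measurable X]setTI (_ : [set _ | _] = @thead n R @^-1` [set 0%R])//.
  have : measurable_fun setT (@thead n R) by meas.
  by apply => //; exact: measurable_set1.
exists [set x : n.+1.-tuple R | thead x = 0%R]; split => //; last first.
  by move=> x /= /negP; rewrite negbK => /eqP.
transitivity (\int[sphere_measure n.+1]_(x in usphere n.+1) (\1_[set x : n.+1.-tuple R
  | thead x = 0%R] x)%:E).
  rewrite ge0_integral_carried; [|exact: measurable_usphere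
    |exact: sphere_measure_carried| |]; last 2 first.
  - by apply/measurable_EFinP; exact: measurable_indic.
  - by move=> x; rewrite lee_fin.
  by rewrite integral_indic// setIT.
rewrite sphere_integralE; last 2 first.
- by apply/measurable_EFinP; exact: measurable_indic.
- by move=> x; rewrite lee_fin.
rewrite (_ : \int[_]_x _ = 0) ?mule0//.
rewrite (ge0_ae_eq_integral (g := cst 0)) ?integral0//.
  have mi : measurable_fun setT (fun x : n.+1.-tuple R => (\1_[set x : n.+1.-tuple R |
    thead x = 0%R] x)%:E : \bar R).
    by apply/measurable_EFinP; exact: measurable_indic.
  have mb : measurable_fun setT (@in_pball R n.+1) by exact: (meas_in_pball (f := id)).
  apply: emeasurable_funM; first exact: (measurableT_comp mi (@measurable_normalize R
    n.+1)).
  by apply: meas_EFin; exact: meas_indic.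
have := @ae_thead_neq0 R n; apply: filterS => x.
rewrite [x]tcons_eta; move: (thead x) (tbehead x) => a y; rewrite thead_tcons => a0 _.
have [|_] := boolP (in_pball _); last by rewrite mule0.
move=> /andP[z0 _]; rewrite indicE memNset ?mul0e//=.
rewrite /normalize tscale_tcons thead_tcons => /eqP.
by rewrite mulf_eq0 invr_eq0 gt_eqF//= (negbTE a0).
Qed.

(** By dominated convergence: the measures of the sections converge for
    almost every [xi] and are bounded by that of the whole subsphere. *)
Lemma section_osc_cvg b j k p : (0 <= b <= 1)%R ->
  \int[sphere_measure j.+3]_(xi in (usphere j.+3 : set (j.+3.-tuple R)))
     ((k%:R%:E * perp_integral xi (cone_ext (oscE b m))) ^+ p) @[m --> \oo] -->
  ((k%:R * (b * bvol j.+2)) ^+ p * (j.+3%:R * bvol j.+3))%:E.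
Proof.
move=> b01.
pose S : set (j.+3.-tuple R) := usphere j.+3.
have mS : measurable S := @measurable_usphere R j.+3.
have sA : sphere_measure j.+3 S = (j.+3%:R * bvol j.+3)%:E.
  by rewrite sphere_area bvolE -EFinM.
pose T m xi := perp_integral xi (cone_ext (@oscE b j m)).
have T0 m xi : 0 <= T m xi.
  by apply: perp_integral_ge0 => x; apply: cone_ext_ge0; exact: oscE_ge0.
have Tle m xi : S xi -> T m xi <= (bvol j.+2)%:E by exact: perp_osc_le.
have TE m xi : S xi -> T m xi = (fine (T m xi))%:E.
  by move=> Sx; rewrite fineK// ge0_fin_numE// (le_lt_trans (Tle m xi Sx))// ltry.
pose f m xi := (k%:R%:E * T m xi) ^+ p.
have fE m xi : S xi -> f m xi = ((k%:R * fine (T m xi)) ^+ p)%:E.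
  by move=> Sx; rewrite /f TE// -EFinM -EFin_expe.
have mf m : measurable_fun S (f m).
  apply: measurable_fun_expe; apply: emeasurable_funM => //.
  apply: measurable_funTS; apply: meas_perp_integral.
    by apply: meas_cone_ext; exact: measurable_oscE.
  by move=> x; apply: cone_ext_ge0; exact: oscE_ge0.
pose l := ((k%:R * (b * bvol j.+2)) ^+ p)%:E : \bar R.
pose g := ((k%:R * bvol j.+2) ^+ p)%:E : \bar R.
have intg : (sphere_measure j.+3).-integrable S (cst g).
  apply/integrableP; split; first exact: measurable_cst.
  have -> : \int[sphere_measure j.+3]_(x in S) `|cst g x| =
      \int[sphere_measure j.+3]_(x in S) cst (`|(k%:R * bvol j.+2) ^+ p|%R%:E) x by [].
  by rewrite integral_cst// [X in _ * X]sA -EFinM ltry.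
have b2 : (0 <= bvol j.+2 :> R)%R by apply: ltW; exact: bvol_gt0.
have cvgf : {ae sphere_measure j.+3, forall x, S x -> f ^~ x @ \oo --> cst l x}.
  have := sphere_ae_thead j.+2; apply: filterS => xi x0 Sx.
  have h := perp_osc_cvg b01 Sx x0.
  rewrite (_ : f ^~ xi = (fun m => ((k%:R * fine (T m xi)) ^+ p)%:E)); last first.
    by apply/funext => m; exact: fE.
  apply: cvg_EFin; first exact: nearW.
  have hk : (k%:R * fine (T m xi))%R @[m --> \oo] --> (k%:R * (b * bvol j.+2) : R)%R.
    by apply: cvgMr; exact: (fine_cvg h).
  exact: (cvg_comp _ _ hk (@exprn_continuous R p _)).
have dom : {ae sphere_measure j.+3, forall x m, S x -> `|f m x| <= cst g x}.
  apply: aeW => xi m Sx; rewrite fE// /g lee_fin ger0_norm; last first.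
    by rewrite exprn_ge0// mulr_ge0// fine_ge0.
  have t0 := fine_ge0 (T0 m xi).
  have tb : (fine (T m xi) <= bvol j.+2)%R by rewrite -lee_fin -TE// Tle.
  by apply: lerXn2r; rewrite ?nnegrE; [exact: mulr_ge0|exact: mulr_ge0|exact: ler_wpM2l].
have [_ _] := dominated_convergence mS mf (measurable_cst _) cvgf intg dom.
by rewrite integral_cst// [X in _ * X]sA -EFinM.
Qed.

(** By [funk] the measure of a set of directions is determined by the mean
    of the measures of its sections, which is [section_osc_cvg] with
    exponent one. *)
Lemma sphere_osc_cvg b j : (0 <= b <= 1)%R ->
  \int[sphere_measure j.+3]_(x in (usphere j.+3 : set (j.+3.-tuple R))) oscE b m x @[m
    --> \oo] -->
  (b * (j.+3%:R * bvol j.+3))%:E.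
Proof.
move=> b01; have := @section_osc_cvg b j 1 1 b01.
have b2 : (0 < bvol j.+2 :> R)%R by exact: bvol_gt0.
pose a m := \int[sphere_measure j.+3]_(x in (usphere j.+3 : set (j.+3.-tuple R))) oscE
  b m x.
rewrite (_ : (fun m => _) = (fun m => (bvol j.+2)%:E * a m)); last first.
  apply/funext => m; rewrite -bvolE -funk; [|exact: measurable_oscE|by move=> x;
    exact: oscE_ge0].
  by apply: eq_integral => xi _; rewrite -[LHS]/(1%:E * _) mul1e.
move=> /(cvgeZl (y := (bvol j.+2)^-1%:E)) => /(_ isT).
under eq_fun => m do rewrite muleA -EFinM mulVf ?gt_eqF// mul1e.
rewrite expr1 mul1r -EFinM.
set L1 := (X in _ --> X%:E -> _); set L2 := (X in _ -> _ --> X%:E).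
suff -> : L1 = L2 by [].
by rewrite /L1 /L2; field; rewrite gt_eqF.
Qed.

End oscillating_sets.

(** * Optimality of the constant *)

Section oscillating_cones.
Context {R : realType}.

Lemma geod_hemisphere n (theta : n.-tuple R) t : usphere n theta ->
  t \in `[- (pi / 2), pi / 2] -> hemisphere n (geod theta t).
Proof.
move=> th; rewrite in_itv/= => tI; split; last first.
  by rewrite geodE thead_tcons; exact: cos_ge0_pihalf.
rewrite /usphere /= /enorm geodE dot_tcons dotZl dotZr (uspherex th) mulr1 -!expr2.
by rewrite cos2Dsin2 sqrtr1.
Qed.

(** In the hemisphere, [cos r <= thead x] says that the distance from the
    pole is at most [r]. *)
Definition osc_cone (r b : R) j m : set (j.+4.-tuple R) :=
  [set x | [/\ hemisphere j.+3 x, cos r <= thead x & osc b m (tbehead x)]].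

Section membership.
Variables (r b : R) (j m : nat).
Hypotheses (rI : r \in `[0, pi / 2]) (b0 : 0 < b).
Local Notation K := (@osc_cone r b j m).

Lemma le_cos_abs t : t \in `[- (pi / 2), pi / 2] -> (cos r <= cos t) = (`|t| <= r).
Proof.
rewrite in_itv/= -ler_norml => tI; rewrite -(cos_norm t) leNgt [RHS]leNgt; congr (~~ _).
move: rI; rewrite in_itv/= => /andP[r0 r1].
by rewrite ltr_cos// in_itv/= ?normr_ge0 ?r0/= (le_trans _ pihalf_le_pi).
Qed.

Lemma osc_cone_geod (theta : j.+3.-tuple R) t : usphere j.+3 theta ->
  t \in `[- (pi / 2), pi / 2] ->
  osc_cone r b m (geod theta t) <-> `|t| <= r /\ (t = 0 \/ osc b m theta).
Proof.
move=> th tI; have hg := geod_hemisphere th tI.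
rewrite /osc_cone /= geodE thead_tcons behead_tcons le_cos_abs// -geodE.
move: tI hg; have [-> _ hg|t0 tI hg] := eqVneq t 0.
  split => [[_ h _]|[h _]]; first by split => //; left.
  split => //; rewrite sin0 /osc.
  have -> : thead (tbehead (tscale 0 theta)) = 0.
    rewrite [theta]tcons_eta tscale_tcons behead_tcons [tbehead theta]tcons_eta
      tscale_tcons.
    by rewrite thead_tcons mul0r.
  (* At the pole the ratio of coordinates is [0 / 0 = 0], and [0 < b]. *)
  by rewrite mul0r mulr0 /frac_lt floor0 subr0.
have st : sin t != 0.
  apply: contra t0 => /eqP s0; move: tI; rewrite in_itv/= -ler_norml => tI.
  have h : `|sin t| = 0 by rewrite s0 normr0.
  have [|a0] := eqVneq `|t| 0; first by move/normr0_eq0/eqP.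
  have : 0 < sin `|t|.
    apply: sin_gt0_pi; rewrite lt_def a0 normr_ge0/= (le_lt_trans tI)//.
    by rewrite ltr_pdivrMr// ltr_pMr// ?pi_gt0// ltr1n.
  have [tp|tn] := leP 0 t; first by rewrite ger0_norm// s0 ltxx.
  by rewrite ltr0_norm// sinN s0 oppr0 ltxx.
rewrite oscZ//; split => [[_ h1 h2]|[h1 [/eqP h2|h2]]].
- by split => //; right.
- by rewrite (negbTE t0) in h2.
- by split.
Qed.

Lemma star_shaped_osc_cone : star_shaped (osc_cone (j := j) r b m).
Proof.
have ph : - (pi / 2) <= 0 :> R by rewrite lerNl oppr0 ltW// pihalf_gt0.
move: (rI); rewrite in_itv/= => /andP[r0 r1].
split; first by move=> x [].
move=> theta th /=; split.
  move=> s u [sI Ks] [uI Ku] t /andP[st tu].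
  have tI : t \in `[- (pi / 2), pi / 2].
    move: sI uI; rewrite !in_itv/= => /andP[s1 s2] /andP[u1 u2].
    by rewrite (le_trans s1)//= (le_trans tu).
  split => //; apply/osc_cone_geod => //.
  have /(osc_cone_geod th sI)[s1 s2] := Ks.
  have /(osc_cone_geod th uI)[u1 u2] := Ku.
  split.
    move: s1 u1; rewrite !ler_norml => /andP[s1 _] /andP[_ u1].
    by rewrite (le_trans s1)//= (le_trans tu).
  case: s2 => [s2|]; last by right.
  case: u2 => [u2|]; last by right.
  by left; apply/eqP; rewrite eq_le -{1}u2 tu -s2.
have I0 : (0 : R) \in `[- (pi / 2), pi / 2].
  by rewrite in_itv/= ph ltW// pihalf_gt0.
split => //; apply/osc_cone_geod => //; split; first by rewrite normr0.
by left.
Qed.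

(** In a direction outside the oscillating set the cone reduces to the pole,
    whence the value 0. *)
Lemma radial_osc_cone (theta : j.+3.-tuple R) : usphere j.+3 theta ->
  radial (osc_cone (j := j) r b m) theta = r * (osc b m theta)%:R.
Proof.
have ph : - (pi / 2) <= 0 :> R by rewrite lerNl oppr0 ltW// pihalf_gt0.
move: (rI); rewrite in_itv/= => /andP[r0 r1] th; rewrite radialE.
set J := [set t | _].
have JE t : J t <-> (0 <= t <= r) && ((t == 0) || osc b m theta).
  split=> [[tI Kt]|/andP[/andP[t0 t1] h]].
    have tI' : t \in `[- (pi / 2), pi / 2].
      by move: tI; rewrite !in_itv/= => /andP[t0 ->]; rewrite (le_trans ph).
    have [h1 h2] := (osc_cone_geod th tI').1 Kt.
    move: tI; rewrite in_itv/= => /andP[t0 _]; rewrite t0 -{1}(ger0_norm t0) h1/=.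
    by case: h2 => [->|->]; rewrite ?eqxx ?orbT.
  have tI : t \in `[0, pi / 2] by rewrite in_itv/= t0 (le_trans t1).
  have tI' : t \in `[- (pi / 2), pi / 2].
    by move: tI; rewrite !in_itv/= => /andP[_ ->]; rewrite (le_trans ph).
  split => //; apply/osc_cone_geod => //; rewrite ger0_norm//; split => //.
  by case/orP: h => [/eqP|]; [left|right].
have Jr : J (r * (osc b m theta)%:R).
  by apply/JE; case: osc; rewrite ?mulr1 ?mulr0 ?r0 ?lexx ?orbT ?eqxx//=.
have Jub : ubound J (r * (osc b m theta)%:R).
  move=> t /JE; case: osc; rewrite ?mulr1 ?mulr0 ?orbT ?orbF.
    by move=> /andP[/andP[]].
  by move=> /andP[_ /eqP ->].
apply/eqP; rewrite eq_le ub_le_sup//; last by exists (r * (osc b m theta)%:R).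
by rewrite ge_sup//; exists (r * (osc b m theta)%:R).
Qed.

Lemma measurable_radial_osc_cone :
  measurable_fun (usphere j.+3) (radial (osc_cone (j := j) r b m)).
Proof.
apply: (@eq_measurable_fun _ _ _ _ _ (fun theta : j.+3.-tuple R => r * (osc b m
  theta)%:R)).
  by move=> theta /set_mem th; rewrite radial_osc_cone.
apply: measurable_funTS; apply: measurable_funM => //.
by apply: meas_indic; exact: measurable_osc.
Qed.

Local Open Scope ereal_scope.

Lemma radial_seg_osc_cone i (theta : j.+3.-tuple R) : usphere j.+3 theta ->
  radial_seg (osc_cone (j := j) r b m) i theta = (seg i r)%:E * oscE b m theta.
Proof.
move=> th; rewrite radial_segE// radial_osc_cone// /oscE -EFinM.
by case: osc; rewrite ?mulr1// !mulr0 seg0.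
Qed.

Lemma vol_osc_cone : vol (osc_cone (j := j) r b m) =
  (seg j.+2 r)%:E * \int[sphere_measure j.+3]_(x in (usphere j.+3 : set (j.+3.-tuple
    R))) oscE b m x.
Proof.
have s0 : 0 <= (seg j.+2 r)%:E by rewrite lee_fin seg_ge0.
rewrite (vol_radial_seg star_shaped_osc_cone).
rewrite -ge0_integralZl; [|exact: measurable_usphere|apply: measurable_funTS;
  exact: measurable_oscE|by move=> x _; exact: oscE_ge0|by []].
by apply: eq_integral => x /set_mem xS; exact: radial_seg_osc_cone.
Qed.

Lemma hvol_osc_cone (xi : j.+3.-tuple R) : usphere j.+3 xi ->
  hvol xi (osc_cone (j := j) r b m `&` perp xi) =
  (seg j.+1 r)%:E * (j.+2%:R%:E * perp_integral xi (cone_ext (oscE b m))).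
Proof.
move=> x1; have s0 : 0 <= (seg j.+1 r)%:E by rewrite lee_fin seg_ge0.
rewrite (hvol_radial_seg star_shaped_osc_cone measurable_radial_osc_cone x1) muleCA;
  congr (_ * _).
have mc := meas_cone_ext (measurable_oscE b (j := j) m).
rewrite /perp_integral -ge0_integralZl; [|by []|by meas| |by []]; last first.
  by move=> x _; rewrite mule_ge0 ?lee_fin// cone_ext_ge0// => y; exact: oscE_ge0.
apply: eq_integral => x _; rewrite muleA; congr (_ * _).
rewrite /cone_ext muleA; have [|_] := boolP (in_pball _); last by rewrite !mule0.
move=> /andP[z0 _]; congr (_ * _); apply: radial_seg_osc_cone.
by apply: enorm_normalize; rewrite gt_eqF.
Qed.

(** The sections grow with [r], and [wallis] is the value of [seg] for
    [r = pi / 2]. *)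
Lemma section_osc_cone_le : section_integral (osc_cone (j := j) r b m) <=
  (wallis j.+1 ^+ j.+3)%:E * \int[sphere_measure j.+3]_(xi in (usphere j.+3 : set
    (j.+3.-tuple R)))
     ((j.+2%:R%:E * perp_integral xi (cone_ext (oscE b m))) ^+ j.+3).
Proof.
have w0 : (0 <= wallis j.+1 :> R)%R by rewrite ltW// wallis_gt0.
have T0 xi : 0 <= perp_integral xi (cone_ext (@oscE R b j m)).
  by apply: perp_integral_ge0 => x; apply: cone_ext_ge0; exact: oscE_ge0.
have mT : measurable_fun (usphere j.+3) (fun xi => j.+2%:R%:E * perp_integral xi
  (cone_ext (@oscE R b j m))).
  apply: (meas_hvol (n := j.+3)); first exact: measurable_oscE.
  exact: oscE_ge0.
have kT0 xi : 0 <= j.+2%:R%:E * perp_integral xi (cone_ext (@oscE R b j m)) by exact: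
  mule_ge0.
rewrite -ge0_integralZl; [|exact: measurable_usphere|exact: measurable_fun_expe
  |by move=> xi _; exact: expe_ge0|by rewrite lee_fin exprn_ge0].
rewrite [leLHS](_ : _ = \int[sphere_measure j.+3]_(xi in (usphere j.+3 : set
  (j.+3.-tuple R)))
     (((seg j.+1 r)%:E * (j.+2%:R%:E * perp_integral xi (cone_ext (oscE b m)))) ^+
       j.+3)); last first.
  by apply: eq_integral => xi /set_mem xS; rewrite hvol_osc_cone.
apply: ge0_le_integral; [exact: measurable_usphere| | | |].
- by move=> xi _; apply: expe_ge0; rewrite mule_ge0// lee_fin seg_ge0.
- by apply: measurable_fun_expe; exact: emeasurable_funM.
- by apply: emeasurable_funM => //; exact: measurable_fun_expe.
move=> xi xS; have Tle := perp_osc_le b m xS.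
have Tf : perp_integral xi (cone_ext (oscE b m)) \is a fin_num.
  by rewrite ge0_fin_numE// (le_lt_trans Tle)// ltry.
rewrite -(fineK Tf) -!EFinM -!EFin_expe -EFinM lee_fin -exprMn.
have kt0 : (0 <= j.+2%:R * fine (perp_integral xi (cone_ext (oscE b m))) :> R)%R.
  by rewrite mulr_ge0// fine_ge0.
apply: lerXn2r; rewrite ?nnegrE.
- by apply: mulr_ge0 => //; exact: seg_ge0.
- exact: mulr_ge0.
- by apply: ler_wpM2r => //; exact: seg_le.
Qed.

End membership.

Local Open Scope ereal_scope.

Lemma vol_hemisphere j : vol (hemisphere j.+3 : set (j.+4.-tuple R)) =
  (wallis j.+2 * (j.+3%:R * bvol j.+3))%:E.
Proof.
transitivity (\int[sphere_measure j.+3]_(theta in (usphere j.+3 : set (j.+3.-tuple R)))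
  cst (wallis j.+2)%:E theta).
  apply: eq_integral => theta /set_mem th; rewrite -integral_wallis.
  apply: eq_integral => t /set_mem /= tI; rewrite indicE mem_set ?mul1r//.
  apply: geod_hemisphere => //; move: tI; rewrite !in_itv/= => /andP[t0 ->].
  by rewrite (le_trans _ t0)// lerNl oppr0 ltW// pihalf_gt0.
rewrite integral_cst; last exact: measurable_usphere.
have sA : sphere_measure j.+3 (usphere j.+3 : set (j.+3.-tuple R)) =
  (j.+3%:R * bvol j.+3)%:E.
  by rewrite sphere_area bvolE -EFinM.
by rewrite [X in _ * X]sA -EFinM.
Qed.

(** The proportion of [v] in the volume of the hemisphere is [al]; the limit
    in [m] of the upper bound of [section_osc_cone_le] for the quotient is
    [g b], and [g al] is the constant. So [b] is taken close to [al], larger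
    in order that the volume [v] be exceeded before truncation. *)
Lemma osc_cone_optimal j (v e : R) :
  (0 < v < wallis j.+2 * (j.+3%:R * bvol j.+3))%R -> (c_ j.+3 < e)%R ->
  exists K : set (j.+4.-tuple R), [/\ star_shaped K,
    measurable_fun (usphere j.+3) (radial K), vol K = v%:E &
    (v ^- j.+3)%:E * section_integral K <= e%:E].
Proof.
move=> /andP[v0 vV] ce.
pose A : R := (j.+3%:R * bvol j.+3)%R.
have A0 : (0 < A)%R by rewrite mulr_gt0// bvol_gt0.
have W0 : (0 < wallis j.+2 :> R)%R := wallis_gt0 _.
have W'0 : (0 < wallis j.+1 :> R)%R := wallis_gt0 _.
have b20 : (0 < bvol j.+2 :> R)%R := bvol_gt0 _.
pose al : R := (v / (wallis j.+2 * A))%R.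
have al0 : (0 < al)%R by rewrite divr_gt0// mulr_gt0.
have al1 : (al < 1)%R.
  by rewrite /al ltr_pdivrMr; [rewrite mul1r|exact: mulr_gt0].
pose g (b : R) : R := (v ^- j.+3 * wallis j.+1 ^+ j.+3 * ((j.+2%:R * (b * bvol j.+2))
  ^+ j.+3 * A))%R.
have gal : g al = c_ j.+3.
  have E (x y z w : R) p : (x^-1 ^+ p * y ^+ p * (z ^+ p * w) =
    w * (x^-1 * y * z) ^+ p)%R.
    by rewrite !exprMn; ring.
  rewrite c_E -/A /g -exprVn E; congr (_ * _ ^+ _)%R.
  rewrite /al.
  by field; rewrite !gt_eqF.
have cg : continuous g.
  move=> x; apply: cvgM; first exact: cvg_cst.
  apply: cvgM; last exact: cvg_cst.
  apply: (@continuousXn R (fun b => j.+2%:R * (b * bvol j.+2))%R j.+3) => y.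
  by apply: cvgM; [exact: cvg_cst|apply: cvgM; [exact: cvg_id|exact: cvg_cst]].
have [b [alb b1 gb]] : exists b, [/\ (al < b)%R, (b < 1)%R & (g b < e)%R].
  have h1 : \forall x \near al^'+, (al < x)%R by exact: nbhs_right_gt.
  have h2 : \forall x \near al^'+, (x < 1)%R by exact: nbhs_right_lt.
  have h3 : \forall x \near al^'+, (g x < e)%R.
    have : g x @[x --> al^'+] --> g al by apply: cvg_at_right_filter; exact: cg.
    by move/cvgr_lt; apply; rewrite gal.
  have [x [? [? ?]]] := filter_ex (filterI h1 (filterI h2 h3)).
  by exists x.
have b0 : (0 < b)%R by exact: lt_trans alb.
have b01 : (0 <= b <= 1)%R by rewrite !ltW.
pose a m := \int[sphere_measure j.+3]_(x in (usphere j.+3 : set (j.+3.-tuple R))) oscE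
  b m x.
pose s m := \int[sphere_measure j.+3]_(xi in (usphere j.+3 : set (j.+3.-tuple R)))
     ((j.+2%:R%:E * perp_integral xi (cone_ext (oscE b m))) ^+ j.+3).
have [m [[afin alt] [sfin slt]]] : exists m, (a m \is a fin_num /\ (al * A < fine (a
  m))%R) /\
    (s m \is a fin_num /\ (v ^- j.+3 * wallis j.+1 ^+ j.+3 * fine (s m) < e)%R).
  have /fine_cvgP[af ac] := @sphere_osc_cvg R b j b01.
  have /fine_cvgP[sf sc] := @section_osc_cvg R b j j.+2 j.+3 b01.
  have h1 : \forall m \near \oo, (al * A < fine (a m))%R.
    by move/cvgr_gt : ac; apply; rewrite ltr_pM2r.
  have h2 : \forall m \near \oo, (v ^- j.+3 * wallis j.+1 ^+ j.+3 * fine (s m) < e)%R.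
    have : (v ^- j.+3 * wallis j.+1 ^+ j.+3 * fine (s m))%R @[m --> \oo] --> g b by
      exact: cvgMr.
    by move/cvgr_lt; exact.
  have [m [[? ?] [? ?]]] := filter_ex (filterI (filterI af h1) (filterI sf h2)).
  by exists m; split; split.
have am0 : (0 < fine (a m))%R by apply: lt_trans alt; rewrite mulr_gt0.
(* Truncation at a radius [r] divides the volume by
   [wallis j.+2 / seg j.+2 r], so the intermediate value theorem for [seg]
   gives the volume [v]. *)
have [r rI rv] : exists2 r : R, r \in `[0%R, (pi / 2)%R] & seg j.+2 r =
  (v / fine (a m))%R.
  apply: IVT.
  - exact: (ltW pihalf_gt0).
  - exact/continuous_subspaceT/continuous_seg.
  rewrite seg0// seg_pihalf// (min_idPl (ltW W0)) (max_idPr (ltW W0)).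
  have vE : v = (wallis j.+2 * (al * A))%R by rewrite /al; field; rewrite !gt_eqF.
  apply/andP; split; first by rewrite divr_ge0// ltW.
  by rewrite ler_pdivrMr// [leLHS]vE ler_pM2l// ltW.
exists (osc_cone r b m); split.
- exact: star_shaped_osc_cone.
- exact: measurable_radial_osc_cone.
- by rewrite vol_osc_cone// rv -/(a m) -(fineK afin) -EFinM divfK ?gt_eqF.
have vn0 : 0 <= (v ^- j.+3)%:E by rewrite lee_fin invr_ge0 exprn_ge0// ltW.
apply: (le_trans (lee_wpmul2l vn0 (section_osc_cone_le j m rI b0))).
by rewrite -/(s m) -(fineK sfin) -!EFinM lee_fin mulrA ltW.
Qed.

End oscillating_cones.

Local Open Scope ereal_scope.

Theorem theorem6p3 (R : realType) (n : nat) (hn : (3 <= n)%N) :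
  (forall K : set (n.+1.-tuple R),
      star_shaped K -> measurable_fun (usphere n) (radial K) ->
      (c_ n)%:E * vol K ^+ n <= section_integral K) /\
  (forall v : R,
      0 < v%:E < vol (hemisphere n) ->
      ereal_inf [set ((fine (vol K)) ^- n)%:E * section_integral K
                | K in [set K : set (n.+1.-tuple R) |
                    [/\ star_shaped K,
                        measurable_fun (usphere n) (radial K) &
                        vol K = v%:E]]]
      = (c_ n)%:E).
Proof.
case: n hn => [//|[//|[//|j _]]]; split; first exact: section_inequality.
move=> v; rewrite vol_hemisphere lte_fin lte_fin => vI.
have v0 : (0 < v)%R by case/andP: vI.
apply/eqP; rewrite eq_le; apply/andP; split; last first.
  apply: le_ereal_inf_tmp => _ /= [K [sK mK vK] <-].
  have := section_inequality sK mK; rewrite vK => h.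
  have vn0 : 0 <= (v ^- j.+3)%:E by rewrite lee_fin invr_ge0 exprn_ge0// ltW.
  apply: le_trans (lee_wpmul2l vn0 h).
  rewrite -EFin_expe -!EFinM lee_fin mulrCA mulVf ?mulr1//.
  by rewrite expf_neq0// gt_eqF.
apply/lee_addgt0Pr => e e0.
have [|K [sK mK vK hK]] := @osc_cone_optimal R j v (c_ j.+3 + e)%R vI.
  by rewrite ltrDl.
rewrite -EFinD; apply: le_trans hK.
by apply: ereal_inf_lbound; exists K => //; rewrite vK.
Qed.
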